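(* Let $\alpha>0$ be irrational, and let $\mu_1,\mu_2\in\mathcal{M}_{\mathrm{loc},\mathrm{unif}}(\mathbb{R})$ be $1$-periodic and $\alpha$-periodic, respectively. Assume that there exist $B>0$ and a sequence $\bigl(\frac{p_m}{q_m}\bigr)_{m\in\mathbb{N}}$ in $\mathbb{Q}$ (with $p_m\in\mathbb{Z}$, $q_m\in\mathbb{N}=\{1,2,\dots\}$) such that $$\Bigl|\alpha-\frac{p_m}{q_m}\Bigr|\le B\,m^{-q_m}\qquad(m\in\mathbb{N}).$$ Let $\mu:=\mu_1+\mu_2$. Then $\mu$ is a weak Gordon measure with weight $C$ for all $C>0$, and $H_\mu$ does not have any eigenvalues.
   Context: A local measure on $\mathbb{R}$ is a map $\mu$ from the bounded Borel subsets of $\mathbb{R}$ to $\mathbb{C}$ such that $\mathbf{1}_K\mu:=\mu(\cdot\cap K)$ is a complex Radon measure for every compact $K\subseteq\mathbb{R}$; $|\mu|$ denotes its total variation (a nonnegative Radon measure on $\mathbb{R}$). Put $\|\mu\|_{\mathrm{unif}}:=\sup_{a\in\mathbb{R}}|\mu|((a,a+1])$, and let $\mathcal{M}_{\mathrm{loc},\mathrm{unif}}(\mathbb{R})$ be the space of all local measures $\mu$ with $\|\mu\|_{\mathrm{unif}}<\infty$. Let $W^1_\infty(\mathbb{R})$ denote the (complex-valued) Lipschitz continuous functions on $\mathbb{R}$. For $\mu\in\mathcal{M}_{\mathrm{loc},\mathrm{unif}}(\mathbb{R})$ and $I\subseteq\mathbb{R}$ define $$\|\mu\|_I:=\sup\Bigl\{\Bigl|\int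 u\,d\mu\Bigr| : u\in W^1_\infty(\mathbb{R}),\ \operatorname{spt}u\subseteq I,\ \operatorname{diam}\operatorname{spt}u\le 2,\ \|u'\|_\infty\le 1\Bigr\}.$$ For $p\in\mathbb{R}$, $\mu(\cdot+p)$ denotes the translate $B\mapsto\mu(B+p)$; $\mu$ is $p$-periodic if $\mu(\cdot+p)=\mu$. For $C>0$, $\mu$ is called a weak Gordon measure with weight $C$ if there is a sequence $(p_m)$ in $(0,\infty)$ with $p_m\to\infty$ and $\lim_{m\to\infty}e^{Cp_m}\|\mu-\mu(\cdot+p_m)\|_{[-p_m,p_m]}=0$. The operator $H_\mu$ in $L_2(\mathbb{R})$ is defined by $D(H_\mu):=\{u\in L_2(\mathbb{R})\cap C(\mathbb{R}) : -u''+u\mu\in L_2(\mathbb{R})\}$, $H_\mu u:=-u''+u\mu$, in the sense of distributions; i.e. for $u,f\in L_2(\mathbb{R})$, one has $u\in D(H_\mu)$ and $H_\mu u=f$ iff $u$ is continuous and $\int_{\mathbb{R}}f\varphi=-\int_{\mathbb{R}}u\varphi''+\int_{\mathbb{R}}u\varphi\,d\mu$ for all $\varphi\in C_c^\infty(\mathbb{R})$. *)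

(* Defs.v *)
From HB Require Import structures.
From mathcomp Require Import all_boot all_order all_algebra.
From mathcomp Require Import all_classical all_reals all_analysis.
From mathcomp Require Import ess_sup_inf.
From mathcomp Require Import complex.

Set Implicit Arguments.
Unset Strict Implicit.
Unset Printing Implicit Defensive.

Import Order.TTheory GRing.Theory Num.Theory.
Import numFieldNormedType.Exports.

Local Open Scope classical_set_scope.
Local Open Scope complex_scope.
Local Open Scope ring_scope.

(** Complex-valued functions on the real line are functions [R -> R[i]]; limits,
    derivatives, measurability and integrals are taken componentwise. *)

Section ComplexFunctions.
Context {R : realType}.
Implicit Types (u f phi : R -> R[i]) (z : R[i]) (A : set R).

(* Real-valued modulus; the library's [`|z|] has values in [R[i]]. *)
Definition cabs z : R := ComplexField.Normc.normc z.

Definition Ref f : R -> R := fun x => complex.Re (f x).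
Definition Imf f : R -> R := fun x => complex.Im (f x).

Definition ccontinuous f := continuous (Ref f) /\ continuous (Imf f).

Definition cmeasurable f :=
  measurable_fun [set: R] (Ref f) /\ measurable_fun [set: R] (Imf f).

Definition cderive1n n f : R -> R[i] :=
  fun x => (derive1n n (Ref f) x) +i* (derive1n n (Imf f) x).

Definition csmooth f :=
  forall n x, derivable (derive1n n (Ref f)) x 1 /\
              derivable (derive1n n (Imf f)) x 1.

Definition clipschitz f :=
  exists k : R, forall x y, cabs (f x - f y) <= k * `|x - y|.

Definition spt f : set R := closure [set x | f x != 0].

(* [diam set0 = -oo], which is harmless in the upper bound [diam _ <= 2]. *)
Definition diam A : \bar R :=
  ereal_sup [set z | exists x y, [/\ A x, A y & z = `|x - y|%:E]].

Definition test_function phi := csmooth phi /\ compact (spt phi).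

Definition sup_norm f : \bar R :=
  ess_sup (@lebesgue_measure R) (fun x => (cabs (f x))%:E).

Definition square_integrable f :=
  cmeasurable f /\
  (\int[@lebesgue_measure R]_x ((cabs (f x)) ^+ 2)%:E < +oo)%E.

(* [m] is only required to be a set function, so that Jordan parts of local
   measures can be used below without bundling them as measures. *)
Definition rint (m : set (measurableTypeR R) -> \bar R) (g : R -> R) : R :=
  fine (\int[m]_x (g x)%:E)%E.

Definition cint (m : set (measurableTypeR R) -> \bar R) f : R[i] :=
  (rint m (Ref f)) +i* (rint m (Imf f)).

End ComplexFunctions.

Section LocalMeasures.
Context {R : realType}.

(* A map on bounded Borel sets is given as a total set function; every notion
   below reads off its values on bounded Borel sets only. *)
Definition set_function := set (measurableTypeR R) -> R[i].
Implicit Types (mu : set_function) (A B : set (measurableTypeR R)).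

Definition bounded_borel B := measurable B /\ bounded_set (B : set R).

(* Countable additivity with finite values; a complex Borel measure on the real
   line is automatically regular, so this is a complex Radon measure. *)
Definition complex_measure mu :=
  semi_sigma_additive (fun B => (complex.Re (mu B))%:E) /\
  semi_sigma_additive (fun B => (complex.Im (mu B))%:E).

Definition local_measure mu :=
  forall K : set R, compact K -> complex_measure (fun B => mu (B `&` K)).

(* Total variation of a complex local measure, via countable Borel partitions; to
   be evaluated on bounded Borel sets only. *)
Definition measure_variation mu A : \bar R :=
  ereal_sup [set (\sum_(0 <= k <oo) (cabs (mu (F k)))%:E)%E |
    F in [set F : (set (measurableTypeR R))^nat |
      [/\ forall k, measurable (F k), trivIset setT F &
          \bigcup_k F k = A]]].

Definition unif_norm mu : \bar R :=
  ereal_sup [set measure_variation mu `]a, a + 1] | a in [set: R]].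

Definition Mlocunif mu := local_measure mu /\ (unif_norm mu < +oo)%E.

(* Jordan decomposition of a real-valued local measure [nu]: the positive part is
   [A |-> sup {nu B | B subset of A}], a nonnegative Radon measure. *)
Definition pos_part (nu : set (measurableTypeR R) -> R) A : \bar R :=
  ereal_sup [set (nu B)%:E | B in [set B | bounded_borel B /\ B `<=` A]].

Definition neg_part (nu : set (measurableTypeR R) -> R) : _ -> \bar R :=
  pos_part (fun B => - nu B).

(* The integral of a compactly supported continuous [u] against a local measure. *)
Definition lint mu (u : R -> R[i]) : R[i] :=
  let re B := complex.Re (mu B) in
  let im B := complex.Im (mu B) in
  (cint (pos_part re) u - cint (neg_part re) u) +
  (0 +i* 1) * (cint (pos_part im) u - cint (neg_part im) u).

(* A Lipschitz [u] is differentiable almost everywhere, so the essential supremum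
   of [u'] does not see the junk values of the derivative elsewhere. *)
Definition lip_test (I : set R) (u : R -> R[i]) :=
  [/\ clipschitz u, spt u `<=` I, (diam (spt u) <= 2%:E)%E &
      (sup_norm (cderive1n 1 u) <= 1)%E].

Definition norm_on (I : set R) mu : \bar R :=
  ereal_sup [set (cabs (lint mu u))%:E | u in lip_test I].

Definition measure_translate (p : R) mu : set_function :=
  fun B => mu [set x + p | x in B].

Definition periodic_measure (p : R) mu :=
  forall B, bounded_borel B -> measure_translate p mu B = mu B.

Definition weak_gordon (C : R) mu :=
  Mlocunif mu /\
  exists p : R^nat,
    [/\ forall m, 0 < p m,
        p m @[m --> \oo] --> +oo%R &
        ((expR (C * p m))%:E *
          norm_on `[(- p m)%R, p m] (mu \- measure_translate (p m) mu)%R)%E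
          @[m --> \oo] --> 0%E].

End LocalMeasures.
Arguments set_function : clear implicits.

Section SchroedingerOperator.
Context {R : realType}.
Implicit Types (mu : set_function R) (u f : R -> R[i]).

(* The graph of the operator: [u] is in the domain and is mapped to [f]. Elements
   of L2 are represented by functions, [u] by its (unique) continuous
   representative, [f] by any representative. *)
Definition schroedinger mu u f :=
  [/\ square_integrable u, square_integrable f, ccontinuous u &
      forall phi, test_function phi ->
        cint (@lebesgue_measure R) (fun x => f x * phi x) =
        - cint (@lebesgue_measure R) (fun x => u x * cderive1n 2 phi x)
        + lint mu (fun x => u x * phi x)].

Definition schroedinger_eigenvalue mu (lambda : R[i]) :=
  exists u, schroedinger mu u (fun x => lambda * u x) /\
    ~ {ae @lebesgue_measure R, forall x, u x = 0}.

End SchroedingerOperator.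

(* Main.v *)
From HB Require Import structures.
Require Import Defs.
From mathcomp Require Import all_boot all_order all_algebra.
From mathcomp Require Import all_classical all_reals all_analysis.
From mathcomp Require Import measurable_realfun ess_sup_inf complex.
From mathcomp Require Import ring lra zify.

Import Order.TTheory GRing.Theory Num.Theory.
Import numFieldNormedType.Exports.
Set Implicit Arguments.
Unset Strict Implicit.
Unset Printing Implicit Defensive.

Local Open Scope classical_set_scope.
Local Open Scope complex_scope.
Local Open Scope ring_scope.

(** Write [P = p_m], [Q = q_m] and [d = P - Q * alpha]. As [alpha] is irrational, each
denominator occurs only finitely often, so [q_m] tends to infinity and [m^(- q_m)] beats every
exponential [c^(- q_m)]. Hence, for every [n], the product [e^(n P) |d|] becomes arbitrarily
small with [P] arbitrarily large ([superexponential_approx]); this is the only arithmetic that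
enters.

Weak Gordon property. [P] is a multiple of the period of [mu1] and [Q * alpha] one of the
period of [mu2], so that [mu - mu(. + P) = mu2 - mu2(. + d)]. Integrating [u] against the
latter is integrating [u - u(. - d)] against [mu2]. An almost everywhere bound on the
derivative of a Lipschitz function is a bound on its Lipschitz constant
([lipschitz_deriv_le1]), so this integral is at most a constant times [|d|].

No eigenvalues. Let [N(x) = mu(]0, x]) - kappa x], where [kappa] is the sum of the mean
densities of [mu1] and [mu2]. Then [N = N1 + N2] with [N1] of period [1], [N2] of period
[alpha], both bounded. If [- u'' + u mu = lambda u], the quasi-derivative [v = u' - N u] is
absolutely continuous although [u'] may jump, and with [E = lambda - kappa]
  [u' = v + N u],   [v' = - (N v + (N^2 + E) u)]
([weak_derivative], [quasi_derivative]). The coefficients of this system are bounded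
functions, and [N(x + P) - N(x) = N2(x + d) - N2(x)] is small in the mean: its integral over
[[0, P]] is at most a constant times [(P + 2) |d|]. A square integrable [u] makes [u] and [v]
vanish at infinity ([sol_decay]).

The Gordon argument ([gordon_argument]) works with the three vectors [w_j = (u, v)(j P)],
[j = 0, 1, 2], and the two-by-two determinants [om = W(w_1, w_0)], [om' = W(w_2, w_1)] and
[th = W(w_2, w_0)]. They satisfy [om w_2 - th w_1 + om' w_0 = 0]. The same combination of
[(u, v)(. + P)], [(u, v)] and [(u, v)(. - P)] nearly solves the system on [[0, P]] and
vanishes at [P], so it is small at [0] by Gronwall, the factor [e^(C P)] being absorbed by
[|d|]; that is, [om w_1 - th w_0 + om' w_(-1)] is small. The Wronskian of a solution and its
translate hardly varies over a period ([wronskian_drift]), so that [om'] is close to [om].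
Comparing [|th|] with [|om|], one of the two relations bounds [|om| |w_0|] by [|om|] times the
norms of [w_1], [w_2], [w_(-1)], up to a tiny error. As the latter norms tend to [0] while
[w_0] is fixed, either [w_0 = 0] or [om] is tiny. In the second case the combinations
[u(0) (u, v) - u(P) (u, v)(. - P)] and [v(0) (u, v) - v(P) (u, v)(. - P)], whose values at [P]
have size [|om|], are again propagated back to [0] and give
[|w_0|^2 <= |w_1| |w_(-1)| + tiny]. So [w_0 = 0] in all cases, and [u = 0] by uniqueness.
The argument involves only the given solution and its translates. *)

(** * Real local measures and their Jordan decomposition *)

Section RealLocalMeasure.
Context {R : realType}.
Implicit Types (nu : set (measurableTypeR R) -> R) (A B : set R).

Definition has_bound (B : set R) := exists L : R, forall x, B x -> `|x| <= L.

Lemma bounded_setP B : bounded_set B <-> has_bound B.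
Proof.
split=> [[M [_ MB]]|[L BL]].
  exists (M + 1) => x Bx; apply: (MB (M + 1)) => //; by rewrite ltrDl.
exists L; split => [|M LM x Bx] /=; first exact: num_real.
exact: le_trans (BL _ Bx) (ltW LM).
Qed.

Lemma has_bound_sub A B : A `<=` B -> has_bound B -> has_bound A.
Proof. by move=> AB [L BL]; exists L => x /AB /BL. Qed.

Lemma has_boundU A B : has_bound A -> has_bound B -> has_bound (A `|` B).
Proof.
move=> [L AL] [L' BL']; exists (Num.max L L') => x [/AL|/BL'] h;
  by rewrite le_max h ?orbT.
Qed.

Lemma has_bound_oc (a b : R) : has_bound `]a, b].
Proof.
exists (`|a| + `|b|) => x; rewrite /= in_itv /= => /andP[ax xb].
have := ler_norm b; have := ler_norm (- a); rewrite normrN ler_norml => h1 h2.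
have := normr_ge0 a; have := normr_ge0 b => h3 h4.
by apply/andP; split; lra.
Qed.

(** Countable additivity on bounded Borel sets together with a uniform bound on the subsets of
unit intervals; the latter replaces the total variation. *)
Record rlocal nu : Prop := {
  rlocal_sigma : forall F : (set (measurableTypeR R))^nat,
    (forall i, measurable (F i)) -> trivIset setT F -> has_bound (\bigcup_n F n) ->
    (fun n => \sum_(0 <= i < n) nu (F i)) @ \oo --> nu (\bigcup_n F n);
  rlocal_bound : exists U : R, forall (a : R) (B : set (measurableTypeR R)),
    measurable B -> B `<=` `]a, a + 1] -> `|nu B| <= U }.

Section Jordan.
Variable nu : set (measurableTypeR R) -> R.
Hypothesis nuP : rlocal nu.

Lemma rlocal0 : nu set0 = 0.
Proof.
have U0 : \bigcup_(n : nat) (set0 : set (measurableTypeR R)) = set0 by rewrite bigcup0.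
have b0 : has_bound (\bigcup_(n : nat) (set0 : set R)) by rewrite U0; exists 0.
have t0 : trivIset setT (fun _ : nat => set0 : set (measurableTypeR R)).
  by move=> i j _ _ [x []].
have := rlocal_sigma nuP (F := fun=> set0) (fun=> measurable0) t0 b0; rewrite U0.
set u := (fun n => _) => /= cu.
have cu1 := cu; rewrite -(cvg_shiftS u) in cu1.
have := cvgB cu1 cu; rewrite subrr => h.
have e : (fun n => u n.+1 - u n) = (fun=> nu set0).
  by apply/funext => n; rewrite /u big_nat_recr//= addrAC subrr add0r.
have {}h : (fun n => u n.+1 - u n) @ \oo --> (0 : R) by exact: h.
rewrite e in h.
 apply/esym; apply: (cvg_unique _ h); [exact: norm_hausdorff|exact: cvg_cst].
Qed.

Lemma rlocalU (A B : set (measurableTypeR R)) :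
  measurable A -> measurable B -> has_bound A -> has_bound B -> A `&` B = set0 ->
  nu (A `|` B) = nu A + nu B.
Proof.
move=> mA mB bA bB AB.
have := rlocal_sigma nuP (F := bigcup2 A B) _ _ _; rewrite bigcup2E => h.
have {}h := h (fun i => ltac:(case: i => [|[|i]] //=)) ltac:(by rewrite -trivIset_bigcup2) (has_boundU bA bB).
rewrite -(cvg_shiftn 2) in h; set u := (fun n => _) in h.
have e : u = fun=> nu A + nu B.
  apply/funext => n; rewrite /u addn2 big_nat_recl// big_nat_recl//= big1 ?addr0//.
  by move=> i _; rewrite rlocal0.
rewrite e in h; apply: (cvg_unique _ h); [exact: norm_hausdorff|exact: cvg_cst].
Qed.

Let pp := pos_part nu.

Lemma le_pos_part A B : A `<=` B -> (pp A <= pp B)%E.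
Proof.
by move=> AB; apply: ub_ereal_sup => _ [C [bC CA] <-];
   apply: ereal_sup_ubound; exists C => //; split => //; exact: subset_trans AB.
Qed.

Lemma pos_part_ub A B : measurable A -> has_bound A -> A `<=` B -> ((nu A)%:E <= pp B)%E.
Proof.
by move=> mA bA AB; apply: ereal_sup_ubound; exists A => //; split => //; split => //;
  apply/bounded_setP.
Qed.

Lemma pos_part_ge0 A : (0 <= pp A)%E.
Proof.
rewrite -[0%E]/(0%:E) -rlocal0; apply: pos_part_ub => //; by exists 0.
Qed.

Lemma pos_part0 : pp set0 = 0%E.
Proof.
apply/eqP; rewrite eq_le pos_part_ge0 andbT; apply: ub_ereal_sup => _ [C [_ C0] <-].
by move: C0; rewrite subset0 => ->; rewrite rlocal0.
Qed.

(** Subsets of two disjoint sets are disjoint, so their values add up to the value of a subset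
of the union. The infinite case is split off because suprema are then moved across the
inequality by subtraction. *)
Lemma pos_part_superadd A B : A `&` B = set0 -> (pp A + pp B <= pp (A `|` B))%E.
Proof.
move=> AB.
have [->|fin] := eqVneq (pp (A `|` B)) +oo%E; first by rewrite leey.
have fAB : pp (A `|` B) \is a fin_num by rewrite ge0_fin_numE ?pos_part_ge0 // ltey.
have le1 : (pp A <= pp (A `|` B))%E by apply: le_pos_part; exact: subsetUl.
have le2 : (pp B <= pp (A `|` B))%E by apply: le_pos_part; exact: subsetUr.
have fB : pp B \is a fin_num.
  by rewrite ge0_fin_numE ?pos_part_ge0 //; apply: le_lt_trans le2 _; rewrite ltey.
rewrite -leeBrDr//; apply: ub_ereal_sup => _ [C [[mC /bounded_setP bC] CA] <-].
rewrite leeBrDr// addeC -leeBrDr//; apply: ub_ereal_sup => _ [D [[mD /bounded_setP bD] DB] <-].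
rewrite leeBrDr// -EFinD addrC -rlocalU//.
  apply: pos_part_ub; [exact: measurableU|exact: has_boundU|exact: setUSS].
by apply/seteqP; split => // x [/CA Ax /DB Bx]; rewrite -AB.
Qed.

(** The inequality from below is superadditivity of the finite unions; from above, a competitor
[B] for the union is cut into the pieces [B `&` F i], each a competitor for [F i]. *)
Lemma pos_part_sigma : semi_sigma_additive (pp : set (measurableTypeR R) -> \bar R).
Proof.
move=> F mF tF mUF.
suff <- : (\sum_(0 <= k <oo) pp (F k))%E = pp (\bigcup_n F n).
  by apply: is_cvg_nneseries => n _ _; exact: pos_part_ge0.
apply/eqP; rewrite eq_le; apply/andP; split.
  apply: lime_le; first by apply: is_cvg_nneseries => n _ _; exact: pos_part_ge0.
  near=> n.
  apply: (@le_trans _ _ (pp (\big[setU/set0]_(0 <= i < n) F i))); last first.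
    by apply: le_pos_part; rewrite big_mkord; exact: bigsetU_bigcup.
  elim: (n) => [|m IH]; first by rewrite !big_geq// pos_part0.
  rewrite !big_nat_recr//=; apply: le_trans (pos_part_superadd _); first exact: leeD2r.
  rewrite big_mkord; apply/seteqP; split => // x [].
  rewrite -bigcup_mkord => -[i /= im Fix] Fmx.
  have e : i = m by apply: (tF i m) => //; exists x.
  by rewrite e ltnn in im.
apply: ub_ereal_sup => _ [B [[mB /bounded_setP bB] BF] <-].
have := rlocal_sigma nuP (F := fun i => B `&` F i) (fun i => measurableI _ _ mB (mF i)) (trivIset_setIl tF).
rewrite -setI_bigcupr (setIidl BF) => /(_ bB) h.
have {}h : (fun n => (\sum_(0 <= i < n) nu (B `&` F i))%:E) @ \oo --> (nu B)%:E.
  by apply: cvg_EFin => //; near=> n.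
rewrite -(cvg_lim _ h) //; apply: lee_lim.
- by apply/cvg_ex; exists (nu B)%:E.
- by apply: is_cvg_nneseries => n0 _ _; exact: pos_part_ge0.
near=> n; rewrite -sumEFin; apply: lee_sum => i _; apply: pos_part_ub.
- exact: (measurableI _ _ mB (mF i)).
- by apply: has_bound_sub bB; exact: subIsetl.
- exact: subIsetr.
Unshelve. all: by end_near. Qed.

(** Makes the proof of locality part of the term, so that the measure structure below can be
found by inference. *)
Definition pos_part_measure (_ : rlocal nu) := pp.

HB.instance Definition _ := isMeasure.Build _ (measurableTypeR R) R (pos_part_measure nuP)
  pos_part0 pos_part_ge0 pos_part_sigma.

End Jordan.
End RealLocalMeasure.

(** * Integrals of locally bounded functions over half-open intervals *)

Section LocallyBounded.
Context {R : realType}.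
Implicit Types (f g : R -> R) (a b c : R).

(** The class of integrands: it contains the continuous functions, the monotone functions and
their products, and is integrable on bounded intervals for all measures that occur. *)
Definition lbm f := measurable_fun [set: R] f /\
  forall L : R, exists C : R, forall x, `|x| <= L -> `|f x| <= C.

Lemma lbm_itv f a b : lbm f -> exists2 C : R, 0 <= C & forall x, a <= x -> x <= b -> `|f x| <= C.
Proof.
move=> [_ /(_ (Num.max `|a| `|b|))[C fC]]; exists (Num.max 0 C); first by rewrite le_max lexx.
move=> x ax xb; rewrite le_max fC ?orbT// le_max.
have := ler_norm b; have := ler_norm (- a); rewrite normrN => h1 h2.
have := normr_ge0 a; have := normr_ge0 b => h3 h4.
by have [x0|x0] := lerP 0 x; apply/orP; [right|left]; rewrite ler_norml; apply/andP; split; lra.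
Qed.

Lemma lbm_cst c : lbm (fun=> c).
Proof. by split=> [|L]; [exact: measurable_cst|exists `|c|]. Qed.

Lemma lbmD f g : lbm f -> lbm g -> lbm (fun x => f x + g x).
Proof.
move=> [mf bf] [mg bg]; split; first exact: measurable_funD.
move=> L; have [C fC] := bf L; have [C' gC] := bg L; exists (C + C') => x xL.
by apply: le_trans (ler_normD _ _) _; apply: lerD; [exact: fC|exact: gC].
Qed.

Lemma lbmM f g : lbm f -> lbm g -> lbm (fun x => f x * g x).
Proof.
move=> [mf bf] [mg bg]; split; first exact: measurable_funM.
move=> L; have [C fC] := bf L; have [C' gC] := bg L; exists (C * C') => x xL.
by rewrite normrM; apply: ler_pM => //; [exact: fC|exact: gC].
Qed.

Lemma lbmN f : lbm f -> lbm (fun x => - f x).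
Proof.
move=> lf; have := lbmM (lbm_cst (-1)) lf.
by congr lbm; apply/funext => x; rewrite mulN1r.
Qed.

Lemma lbmB f g : lbm f -> lbm g -> lbm (fun x => f x - g x).
Proof. by move=> lf lg; apply: lbmD => //; exact: lbmN. Qed.

Lemma lbm_norm f : lbm f -> lbm (fun x => `|f x|).
Proof.
move=> [mf bf]; split; first exact: measurableT_comp.
by move=> L; have [C fC] := bf L; exists C => x xL; rewrite normr_id fC.
Qed.

Lemma lbm_shift f p : lbm f -> lbm (fun x => f (x + p)).
Proof.
move=> [mf bf]; split.
  by apply: (measurableT_comp mf); apply: measurable_funD => //; exact: measurable_cst.
move=> L; have [C fC] := bf (L + `|p|); exists C => x xL; apply: fC.
by apply: le_trans (ler_normD _ _) _; rewrite lerD2r.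
Qed.

Lemma lbm_continuous f : continuous f -> lbm f.
Proof.
move=> cf; split; first exact: continuous_measurable_fun.
move=> L.
have cL : compact (f @` `[- L, L]).
  by apply: continuous_compact; [exact: continuous_subspaceT|exact: segment_compact].
have [C [_ fC]] := compact_bounded cL; exists (C + 1) => x; rewrite ler_norml => xL.
by apply: (fC (C + 1)); [rewrite ltrDl|exists x => //=; rewrite in_itv].
Qed.

Lemma lbm_nondecreasing f : {homo f : x y / x <= y} -> lbm f.
Proof.
move=> nf; split; first by apply: nondecreasing_measurable => // x y; exact: nf.
move=> L; exists (`|f (- L)| + `|f L|) => x; rewrite ler_norml => /andP[/nf h1 /nf h2].
have := ler_norm (f L); have := ler_norm (- f (- L)); rewrite normrN ler_norml => h3 h4.
have := normr_ge0 (f (-L)); have := normr_ge0 (f L) => h5 h6.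
by apply/andP; split; lra.
Qed.

Section Rint.
Variable m : {measure set (measurableTypeR R) -> \bar R}.
Hypothesis mfin : forall a b, (m `]a, b]%classic < +oo)%E.
Local Notation I g a b := (Rintegral m `]a, b]%classic g).

Lemma lbm_int g a b : lbm g -> m.-integrable `]a, b] (EFin \o g).
Proof.
move=> lg; apply: measurable_bounded_integrable => //.
- exact: measurable_funTS lg.1.
- have [C C0 gC] := lbm_itv a b lg; exists C; split; first exact: num_real.
  move=> M CM x /=; rewrite in_itv/= => /andP[ax xb].
  by apply: le_trans (ltW CM); apply: gC => //; exact: ltW.
Qed.

Lemma RI_D f g a b : lbm f -> lbm g ->
  I (fun x => f x + g x) a b = I f a b + I g a b.
Proof. by move=> lf lg; apply: RintegralD => //; exact: lbm_int. Qed.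

Lemma RI_Z f k a b : lbm f -> I (fun x => k * f x) a b = k * I f a b.
Proof. by move=> lf; apply: RintegralZl => //; exact: lbm_int. Qed.

Lemma RI_cst k a b : I (fun=> k) a b = k * fine (m `]a, b]%classic).
Proof. exact: Rintegral_cst. Qed.

Lemma RI_le f g a b : lbm f -> lbm g -> (forall x, a < x -> x <= b -> f x <= g x) ->
  I f a b <= I g a b.
Proof.
move=> lf lg fg; apply: le_Rintegral => //; [exact: lbm_int|exact: lbm_int|].
by move=> x /=; rewrite in_itv/= => /andP[]; exact: fg.
Qed.

Lemma RI_abs f g a b : lbm f -> lbm g -> (forall x, a < x -> x <= b -> `|f x| <= g x) ->
  `|I f a b| <= I g a b.
Proof.
move=> lf lg fg; apply: le_trans (le_normr_Rintegral _ _) _ => //; first exact: lbm_int.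
by apply: RI_le => //; exact: lbm_norm.
Qed.

Lemma RI_close f k e a b : lbm f -> (forall x, a < x -> x <= b -> `|f x - k| <= e) ->
  `|I f a b - k * fine (m `]a, b]%classic)| <= e * fine (m `]a, b]%classic).
Proof.
move=> lf fk; rewrite -!RI_cst -RintegralB//; last 2 first.
- exact: lbm_int.
- exact: lbm_int (lbm_cst _).
by apply: RI_abs => //; [apply: lbmB => //; exact: lbm_cst|exact: lbm_cst].
Qed.

Lemma RI_chasles f a b c : lbm f -> a <= b -> b <= c -> I f a c = I f a b + I f b c.
Proof.
move=> lf ab bc; have e : `]a, c]%classic = `]a, b] `|` `]b, c].
  by rewrite -itv_bndbnd_setU//= bnd_simp.
rewrite [in LHS]e Rintegral_setU//; first by rewrite -e; exact: lbm_int.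
apply/disj_set2P; apply/seteqP; split => // x [] /=; rewrite !in_itv/= => /andP[_ h] /andP[h' _].
by have := lt_le_trans h' h; rewrite ltxx.
Qed.

Lemma m_chasles a b c : a <= b -> b <= c ->
  fine (m `]a, c]%classic) = fine (m `]a, b]%classic) + fine (m `]b, c]%classic).
Proof.
move=> ab bc; have := RI_chasles (lbm_cst 1) ab bc.
by rewrite !RI_cst !mul1r.
Qed.

Lemma RI_whole f a b : lbm f -> (forall x, ~ (a < x <= b) -> f x = 0) ->
  Rintegral m setT f = I f a b.
Proof.
move=> lf f0; rewrite [RHS]Rintegral_mkcond; congr Rintegral.
apply/funext => x; rewrite patchE; case: ifPn => // /negP.
by rewrite inE/= in_itv/= => h; apply: f0 => /h.
Qed.

End Rint.
End LocallyBounded.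

(** * Stieltjes integrals against real local measures *)

Section Orient.
Context {R : realType} {V : zmodType}.
Implicit Types (J : R -> R -> V).

(** The sign convention of integrals with bounds in the wrong order. *)
Definition orient J (a b : R) : V := if a <= b then J a b else - J b a.

Definition additive_itv J := forall a b c, a <= b -> b <= c -> J a c = J a b + J b c.

Lemma orient_le J a b : a <= b -> orient J a b = J a b.
Proof. by rewrite /orient => ->. Qed.

Lemma orient_chasles J : additive_itv J ->
  forall a b c, orient J a c = orient J a b + orient J b c.
Proof.
move=> addJ a b c.
have J0 x : J x x = 0.
  by have := addJ x x x (lexx _) (lexx _) => /eqP; rewrite addrC -subr_eq subrr eq_sym => /eqP.
rewrite /orient; case: (leP a b) => ab; case: (leP b c) => bc; case: (leP a c) => ac.
- exact: addJ.
- by have := lt_le_trans ac (le_trans ab bc); rewrite ltxx.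
- by rewrite (addJ a c b) ?(ltW bc)// addrK.
- by rewrite (addJ c a b) ?(ltW ac)// opprD addrCA subrr addr0.
- by rewrite (addJ b a c) ?(ltW ab)// addrA addNr add0r.
- by rewrite (addJ b c a) ?(ltW ac)// opprD addrAC addNr add0r.
- by have := lt_le_trans (lt_trans bc ab) ac; rewrite ltxx.
- by rewrite (addJ c b a) ?(ltW bc) ?(ltW ab)// opprD addrC.
Qed.

Lemma orientxx J a : additive_itv J -> orient J a a = 0.
Proof. by move=> h; have := orient_chasles h a a a => /eqP; rewrite addrC -subr_eq subrr eq_sym => /eqP. Qed.

Lemma orientN J a b : additive_itv J -> orient J a b = - orient J b a.
Proof. by move=> h; apply/eqP; rewrite -addr_eq0 -orient_chasles// orientxx. Qed.

Lemma orientB J a b c : additive_itv J -> orient J a c - orient J a b = orient J b c.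
Proof. by move=> h; rewrite (orient_chasles h a b c) addrAC subrr add0r. Qed.

End Orient.

Section JordanIntegral.
Context {R : realType}.
Implicit Types (nu : set (measurableTypeR R) -> R) (a b c : R).

Lemma rlocalN nu : rlocal nu -> rlocal (fun B => - nu B).
Proof.
move=> [sg [U bd]]; split.
  move=> F mF tF bF; under eq_fun do rewrite sumrN.
  by apply: cvgN; exact: sg.
by exists U => a B mB Ba; rewrite normrN; exact: bd Ba.
Qed.

Lemma pos_part_unif nu : rlocal nu ->
  exists U : R, forall a, (pos_part nu `]a, (a + 1)%R]%classic <= U%:E)%E.
Proof.
move=> [_ [U bd]]; exists U => a; apply: ub_ereal_sup => _ [B [[mB _] Ba] <-].
by rewrite lee_fin; apply: le_trans (ler_norm _) _; exact: bd Ba.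
Qed.

(** An interval is covered by finitely many unit intervals, where the uniform bound applies. *)
Lemma pos_part_itv_fin nu a b : rlocal nu -> (pos_part nu `]a, b]%classic < +oo)%E.
Proof.
move=> nuP; have [U hU] := pos_part_unif nuP.
have claim n : (pos_part nu `]a, (a + n%:R)%R]%classic <= (n%:R * U)%:E)%E.
  elim: n => [|n IH].
    by rewrite addr0 set_itvoc0 pos_part0// mul0r.
  have e : `]a, a + n.+1%:R]%classic = `]a, a + n%:R] `|` `]a + n%:R, a + n.+1%:R].
    by rewrite -itv_bndbnd_setU//= bnd_simp ?lerDl// lerD2l ler_nat.
  rewrite e; have -> : (n.+1%:R * U)%:E = ((n%:R * U)%:E + U%:E)%E.
    by rewrite -EFinD -addn1 natrD mulrDl mul1r.
  apply: le_trans (leeD IH (hU (a + n%:R))).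
  rewrite -addrA natr1.
  have := measureU2 (pos_part_measure nuP : {measure set (measurableTypeR R) -> \bar R}).
  by apply.
apply: le_lt_trans (le_pos_part nu _) (le_lt_trans (claim (Num.truncn `|b - a|).+1) _); last exact: ltry.
move=> x /=; rewrite !in_itv/= => /andP[-> xb] /=.
apply: le_trans xb _; rewrite -lerBlDl; apply: le_trans (ler_norm _) _.
by apply: ltW; apply: truncnS_gt.
Qed.

(** For each Borel part [C] of the interval, [nu] of the interval is [nu C] plus [nu] of the
rest; taking the supremum over [C], the positive part is [nu] plus the negative part. *)
Lemma jordanE nu a b : rlocal nu ->
  fine (pos_part nu `]a, b]%classic) - fine (neg_part nu `]a, b]%classic) = nu `]a, b]%classic.
Proof.
move=> nuP; have nuN := rlocalN nuP.
have fp : pos_part nu `]a, b]%classic \is a fin_num.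
  by rewrite ge0_fin_numE ?pos_part_itv_fin// pos_part_ge0.
have fn : neg_part nu `]a, b]%classic \is a fin_num.
  by rewrite ge0_fin_numE ?pos_part_itv_fin// pos_part_ge0.
have mI : measurable (`]a, b]%classic : set (measurableTypeR R)) by exact: measurable_itv.
have split_itv (C : set (measurableTypeR R)) : measurable C -> C `<=` `]a, b]%classic ->
    nu `]a, b]%classic = nu C + nu (`]a, b]%classic `\` C).
  move=> mC CI; rewrite -[in LHS](setDUK CI) rlocalU//.
  - exact: measurableD.
  - exact: has_bound_sub CI (has_bound_oc _ _).
  - by apply: has_bound_sub (has_bound_oc a b); exact: subDsetl.
  - by rewrite setDIK.
apply/eqP; rewrite subr_eq; apply/eqP; apply: le_anti; apply/andP; split.
  rewrite -lee_fin EFinD !fineK//; apply: ub_ereal_sup => _ [C [[mC _] CI] <-].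
  rewrite (split_itv C mC CI) EFinD -addeA leeDl//.
  rewrite addeC -leeBlDr// -EFinB sub0r.
  apply: pos_part_ub; [exact: measurableD| |exact: subDsetl].
  by apply: has_bound_sub (has_bound_oc a b); exact: subDsetl.
rewrite addrC -lerBrDr -lee_fin EFinB !fineK//; apply: ub_ereal_sup => _ [C [[mC _] CI] <-].
rewrite (split_itv C mC CI) leeBrDr// -EFinD addrA addNr add0r.
apply: pos_part_ub; [exact: measurableD| |exact: subDsetl].
by apply: has_bound_sub (has_bound_oc a b); exact: subDsetl.
Qed.

(** The integral of [g] against [nu] over the half-open interval, through the Jordan parts. *)
Definition Sr nu (g : R -> R) a b : R :=
  fine (\int[pos_part nu]_(x in `]a, b]) (g x)%:E)%E -
  fine (\int[neg_part nu]_(x in `]a, b]) (g x)%:E)%E.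

(** The total variation of [nu] on the half-open interval. *)
Definition Vr nu a b : R :=
  fine (pos_part nu `]a, b]%classic) + fine (neg_part nu `]a, b]%classic).

Section Sr.
Variable nu : set (measurableTypeR R) -> R.
Hypothesis nuP : rlocal nu.
Let nuN := rlocalN nuP.
Let mp : {measure set (measurableTypeR R) -> \bar R} := pos_part_measure nuP.
Let mn : {measure set (measurableTypeR R) -> \bar R} := pos_part_measure nuN.
Let mpfin a b : (mp `]a, b]%classic < +oo)%E. Proof. exact: pos_part_itv_fin. Qed.
Let mnfin a b : (mn `]a, b]%classic < +oo)%E. Proof. exact: pos_part_itv_fin. Qed.

Let SrE g a b : Sr nu g a b = Rintegral mp `]a, b]%classic g - Rintegral mn `]a, b]%classic g.
Proof. by []. Qed.

Let VrE a b : Vr nu a b = fine (mp `]a, b]%classic) + fine (mn `]a, b]%classic).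
Proof. by []. Qed.

Let nuE a b : nu `]a, b]%classic = fine (mp `]a, b]%classic) - fine (mn `]a, b]%classic).
Proof. by rewrite -jordanE. Qed.

Lemma Sr_chasles g : lbm g -> additive_itv (Sr nu g).
Proof.
move=> lg a b c ab bc; rewrite !SrE.
by rewrite (RI_chasles mpfin lg ab bc) (RI_chasles mnfin lg ab bc) opprD addrACA.
Qed.

Lemma Vr_chasles : additive_itv (Vr nu).
Proof.
move=> a b c ab bc; rewrite !VrE.
by rewrite (m_chasles mpfin ab bc) (m_chasles mnfin ab bc) addrACA.
Qed.

Lemma Vr_ge0 a b : 0 <= Vr nu a b.
Proof. by apply: addr_ge0; apply: fine_ge0; exact: pos_part_ge0. Qed.

Lemma Vr_unif : exists U : R, forall a, Vr nu a (a + 1) <= U.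
Proof.
have [U hU] := pos_part_unif nuP; have [U' hU'] := pos_part_unif nuN.
exists (U + U') => a; apply: lerD.
  rewrite -lee_fin fineK ?hU// ge0_fin_numE ?pos_part_ge0//; exact: pos_part_itv_fin.
rewrite -lee_fin fineK ?hU'// ge0_fin_numE ?pos_part_ge0//; exact: pos_part_itv_fin.
Qed.

Lemma nu_le_Vr a b : `|nu `]a, b]%classic| <= Vr nu a b.
Proof.
rewrite -jordanE//; apply: le_trans (ler_normB _ _) _.
by rewrite !ger0_norm//; apply: fine_ge0; exact: pos_part_ge0.
Qed.

(** The basic estimate on the Stieltjes integral: everything proved about it by local comparison
below goes through an approximation by [k] times the measure. *)
Lemma Sr_close g k e a b : lbm g -> (forall x, a < x -> x <= b -> `|g x - k| <= e) ->
  `|Sr nu g a b - k * nu `]a, b]%classic| <= e * Vr nu a b.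
Proof.
move=> lg gk; rewrite SrE VrE nuE.
have h1 := RI_close mpfin lg gk; have h2 := RI_close mnfin lg gk.
rewrite mulrBr mulrDr; apply: le_trans (lerD h1 h2); rewrite opprD addrACA -opprD.
exact: ler_normB.
Qed.

Lemma rint_Sr g a b : lbm g -> (forall x, ~ (a < x <= b) -> g x = 0) ->
  rint (pos_part nu) g - rint (neg_part nu) g = Sr nu g a b.
Proof.
move=> lg g0; rewrite SrE -(RI_whole mp lg g0) -(RI_whole mn lg g0).
by [].
Qed.

End Sr.
End JordanIntegral.

(** * Complex functions and complex local measures *)

Section Cabs.
Context {R : realType}.
Implicit Types (z w : R[i]).

Lemma complex_ext z w : complex.Re z = complex.Re w -> complex.Im z = complex.Im w -> z = w.
Proof. by case: z w => [a b] [c d] /= -> ->. Qed.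

Lemma cabsE z : cabs z = Num.sqrt (complex.Re z ^+ 2 + complex.Im z ^+ 2).
Proof. by case: z. Qed.

Lemma cabs_ge0 z : 0 <= cabs z.
Proof. by rewrite cabsE sqrtr_ge0. Qed.

Lemma cabsD z w : cabs (z + w) <= cabs z + cabs w.
Proof. exact: complex.le_normcD. Qed.

Lemma cabsM z w : cabs (z * w) = cabs z * cabs w.
Proof. exact: ComplexField.Normc.normcM. Qed.

Lemma cabsN z : cabs (- z) = cabs z.
Proof. exact: complex.normcN. Qed.

Lemma cabsB z w : cabs (z - w) <= cabs z + cabs w.
Proof. by rewrite -(cabsN w); exact: cabsD. Qed.

Lemma cabsBC z w : cabs (z - w) = cabs (w - z).
Proof. by rewrite -cabsN opprB. Qed.

Lemma cabs0 : cabs (0 : R[i]) = 0.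
Proof. exact: ComplexField.Normc.normc0. Qed.

Lemma cabs1 : cabs (1 : R[i]) = 1.
Proof. exact: ComplexField.Normc.normc1. Qed.

Lemma cabs_eq0 z : cabs z = 0 -> z = 0.
Proof. exact: ComplexField.Normc.eq0_normc. Qed.

Lemma cabs_Re z : `|complex.Re z| <= cabs z.
Proof. by rewrite cabsE -sqrtr_sqr ler_wsqrtr// lerDl sqr_ge0. Qed.

Lemma cabs_Im z : `|complex.Im z| <= cabs z.
Proof. by rewrite cabsE -sqrtr_sqr ler_wsqrtr// lerDr sqr_ge0. Qed.

Lemma cabs_le z : cabs z <= `|complex.Re z| + `|complex.Im z|.
Proof.
rewrite cabsE; have h : 0 <= `|complex.Re z| + `|complex.Im z| by exact: addr_ge0.
rewrite -(ger0_norm h) -sqrtr_sqr ler_wsqrtr// sqrrD !real_normK ?num_real//.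
by rewrite addrAC lerDl mulrn_wge0// mulr_ge0.
Qed.

Lemma cabs_real (x : R) : cabs x%:C = `|x|.
Proof. by rewrite cabsE /= expr0n addr0 sqrtr_sqr. Qed.

Lemma cabs_dist z w v : cabs (z - v) <= cabs (z - w) + cabs (w - v).
Proof. by have := cabsD (z - w) (w - v); rewrite addrA subrK. Qed.

Lemma cabs_ltr_dist z w : cabs z <= cabs w + cabs (z - w).
Proof. by have := cabsD w (z - w); rewrite addrCA subrr addr0. Qed.

Lemma cabs_dist_norm (z w : R[i]) : `|cabs z - cabs w| <= cabs (z - w).
Proof.
have := cabs_ltr_dist z w; have := cabs_ltr_dist w z; rewrite (cabsBC w z) => h1 h2.
by rewrite ler_norml; apply/andP; split; lra.
Qed.

Lemma Re_add z w : @complex.Re R (z + w) = complex.Re z + complex.Re w.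
Proof. by case: z w => [a b] [c d]. Qed.
Lemma Im_add z w : @complex.Im R (z + w) = complex.Im z + complex.Im w.
Proof. by case: z w => [a b] [c d]. Qed.
Lemma Re_opp z : @complex.Re R (- z) = - complex.Re z.
Proof. by case: z. Qed.
Lemma Im_opp z : @complex.Im R (- z) = - complex.Im z.
Proof. by case: z. Qed.
Lemma Re_mul z w : @complex.Re R (z * w) = complex.Re z * complex.Re w - complex.Im z * complex.Im w.
Proof. by case: z w => [a b] [c d]. Qed.
Lemma Im_mul z w : @complex.Im R (z * w) = complex.Re z * complex.Im w + complex.Im z * complex.Re w.
Proof. by case: z w => [a b] [c d]. Qed.
Definition ReIm := (Re_add, Im_add, Re_opp, Im_opp, Re_mul, Im_mul).

End Cabs.

Section ComplexIntegrals.
Context {R : realType}.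
Implicit Types (f g : R -> R[i]) (a b c : R) (mu : set_function R).

Definition clbm f := lbm (Ref f) /\ lbm (Imf f).

Lemma clbm_ext f g : f =1 g -> clbm f -> clbm g.
Proof. by move=> /funext ->. Qed.

Lemma clbm_cst (k : R[i]) : clbm (fun=> k).
Proof. by split; exact: lbm_cst. Qed.

Lemma clbmD f g : clbm f -> clbm g -> clbm (fun x => f x + g x).
Proof.
move=> [rf jf] [rg ig]; split.
  by have := lbmD rf rg; congr lbm; apply/funext => x; rewrite /Ref Re_add.
by have := lbmD jf ig; congr lbm; apply/funext => x; rewrite /Imf Im_add.
Qed.

Lemma clbmM f g : clbm f -> clbm g -> clbm (fun x => f x * g x).
Proof.
move=> [rf jf] [rg ig]; split.
  by have := lbmB (lbmM rf rg) (lbmM jf ig); congr lbm; apply/funext => x; rewrite /Ref Re_mul.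
by have := lbmD (lbmM rf ig) (lbmM jf rg); congr lbm; apply/funext => x; rewrite /Imf Im_mul.
Qed.

Lemma clbmN f : clbm f -> clbm (fun x => - f x).
Proof.
move=> [rf jf]; split.
  by have := lbmN rf; congr lbm; apply/funext => x; rewrite /Ref Re_opp.
by have := lbmN jf; congr lbm; apply/funext => x; rewrite /Imf Im_opp.
Qed.

Lemma clbmB f g : clbm f -> clbm g -> clbm (fun x => f x - g x).
Proof. by move=> cf cg; apply: clbmD => //; exact: clbmN. Qed.

Lemma clbm_shift f p : clbm f -> clbm (fun x => f (x + p)).
Proof. by move=> [rf jf]; split; [exact: (lbm_shift p rf)|exact: (lbm_shift p jf)]. Qed.

Lemma clbm_continuous f : ccontinuous f -> clbm f.
Proof. by move=> [rf jf]; split; exact: lbm_continuous. Qed.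

Lemma clbm_bound f a b : clbm f ->
  exists2 C : R, 0 <= C & forall x, a <= x -> x <= b -> cabs (f x) <= C.
Proof.
move=> [rf jf]; have [C C0 fC] := lbm_itv a b rf; have [D D0 fD] := lbm_itv a b jf.
exists (C + D); first exact: addr_ge0.
by move=> x ax xb; apply: le_trans (cabs_le _) _; apply: lerD; [exact: fC|exact: fD].
Qed.

Definition clocal mu := rlocal (fun B => complex.Re (mu B)) /\ rlocal (fun B => complex.Im (mu B)).

(** The Stieltjes integral of a complex function over the half-open interval from [a] to [b],
written out in real and imaginary parts. *)
Definition cS mu f a b : R[i] :=
  let re B := complex.Re (mu B) in let im B := complex.Im (mu B) in
  (Sr re (Ref f) a b - Sr im (Imf f) a b) +i* (Sr re (Imf f) a b + Sr im (Ref f) a b).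

(** An additive majorant of the total variation of [mu]; it is comparable to the total variation
up to a factor, which is all that the estimates need. *)
Definition Vc mu a b : R :=
  Vr (fun B => complex.Re (mu B)) a b + Vr (fun B => complex.Im (mu B)) a b.

Lemma cS_chasles mu f : clocal mu -> clbm f -> additive_itv (cS mu f).
Proof.
move=> [h1 h2] [rf jf] a b c ab bc; apply: complex_ext; rewrite !ReIm /cS /=.
  by rewrite (Sr_chasles h1 rf ab bc) (Sr_chasles h2 jf ab bc); ring.
by rewrite (Sr_chasles h1 jf ab bc) (Sr_chasles h2 rf ab bc); ring.
Qed.

Lemma Vc_chasles mu : clocal mu -> additive_itv (Vc mu).
Proof.
move=> [h1 h2] a b c ab bc; rewrite /Vc (Vr_chasles h1 ab bc) (Vr_chasles h2 ab bc); ring.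
Qed.

Lemma Vc_ge0 mu a b : clocal mu -> 0 <= Vc mu a b.
Proof. by move=> [h1 h2]; apply: addr_ge0; exact: Vr_ge0. Qed.

Lemma Vc_unif mu : clocal mu -> exists2 U : R, 0 <= U & forall a, Vc mu a (a + 1) <= U.
Proof.
move=> mP; have [h1 h2] := mP.
have [U hU] := Vr_unif h1; have [U' hU'] := Vr_unif h2.
have h a : Vc mu a (a + 1) <= U + U' by exact: lerD.
by exists (U + U') => //; apply: le_trans (h 0); exact: Vc_ge0.
Qed.

Lemma cmu_le_Vc mu a b : clocal mu -> cabs (mu `]a, b]%classic) <= Vc mu a b.
Proof.
by move=> [h1 h2]; apply: le_trans (cabs_le _) _; apply: lerD; [exact: (nu_le_Vr h1)|exact: (nu_le_Vr h2)].
Qed.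

(** The factor 2 comes from bounding the modulus by the sum of the real and imaginary parts. *)
Lemma cS_close mu f k e a b : clocal mu -> clbm f ->
  (forall x, a < x -> x <= b -> cabs (f x - k) <= e) ->
  cabs (cS mu f a b - k * mu `]a, b]%classic) <= 2 * e * Vc mu a b.
Proof.
move=> [h1 h2] [rf jf] fk; apply: le_trans (cabs_le _) _.
have rk x : a < x -> x <= b -> `|Ref f x - complex.Re k| <= e.
  by move=> ax xb; apply: le_trans (fk x ax xb); rewrite -Re_opp -Re_add; exact: cabs_Re.
have ik x : a < x -> x <= b -> `|Imf f x - complex.Im k| <= e.
  by move=> ax xb; apply: le_trans (fk x ax xb); rewrite -Im_opp -Im_add; exact: cabs_Im.
have e1 := Sr_close h1 rf rk; have e2 := Sr_close h2 jf ik.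
have e3 := Sr_close h1 jf ik; have e4 := Sr_close h2 rf rk.
rewrite !ReIm /= /Vc.
set A := Sr _ _ _ _ in e1 *; set B := Sr _ _ _ _ in e2 *; set C := Sr _ _ _ _ in e3 *;
set D := Sr _ _ _ _ in e4 *; set V1 := Vr _ _ _ in e1 *; set V2 := Vr _ _ _ in e2 *.
move: e1 e2 e3 e4; set x := complex.Re (mu _); set y := complex.Im (mu _).
set p := complex.Re k; set q := complex.Im k => e1 e2 e3 e4.
have -> : A - B - (p * x - q * y) = (A - p * x) - (B - q * y) by ring.
have -> : C + D - (p * y + q * x) = (C - q * x) + (D - p * y) by ring.
have := ler_normB (A - p * x) (B - q * y); have := ler_normD (C - q * x) (D - p * y).
by move: e1 e2 e3 e4; rewrite -/V1 -/V2; lra.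
Qed.

(** Rewrites the integral of a compactly supported function as an integral over a bounded
interval, where additivity and the estimates are available. *)
Lemma lint_cS mu f a b : clocal mu -> clbm f -> (forall x, ~ (a < x <= b) -> f x = 0) ->
  lint mu f = cS mu f a b.
Proof.
move=> [h1 h2] [rf jf] f0.
have r0 x : ~ (a < x <= b) -> Ref f x = 0 by move=> /f0; rewrite /Ref => ->.
have i0 x : ~ (a < x <= b) -> Imf f x = 0 by move=> /f0; rewrite /Imf => ->.
rewrite /lint /cint /cS.
rewrite -(rint_Sr h1 rf r0) -(rint_Sr h1 jf i0) -(rint_Sr h2 rf r0) -(rint_Sr h2 jf i0).
by apply: complex_ext; rewrite /=; ring.
Qed.

End ComplexIntegrals.

(** * Lebesgue integrals over oriented intervals *)

Section LebesgueReal.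
Context {R : realType}.
Implicit Types (f g : R -> R) (a b c p : R).
Notation leb := (@lebesgue_measure R).

Lemma leb_itv a b : a <= b -> leb `]a, b]%classic = (b - a)%:E.
Proof.
move=> ab; rewrite lebesgue_measure_itv/= lte_fin; case: ltP => // ba.
by rewrite (le_anti (_ : a <= b <= a)) ?ab ?subrr.
Qed.

Lemma leb_fin a b : (leb `]a, b]%classic < +oo)%E.
Proof.
have [ab|ba] := leP a b; first by rewrite leb_itv// ltry.
by rewrite set_itv_ge ?measure0// bnd_simp -leNgt ltW.
Qed.

Lemma fine_leb a b : a <= b -> fine (leb `]a, b]%classic) = b - a.
Proof. by move=> ab; rewrite leb_itv. Qed.

Definition lI f a b := Rintegral leb `]a, b]%classic f.

Lemma addr_preimage_oc a b p :
  ((fun x => x + p) : measurableTypeR R -> measurableTypeR R) @^-1` `]a, b]%classic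
  = `]a - p, b - p]%classic.
Proof. by apply/seteqP; split => x /=; rewrite !in_itv/= ltrBlDr lerBrDr. Qed.

(** Both sides agree on half-open intervals, which determines Lebesgue measure. *)
Lemma leb_translate p (A : set (measurableTypeR R)) : measurable A ->
  pushforward leb ((fun x => x + p) : measurableTypeR R -> measurableTypeR R) A = leb A.
Proof.
move=> mA; apply/esym/lebesgue_measure_unique => //=.
  apply: (measurable_funD (D := [set: R])) => //; exact: measurable_cst.
move=> _ _ [[a b]] _ <-.
rewrite /pushforward addr_preimage_oc/= !lebesgue_measure_itv/= !lte_fin ltrD2r.
by case: ifP => // _; rewrite -!EFinB; congr (_%:E); ring.
Qed.

Lemma lI_shift f a b p : lbm f -> lI f (a + p) (b + p) = lI (fun x => f (x + p)) a b.
Proof.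
move=> lf; rewrite /lI /Rintegral; congr fine.
pose phi : measurableTypeR R -> measurableTypeR R := fun x => x + p.
have mphi : measurable_fun setT phi.
  by apply: (measurable_funD (D := [set: R])) => //; exact: measurable_cst.
have pre : phi @^-1` `]a + p, b + p]%classic = `]a, b]%classic.
  by rewrite addr_preimage_oc !addrK.
have := @integral_pushforward _ _ _ _ _ phi mphi leb `]a + p, b + p]%classic (EFin \o f).
rewrite pre => <- //.
- by apply: eq_measure_integral => A mA _; exact: (esym (leb_translate p mA)).
- by apply/measurable_EFinP; exact: lf.1.
- exact: (lbm_int leb_fin a b (lbm_shift p lf)).
Qed.

Lemma lI_lin f g k l a b : lbm f -> lbm g ->
  lI (fun x => k * f x + l * g x) a b = k * lI f a b + l * lI g a b.
Proof.
move=> lf lg; rewrite /lI (RI_D leb_fin).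
- by rewrite !(RI_Z leb_fin).
- by apply: (lbmM (lbm_cst k)).
- by apply: (lbmM (lbm_cst l)).
Qed.

Lemma lI_ge0 g a b : lbm g -> (forall x, a < x -> x <= b -> 0 <= g x) -> 0 <= lI g a b.
Proof.
move=> lg g0; have := RI_le leb_fin (lbm_cst 0) lg g0.
by rewrite RI_cst mul0r.
Qed.

Lemma lI_mono g a b s t : lbm g -> (forall x, a < x -> x <= b -> 0 <= g x) ->
  a <= s -> s <= t -> t <= b -> lI g s t <= lI g a b.
Proof.
move=> lg g0 as_ st tb.
have e1 : lI g a b = lI g a s + lI g s b.
  by apply: RI_chasles => //; [exact: leb_fin|exact: le_trans st tb].
have e2 : lI g s b = lI g s t + lI g t b by apply: RI_chasles => //; exact: leb_fin.
have h1 : 0 <= lI g a s.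
  by apply: lI_ge0 => // x ax xs; apply: g0 => //; apply: le_trans xs (le_trans st tb).
have h2 : 0 <= lI g t b.
  by apply: lI_ge0 => // x tx xb; apply: g0 => //; apply: le_lt_trans tx; exact: le_trans as_ st.
by rewrite e1 e2 addrCA lerDl addr_ge0.
Qed.

(** A nondecreasing function varies little in the mean under small translations, whatever its
jumps: the integral telescopes to the difference of two integrals over intervals of length
[2 d]. *)
Lemma lI_nondecreasing f a b d : {homo f : x y / x <= y} -> a <= b -> 0 <= d ->
  lI (fun x => f (x + d) - f (x - d)) a b <= 2 * d * (f (b + d) - f (a - d)).
Proof.
move=> nf ab d0; have lf := lbm_nondecreasing nf.
have i1 : a - d <= a + d by lra.
have i2 : a + d <= b + d by lra.
have i3 : a - d <= b - d by lra.
have i4 : b - d <= b + d by lra.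
have e1 : lI (fun x => f (x + d) - f (x - d)) a b =
    lI f (a + d) (b + d) - lI f (a - d) (b - d).
  rewrite !lI_shift//; apply: RintegralB => //; apply: lbm_int; try exact: leb_fin.
    exact: lbm_shift.
  exact: (lbm_shift (- d) lf).
have c1 : lI f (a - d) (b + d) = lI f (a - d) (a + d) + lI f (a + d) (b + d).
  by apply: RI_chasles => //; exact: leb_fin.
have c2 : lI f (a - d) (b + d) = lI f (a - d) (b - d) + lI f (b - d) (b + d).
  by apply: RI_chasles => //; exact: leb_fin.
have -> : lI (fun x => f (x + d) - f (x - d)) a b =
    lI f (b - d) (b + d) - lI f (a - d) (a + d).
  rewrite e1; move: c1 c2; move: (lI f (a - d) (b + d)) => I1.
  move: (lI f _ _) (lI f _ _) (lI f _ _) (lI f _ _) => I2 I3 I4 I5 h1 h2; clear -h1 h2; lra.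
have u1 : lI f (b - d) (b + d) <= f (b + d) * (2 * d).
  have := RI_le leb_fin lf (lbm_cst (f (b + d))) (a := b - d) (b := b + d).
  rewrite RI_cst fine_leb//.
  move=> h; apply: le_trans (h _) _; last by rewrite le_eqVlt; apply/orP; left; apply/eqP; ring.
  by move=> x _; exact: nf.
have u2 : f (a - d) * (2 * d) <= lI f (a - d) (a + d).
  have := RI_le leb_fin (lbm_cst (f (a - d))) lf (a := a - d) (b := a + d).
  rewrite RI_cst fine_leb//.
  move=> h; apply: le_trans (h _); first by rewrite le_eqVlt; apply/orP; left; apply/eqP; ring.
  by move=> x h1 _; apply: nf; exact: ltW.
move: u1 u2; move: (lI f _ _) (lI f _ _) => I1 I2 h1 h2; clear -h1 h2; lra.
Qed.

End LebesgueReal.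

Section LebesgueComplex.
Context {R : realType}.
Implicit Types (f g : R -> R[i]) (a b c p : R) (k : R[i]).
Notation leb := (@lebesgue_measure R).

Definition cIb f a b : R[i] := lI (Ref f) a b +i* lI (Imf f) a b.
(** The oriented Lebesgue integral from [a] to [b]. *)
Definition cI f := orient (cIb f).

Lemma Re_cIb f a b : complex.Re (cIb f a b) = lI (Ref f) a b. Proof. by []. Qed.
Lemma Im_cIb f a b : complex.Im (cIb f a b) = lI (Imf f) a b. Proof. by []. Qed.

Lemma cIb_additive f : clbm f -> additive_itv (cIb f).
Proof.
move=> [rf jf] a b c ab bc; apply: complex_ext; rewrite !ReIm /=.
  by rewrite /lI (RI_chasles leb_fin rf ab bc).
by rewrite /lI (RI_chasles leb_fin jf ab bc).
Qed.

Lemma cI_chasles f a b c : clbm f -> cI f a c = cI f a b + cI f b c.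
Proof. by move=> cf; apply: orient_chasles; exact: cIb_additive. Qed.

Lemma cIB f a b c : clbm f -> cI f a c - cI f a b = cI f b c.
Proof. by move=> cf; rewrite (cI_chasles a b c cf) addrAC subrr add0r. Qed.

Lemma cIxx f a : clbm f -> cI f a a = 0.
Proof. by move=> cf; apply: orientxx; exact: cIb_additive. Qed.

Lemma cI_opp f a b : clbm f -> cI f a b = - cI f b a.
Proof. by move=> cf; apply: orientN; exact: cIb_additive. Qed.

Lemma cI_ext f g a b : f =1 g -> cI f a b = cI g a b.
Proof. by move=> /funext ->. Qed.

Lemma cIb_D f g a b : clbm f -> clbm g ->
  cIb (fun x => f x + g x) a b = cIb f a b + cIb g a b.
Proof.
move=> [rf jf] [rg ig]; apply: complex_ext; rewrite !ReIm /= /lI.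
  rewrite -(RI_D leb_fin a b rf rg); congr Rintegral; apply/funext => x.
  by rewrite /Ref Re_add.
rewrite -(RI_D leb_fin a b jf ig); congr Rintegral; apply/funext => x.
by rewrite /Imf Im_add.
Qed.

Lemma cI_D f g a b : clbm f -> clbm g ->
  cI (fun x => f x + g x) a b = cI f a b + cI g a b.
Proof. by move=> cf cg; rewrite /cI /orient; case: ifP => _; rewrite cIb_D// opprD. Qed.

Lemma cIb_Z f k a b : clbm f -> cIb (fun x => k * f x) a b = k * cIb f a b.
Proof.
move=> [rf jf]; apply: complex_ext.
  rewrite [RHS]Re_mul !Re_cIb Im_cIb -mulNr -lI_lin//; congr lI; apply/funext => x.
  by rewrite /Ref /Imf Re_mul; ring.
rewrite [RHS]Im_mul !Im_cIb Re_cIb -lI_lin//; congr lI; apply/funext => x.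
by rewrite /Ref /Imf Im_mul.
Qed.

Lemma cI_Z f k a b : clbm f -> cI (fun x => k * f x) a b = k * cI f a b.
Proof. by move=> cf; rewrite /cI /orient; case: ifP => _; rewrite cIb_Z// mulrN. Qed.

Lemma cI_N f a b : clbm f -> cI (fun x => - f x) a b = - cI f a b.
Proof.
move=> cf; rewrite -mulN1r -cI_Z//; apply: cI_ext => x; by rewrite mulN1r.
Qed.

Lemma cI_B f g a b : clbm f -> clbm g ->
  cI (fun x => f x - g x) a b = cI f a b - cI g a b.
Proof. by move=> cf cg; rewrite -cI_N// -cI_D//; exact: clbmN. Qed.

Lemma cI_cst k a b : cI (fun=> k) a b = k * (b - a)%:C.
Proof.
have h c d : c <= d -> cIb (fun=> k) c d = k * (d - c)%:C.
  move=> cd; apply: complex_ext; rewrite !ReIm /= /lI RI_cst fine_leb//; ring.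
rewrite /cI /orient; case: (leP a b) => [/h//|/ltW /h ->].
by rewrite -mulrN -rmorphN opprB.
Qed.

Lemma cI_le f (g : R -> R) a b : a <= b -> clbm f -> lbm g ->
  (forall x, a < x -> x <= b -> cabs (f x) <= g x) -> cabs (cI f a b) <= 2 * lI g a b.
Proof.
move=> ab [rf jf] lg fg; rewrite /cI orient_le//; apply: le_trans (cabs_le _) _ => /=.
have h1 : `|lI (Ref f) a b| <= lI g a b.
  apply: RI_abs => //; first exact: leb_fin.
  by move=> x ax xb; apply: le_trans (cabs_Re _) (fg x ax xb).
have h2 : `|lI (Imf f) a b| <= lI g a b.
  apply: RI_abs => //; first exact: leb_fin.
  by move=> x ax xb; apply: le_trans (cabs_Im _) (fg x ax xb).
by lra.
Qed.

Lemma cI_bound f C a b : a <= b -> clbm f ->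
  (forall x, a < x -> x <= b -> cabs (f x) <= C) -> cabs (cI f a b) <= 2 * C * (b - a).
Proof.
move=> ab cf fC; have := cI_le ab cf (lbm_cst C) fC.
by rewrite /lI RI_cst fine_leb// mulrA.
Qed.

Lemma cI_close f k e a b : a <= b -> clbm f ->
  (forall x, a < x -> x <= b -> cabs (f x - k) <= e) ->
  cabs (cI f a b - k * (b - a)%:C) <= 2 * e * (b - a).
Proof.
move=> ab cf fk; rewrite -cI_cst -cI_B//; last exact: clbm_cst.
by apply: cI_bound => //; apply: clbmB => //; exact: clbm_cst.
Qed.

Lemma cI_shift f a b p : clbm f -> cI f (a + p) (b + p) = cI (fun x => f (x + p)) a b.
Proof.
move=> [rf jf]; rewrite /cI /orient lerD2r.
have h c d : cIb f (c + p) (d + p) = cIb (fun x => f (x + p)) c d.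
  by rewrite /cIb !lI_shift.
by case: ifP => _; rewrite h.
Qed.

Lemma cint_cI f a b : a <= b -> clbm f -> (forall x, ~ (a < x <= b) -> f x = 0) ->
  cint leb f = cI f a b.
Proof.
move=> ab [rf jf] f0; rewrite /cI orient_le// /cint /cIb.
congr (_ +i* _).
  by apply: (RI_whole leb rf) => x /f0; rewrite /Ref => ->.
by apply: (RI_whole leb jf) => x /f0; rewrite /Imf => ->.
Qed.

(** The counterpart of a vanishing derivative that serves for functions with jumps: increments
that are arbitrarily small compared with those of a fixed monotone [V], uniformly on short
intervals, add up to nothing. Integration by parts, the product rule and the change of variables
in Stieltjes integrals are all proved by applying it to the difference of their two sides. *)
Lemma increments_constant (D : R -> R[i]) (V : R -> R) a b : a <= b ->
  {homo V : x y / x <= y} ->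
  (forall e, 0 < e -> exists2 d, 0 < d & forall x y, a <= x -> x <= y -> y <= b ->
     y <= x + d -> cabs (D y - D x) <= e * (V y - V x)) ->
  D b = D a.
Proof.
move=> ab nV hD; apply/eqP; rewrite -subr_eq0; apply/eqP; apply: cabs_eq0.
apply: le_anti; rewrite cabs_ge0 andbT.
apply/ler_addgt0Pl => e e0; rewrite addr0.
set W := V b - V a; have W0 : 0 <= W by rewrite subr_ge0 nV.
have e'0 : 0 < e / (W + 1) by rewrite divr_gt0// ltr_wpDl.
have [d d0 hd] := hD _ e'0.
have claim n x y : a <= x -> x <= y -> y <= b -> y <= x + n%:R * d ->
    cabs (D y - D x) <= e / (W + 1) * (V y - V x).
  elim: n x => [|n IH] x ax xy yb.
    rewrite mul0r addr0 => yx; have -> : y = x by apply: le_anti; rewrite xy yx.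
    by rewrite !subrr cabs0 mulr0.
  move=> yn; have [yd|yd] := leP y (x + d); first exact: hd.
  apply: le_trans (cabs_dist _ (D (x + d)) _) _.
  have h1 : cabs (D (x + d) - D x) <= e / (W + 1) * (V (x + d) - V x).
    by apply: hd => //; [rewrite lerDl ltW|apply: le_trans yb; exact: ltW].
  have h2 : cabs (D y - D (x + d)) <= e / (W + 1) * (V y - V (x + d)).
    apply: IH => //; [|exact: ltW|].
      by apply: le_trans ax _; rewrite lerDl ltW.
    by apply: le_trans yn _; rewrite -addn1 natrD; lra.
  by apply: le_trans (lerD h2 h1) _; rewrite -mulrDr addrA subrK.
have := claim (Num.truncn ((b - a) / d)).+1 a b (lexx _) ab (lexx _).
move=> /(_ _)/le_trans; apply.
  by rewrite -lerBlDl -ler_pdivrMr// ltW// truncnS_gt.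
rewrite -/W mulrAC ler_pdivrMr ?ltr_wpDl//.
by rewrite ler_pM2l// lerDl.
Qed.

End LebesgueComplex.

(** * Primitives and Gronwall estimates *)

(** Discharges membership of compound integrands in the class of integrable ones. *)
Ltac clbm_tac := repeat lazymatch goal with
  | |- clbm (fun x => _ + _) => apply: clbmD
  | |- clbm (fun x => _ * _) => apply: clbmM
  | |- clbm (fun x => - _) => apply: clbmN
  | |- clbm (fun x => ?f (x + _)) => apply: clbm_shift
  | |- clbm (fun x => ?c) => apply: clbm_cst
  | |- clbm _ => assumption
  end.

Section Primitive.
Context {R : realType}.
Implicit Types (f g F G : R -> R[i]) (a b c : R).

(** Absolute continuity with locally bounded derivative [f], in integrated form; this way
differential equations are stated without derivatives. *)
Definition prim f F := clbm f /\ forall x y, F y - F x = cI f x y.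

Lemma prim_ext f f' F F' : f =1 f' -> F =1 F' -> prim f F -> prim f' F'.
Proof. by move=> /funext <- /funext <-. Qed.

Lemma prim_lip f F a b : a <= b -> prim f F -> exists2 C : R, 0 <= C &
  forall x y, a <= x -> x <= y -> y <= b -> cabs (F y - F x) <= C * (y - x).
Proof.
move=> ab [cf Ff]; have [C C0 fC] := clbm_bound a b cf.
exists (2 * C); first by rewrite mulr_ge0.
move=> x y ax xy yb; rewrite Ff; apply: cI_bound => // t xt ty.
by apply: fC; [exact: le_trans ax (ltW xt)|exact: le_trans ty yb].
Qed.

Lemma lip_continuous (h : R -> R) :
  (forall L : R, exists C : R, forall x y, - L <= x -> x <= y -> y <= L -> `|h y - h x| <= C * (y - x)) ->
  continuous h.
Proof.
move=> hh x; have [C hC] := hh (`|x| + 1).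
apply/cvgrPdist_le => e e0.
have C0 : 0 < `|C| + 1 by rewrite ltr_wpDl.
near=> y.
have yx1 : `|x - y| <= 1 by near: y; apply: cvgr_dist_le.
have yxe : `|x - y| <= e / (`|C| + 1).
  by near: y; apply: cvgr_dist_le => //; rewrite divr_gt0.
have CC : C * `|x - y| <= e.
  rewrite ler_pdivlMr// in yxe; apply: le_trans yxe; rewrite mulrC ler_wpM2l//.
  by have := ler_norm C; lra.
have := ler_norm x; have := ler_norm (- x); rewrite normrN => x1 x2.
have [h1 h2] : x - y <= 1 /\ y - x <= 1.
  by split; [have := ler_norm (x - y)|have := ler_norm (y - x); rewrite distrC]; lra.
have [xy|/ltW yx] := leP x y.
  rewrite distrC; apply: le_trans (hC x y _ xy _) _; [lra|lra|].
  by apply: le_trans CC; rewrite distrC ger0_norm ?subr_ge0.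
apply: le_trans (hC y x _ yx _) _; [lra|lra|].
by apply: le_trans CC; rewrite ger0_norm ?subr_ge0.
Unshelve. all: by end_near. Qed.

Lemma prim_continuous f F : prim f F -> ccontinuous F.
Proof.
move=> Ff; split; apply: lip_continuous => L.
  have [L0|L0] := leP (- L) L; last by exists 0 => x y h1 h2 h3; lra.
  have [C C0 hC] := prim_lip L0 Ff; exists C => x y h1 h2 h3.
  apply: le_trans (hC x y h1 h2 h3); have := cabs_Re (F y - F x).
  by rewrite Re_add Re_opp.
have [L0|L0] := leP (- L) L; last by exists 0 => x y h1 h2 h3; lra.
have [C C0 hC] := prim_lip L0 Ff; exists C => x y h1 h2 h3.
apply: le_trans (hC x y h1 h2 h3); have := cabs_Im (F y - F x).
by rewrite Im_add Im_opp.
Qed.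

Lemma prim_clbm f F : prim f F -> clbm F.
Proof. by move=> /prim_continuous; exact: clbm_continuous. Qed.

Lemma primD f g F G : prim f F -> prim g G -> prim (fun x => f x + g x) (fun x => F x + G x).
Proof.
move=> [cf Ff] [cg Gg]; split; first exact: clbmD.
by move=> x y; rewrite cI_D// -Ff -Gg; ring.
Qed.

Lemma primZ k f F : prim f F -> prim (fun x => k * f x) (fun x => k * F x).
Proof.
move=> [cf Ff]; split; first by clbm_tac.
by move=> x y; rewrite cI_Z// -Ff mulrBr.
Qed.

Lemma prim_shift p f F : prim f F -> prim (fun x => f (x + p)) (fun x => F (x + p)).
Proof.
move=> [cf Ff]; split; first exact: clbm_shift.
by move=> x y; rewrite -cI_shift// Ff.
Qed.

(** On a short interval the increment of [F * G] minus the integral of [f * G + F * g] equals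
the integral of [f(t) (G(y) - G(t)) + g(t) (F(x) - F(t))], which is of second order. *)
Lemma primM f g F G : prim f F -> prim g G ->
  prim (fun x => f x * G x + F x * g x) (fun x => F x * G x).
Proof.
move=> pF pG; have [cf Ff] := pF; have [cg Gg] := pG.
have cF := prim_clbm pF; have cG := prim_clbm pG.
have ch : clbm (fun x => f x * G x + F x * g x) by clbm_tac.
split => // a b.
suff main c d : c <= d -> F d * G d - F c * G c = cI (fun x => f x * G x + F x * g x) c d.
  have [ab|/ltW ba] := leP a b; first exact: main.
  by rewrite cI_opp// -main// opprB.
move=> cd.
(* The difference of the two sides as a function of the right end point. *)
pose D x := F x * G x - cI (fun x => f x * G x + F x * g x) c x.
suff : D d = D c by rewrite /D cIxx// subr0 => <-; ring.
apply: (increments_constant (V := id)) => // e e0.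
have [Cf Cf0 hf] := clbm_bound c d cf; have [Cg Cg0 hg] := clbm_bound c d cg.
have [LF LF0 lF] := prim_lip cd pF; have [LG LG0 lG] := prim_lip cd pG.
pose K := 2 * (Cf * LG + Cg * LF) + 1.
have K0 : 0 < K by rewrite ltr_wpDl// mulr_ge0// addr_ge0// mulr_ge0.
exists (e / K); first by rewrite divr_gt0.
move=> x y cx xy yd yx.
have -> : D y - D x = cI (fun t => f t * (G y - G t) + g t * (F x - F t)) x y.
  have -> : D y - D x = G y * cI f x y + F x * cI g x y -
                        cI (fun x => f x * G x + F x * g x) x y.
    by rewrite /D -(cIB c x y ch) -Ff -Gg; ring.
  rewrite -cI_Z// -cI_Z// -cI_D; [|by clbm_tac|by clbm_tac].
  rewrite -cI_B; [|by clbm_tac|by clbm_tac].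
  by apply: cI_ext => t; ring.
apply: (@le_trans _ _ (2 * ((Cf * LG + Cg * LF) * (e / K)) * (y - x))).
  apply: cI_bound => //; first by clbm_tac.
  move=> t xt ty.
  have ct : c <= t by apply: le_trans cx (ltW xt).
  have td : t <= d by exact: le_trans ty yd.
  apply: le_trans (cabsD _ _) _; rewrite !cabsM mulrDl; apply: lerD; rewrite -mulrA.
    apply: ler_pM; rewrite ?cabs_ge0 ?hf//; apply: le_trans (lG _ _ ct ty yd) _.
    by rewrite ler_wpM2l//; lra.
  apply: ler_pM; rewrite ?cabs_ge0 ?hg// cabsBC.
  apply: le_trans (lF _ _ cx (ltW xt) td) _.
  by rewrite ler_wpM2l//; lra.
rewrite ler_wpM2r ?subr_ge0// mulrA mulrA ler_pdivrMr// mulrC ler_pM2l//.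
by rewrite /K; lra.
Qed.

End Primitive.

Section Gronwall.
Context {R : realType}.
Implicit Types (f : R -> R) (a b s t L e B : R).

(** Every upper bound [M] improves to [M / 2 + c], so the supremum is at most [2 c]. The bound
[B] makes the supremum finite. *)
Lemma contraction_bound (S : set R) c B : S !=set0 -> (forall x, S x -> x <= B) ->
  (forall M, (forall x, S x -> x <= M) -> forall x, S x -> x <= M / 2 + c) ->
  forall x, S x -> x <= 2 * c.
Proof.
move=> S0 SB hS.
have hs : has_sup S by split => //; exists B.
have h : forall x, S x -> x <= sup S by move=> x Sx; exact: sup_upper_bound.
have h2 : sup S <= sup S / 2 + c by apply: ge_sup => //; exact: hS.
by move=> x /h h3; lra.
Qed.

(** The integral inequality of Gronwall in terms of increments: growth at most [L] times the
maximum of [f], up to an error [e]. It is symmetric in time, so estimates hold in both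
directions. *)
Definition gronwall_hyp f a b L e := forall s t B, a <= s -> s <= t -> t <= b ->
  (forall x, s <= x -> x <= t -> f x <= B) -> `|f t - f s| <= L * (t - s) * B + e.

(** On an interval of length at most [1 / (2 L)] the maximum of [f] is bounded by half of itself
plus an end value and the error. *)
Lemma gronwall_step f a b L e B0 s t : gronwall_hyp f a b L e -> 0 <= L ->
  (forall x, 0 <= f x) -> (forall x, a <= x -> x <= b -> f x <= B0) ->
  a <= s -> s <= t -> t <= b -> L * (t - s) <= 2^-1 ->
  forall x, s <= x -> x <= t -> f x <= 2 * (f s + e) /\ f x <= 2 * (f t + e).
Proof.
move=> H L0 f0 fB as_ st tb Lts.
pose S := [set f x | x in [set x | s <= x /\ x <= t]].
have S0 : S !=set0 by exists (f s); exists s.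
have SB : forall y, S y -> y <= B0.
  by move=> _ [x [sx xt] <-]; apply: fB; [exact: le_trans as_ sx|exact: le_trans xt tb].
have main y : (y = s \/ y = t) -> forall z, S z -> z <= 2 * (f y + e).
  move=> yst; apply: (contraction_bound S0 SB) => M SM _ [x [sx xt] <-].
  have M0 : 0 <= M by apply: le_trans (f0 s) _; apply: SM; exists s.
  have fM z : s <= z -> z <= t -> f z <= M by move=> sz zt; apply: SM; exists z.
  have step p q : s <= p -> p <= q -> q <= t -> `|f q - f p| <= M / 2 + e.
    move=> sp pq qt; apply: le_trans (H p q M _ pq _ _) _.
    - exact: le_trans as_ sp.
    - exact: le_trans qt tb.
    - by move=> z pz zq; apply: fM; [exact: le_trans sp pz|exact: le_trans zq qt].
    - rewrite lerD2r mulrC ler_wpM2l//; apply: le_trans Lts; rewrite ler_wpM2l//; lra.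
  case: yst => ->.
    by have := ler_norm (f x - f s); have := step s x (lexx _) sx xt; lra.
  by have := ler_norm (f x - f t); rewrite distrC; have := step x t sx xt (lexx _); lra.
move=> x sx xt; have Sx : S (f x) by exists x.
by split; apply: main => //; [left|right].
Qed.

(** Chaining [n] steps of length [h]; a factor 2 is lost in each. *)
Lemma gronwall f a b L e B0 n h : gronwall_hyp f a b L e -> 0 <= L -> 0 <= e ->
  (forall x, 0 <= f x) -> (forall x, a <= x -> x <= b -> f x <= B0) ->
  L * h <= 2^-1 -> 0 <= h ->
  forall s t, a <= s -> s <= t -> t <= b -> t - s <= n%:R * h ->
  f s + 2 * e <= 2 ^+ n * (f t + 2 * e) /\ f t + 2 * e <= 2 ^+ n * (f s + 2 * e).
Proof.
move=> H L0 e0 f0 fB Lh h0 s t; elim: n s => [|n IH] s as_ st tb.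
  rewrite mul0r subr_le0 => ts; have -> : s = t by apply: le_anti; rewrite st ts.
  by rewrite expr0 !mul1r.
move=> tn; have [th|th] := leP t (s + h).
  have Lts : L * (t - s) <= 2^-1 by apply: le_trans Lh; rewrite ler_wpM2l//; lra.
  have [_ h1] := gronwall_step H L0 f0 fB as_ st tb Lts (lexx _) st.
  have [h2 _] := gronwall_step H L0 f0 fB as_ st tb Lts st (lexx _).
  have p1 : 1 <= 2 ^+ n :> R by rewrite exprn_ege1// ler1n.
  have has_bound (q : R) : 0 <= q -> 2 * q <= 2 ^+ n.+1 * q.
    move=> q0; rewrite exprS -mulrA; apply: ler_wpM2l => //.
    by rewrite -{1}(mul1r q); apply: ler_wpM2r.
  have := has_bound (f t + 2 * e); have := has_bound (f s + 2 * e); have := f0 s; have := f0 t.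
  by move=> a1 a2 a3 a4; split; [apply: le_trans (a4 _); lra|apply: le_trans (a3 _); lra].
have sh : s <= s + h by rewrite lerDl.
have Lts : L * (s + h - s) <= 2^-1 by rewrite addrAC subrr add0r.
have shb : s + h <= b by apply: le_trans tb; exact: ltW.
have [_ h1] := gronwall_step H L0 f0 fB as_ sh shb Lts (lexx _) sh.
have [h2 _] := gronwall_step H L0 f0 fB as_ sh shb Lts sh (lexx _).
have ash : a <= s + h by exact: le_trans as_ sh.
have [] := IH (s + h) ash (ltW th) tb.
  by move: tn; rewrite -addn1 natrD; lra.
have p0 : 0 < 2 ^+ n :> R by exact: exprn_gt0.
move=> i1 i2; rewrite exprS -!mulrA; split.
  by have := f0 s; lra.
apply: le_trans i2 _; rewrite mulrCA ler_pM2l//; lra.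
Qed.

End Gronwall.

(** * The quasi-derivative system *)

Section Gordon.
Context {R : realType}.
Implicit Types (N u v y z e : R -> R[i]) (E c : R[i]) (a b : R).

(** The first order system [u' = v + N u], [v' = - (N v + (N^2 + E) u)], solved in the
integrated sense by [u] and its quasi-derivative [v]. *)
Definition sol N E u v :=
  prim (fun t => v t + N t * u t) u /\
  prim (fun t => - (N t * v t + (N t * N t + E) * u t)) v.

(** A Lipschitz constant of the right hand side of the system for the norm [|u| + |v|], where
[|N| <= K]; the factors 2 come from integrating real and imaginary parts separately. *)
Definition gronwall_lip (K : R) E : R := 2 * (1 + K) + 2 * (K + K * K + cabs E).

(** Inhomogeneous terms bounded by [g] enter the estimate through the integral of [g] only; [g]
may well be large near the jumps of the measure. *)
Lemma sol_gronwall_hyp N E K y z (e1 e2 : R -> R[i]) (g : R -> R) a b :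
  clbm N -> (forall x, cabs (N x) <= K) -> clbm e1 -> clbm e2 -> lbm g ->
  prim (fun t => z t + N t * y t + e1 t) y ->
  prim (fun t => - (N t * z t + (N t * N t + E) * y t) + e2 t) z ->
  (forall x, a < x -> x <= b -> cabs (e1 x) <= g x) ->
  (forall x, a < x -> x <= b -> cabs (e2 x) <= g x) ->
  gronwall_hyp (fun x => cabs (y x) + cabs (z x)) a b (gronwall_lip K E) (4 * lI g a b).
Proof.
move=> cN NK ce1 ce2 lg py pz e1g e2g s t B as_ st tb rB.
have cy := prim_clbm py; have cz := prim_clbm pz.
have g0 x : a < x -> x <= b -> 0 <= g x.
  by move=> ax xb; apply: le_trans (e1g x ax xb); exact: cabs_ge0.
have Ist := lI_mono lg g0 as_ st tb.
have es (e : R -> R[i]) : clbm e -> (forall x, a < x -> x <= b -> cabs (e x) <= g x) ->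
    cabs (cI e s t) <= 2 * lI g a b.
  move=> ce eg; apply: le_trans (_ : 2 * lI g s t <= _); last by rewrite ler_pM2l.
  apply: cI_le => // x sx xt; apply: eg; first exact: le_lt_trans sx.
  exact: le_trans tb.
have K0 : 0 <= K := le_trans (cabs_ge0 _) (NK 0).
have ey : cabs (y t - y s) <= 2 * ((1 + K) * B) * (t - s) + 2 * lI g a b.
  rewrite py.2 cI_D; [|by clbm_tac|by []].
  apply: le_trans (cabsD _ _) _; apply: lerD; last exact: es.
  apply: cI_bound; [by []|by clbm_tac|].
  move=> x sx xt; have := rB x (ltW sx) xt; have := cabs_ge0 (y x); have := cabs_ge0 (z x).
  move=> z0 y0 rx; apply: le_trans (cabsD _ _) _; rewrite cabsM.
  have := ler_wpM2r y0 (NK x); have : 0 <= K * cabs (z x) by exact: mulr_ge0.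
  by have := ler_wpM2l K0 rx; lra.
have ez : cabs (z t - z s) <= 2 * ((K + K * K + cabs E) * B) * (t - s) + 2 * lI g a b.
  rewrite pz.2 cI_D; [|by clbm_tac|by []].
  apply: le_trans (cabsD _ _) _; apply: lerD; last exact: es.
  apply: cI_bound; [by []|by clbm_tac|].
  move=> x sx xt; have := rB x (ltW sx) xt; have := cabs_ge0 (y x); have := cabs_ge0 (z x).
  move=> z0 y0 rx; rewrite cabsN; apply: le_trans (cabsD _ _) _; rewrite !cabsM -addrA mulrDl.
  apply: lerD.
    by apply: ler_pM; rewrite ?cabs_ge0// ?NK//; apply: le_trans rx; rewrite lerDr.
  apply: ler_pM; rewrite ?cabs_ge0//; last by apply: le_trans rx; rewrite lerDl.
  apply: le_trans (cabsD _ _) _; rewrite lerD2r cabsM.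
  by apply: ler_pM; rewrite ?cabs_ge0.
have := cabs_dist_norm (y t) (y s); have := cabs_dist_norm (z t) (z s).
have := ler_normD (cabs (y t) - cabs (y s)) (cabs (z t) - cabs (z s)).
rewrite /gronwall_lip.
have -> : cabs (y t) - cabs (y s) + (cabs (z t) - cabs (z s)) =
          cabs (y t) + cabs (z t) - (cabs (y s) + cabs (z s)) by ring.
move: ey ez; clear; move: (lI g a b) => I; move: (cabs (y t - y s)) (cabs (z t - z s)) => p q.
move: (`|_|) (`|_|) (`|_|) (cabs E) => *; lra.
Qed.

(** The number of Gronwall steps per unit of length depends on [K] and [E] only; thus
propagation over a period [P] costs a factor [2 ^ ((n + 1) * P)] with [n] fixed. *)
Lemma gronwall_step_length (K : R) E : exists n : nat, gronwall_lip K E * (n.+1%:R)^-1 <= 2^-1.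
Proof.
exists (Num.truncn (2 * `|gronwall_lip K E|)); set n := (Num.truncn _).+1.
have h : 2 * `|gronwall_lip K E| < n%:R by exact: truncnS_gt.
have n0 : 0 < n%:R :> R by rewrite ltr0n.
rewrite ler_pdivrMr//; have := ler_norm (gronwall_lip K E); lra.
Qed.

Lemma sol_gronwall N E K n : clbm N -> (forall x, cabs (N x) <= K) ->
  gronwall_lip K E * (n.+1%:R)^-1 <= 2^-1 ->
  forall y z (e1 e2 : R -> R[i]) (g : R -> R) (P : nat) a, clbm e1 -> clbm e2 -> lbm g ->
  prim (fun t => z t + N t * y t + e1 t) y ->
  prim (fun t => - (N t * z t + (N t * N t + E) * y t) + e2 t) z ->
  (forall x, a < x -> x <= a + P%:R -> cabs (e1 x) <= g x) ->
  (forall x, a < x -> x <= a + P%:R -> cabs (e2 x) <= g x) ->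
  forall s t, a <= s -> s <= t -> t <= a + P%:R ->
  let r x := cabs (y x) + cabs (z x) in
  let I := lI g a (a + P%:R) in
  r s <= 2 ^+ (n.+1 * P) * (r t + 8 * I) /\ r t <= 2 ^+ (n.+1 * P) * (r s + 8 * I).
Proof.
move=> cN NK hn y z e1 e2 g P a ce1 ce2 lg py pz e1g e2g s t as_ st tP /=.
have H := sol_gronwall_hyp cN NK ce1 ce2 lg py pz e1g e2g.
have K0 : 0 <= K := le_trans (cabs_ge0 _) (NK 0).
have L0 : 0 <= gronwall_lip K E.
  by rewrite /gronwall_lip; have := cabs_ge0 E; have := mulr_ge0 K0 K0; lra.
have I0 : 0 <= lI g a (a + P%:R).
  by apply: lI_ge0 => // x ax xb; apply: le_trans (e1g x ax xb); exact: cabs_ge0.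
have [B _ yB] := clbm_bound a (a + P%:R) (prim_clbm py).
have [B' _ zB] := clbm_bound a (a + P%:R) (prim_clbm pz).
have e0 : 0 <= 4 * lI g a (a + P%:R) by rewrite mulr_ge0.
have r0 x : 0 <= cabs (y x) + cabs (z x) by rewrite addr_ge0 ?cabs_ge0.
have rB x : a <= x -> x <= a + P%:R -> cabs (y x) + cabs (z x) <= B + B'.
  by move=> ax xb; apply: lerD; [exact: yB|exact: zB].
have h0 : 0 <= (n.+1%:R)^-1 :> R by rewrite invr_ge0.
have [] := gronwall (n := n.+1 * P) H L0 e0 r0 rB hn h0 as_ st tP.
  rewrite natrM mulrAC divff ?mul1r ?pnatr_eq0//; lra.
by rewrite mulrA -natrM => h1 h2; split; lra.
Qed.

Lemma sol_eq0 N E K u v : clbm N -> (forall x, cabs (N x) <= K) -> sol N E u v ->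
  u 0 = 0 -> v 0 = 0 -> forall x, u x = 0.
Proof.
move=> cN NK [pu pv] u0 v0 x.
have [n hn] := gronwall_step_length K E.
pose P := (Num.truncn `|x|).+1.
have xP : `|x| <= P%:R by apply: ltW; exact: truncnS_gt.
have pu' : prim (fun t => v t + N t * u t + 0) u.
  by apply: prim_ext pu => // t; rewrite addr0.
have pv' : prim (fun t => - (N t * v t + (N t * N t + E) * u t) + 0) v.
  by apply: prim_ext pv => // t; rewrite addr0.
have H a := sol_gronwall cN NK hn (P := P) (a := a) (clbm_cst 0) (clbm_cst 0)
  (lbm_cst 0) pu' pv'.
have z0 (y : R) : cabs (0 : R[i]) <= 0 by rewrite cabs0.
suff : cabs (u x) + cabs (v x) <= 0.
  move=> h; apply: cabs_eq0; apply: le_anti; rewrite cabs_ge0 andbT.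
  by apply: le_trans h; rewrite lerDl cabs_ge0.
move: xP; rewrite ler_norml => /andP[x1 x2].
have [x0|/ltW x0] := leP 0 x.
  have [] := H 0 (fun _ _ _ => z0 0) (fun _ _ _ => z0 0) 0 x; rewrite ?add0r//.
  by rewrite u0 v0 cabs0 /lI RI_cst !(mul0r, mulr0, addr0).
have [] := H (- P%:R) (fun _ _ _ => z0 0) (fun _ _ _ => z0 0) x 0; rewrite ?addNr//.
by rewrite u0 v0 cabs0 /lI RI_cst !(mul0r, mulr0, addr0).
Qed.

Section BoundedSolution.
Variables (N : R -> R[i]) (E : R[i]) (u v : R -> R[i]) (K R0 : R).
Hypothesis cN : clbm N.
Hypothesis NK : forall x, cabs (N x) <= K.
Hypothesis uv : sol N E u v.
Hypothesis uR : forall x, cabs (u x) <= R0.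
Hypothesis vR : forall x, cabs (v x) <= R0.

Let K0 : 0 <= K := le_trans (cabs_ge0 _) (NK 0).
Let R00 : 0 <= R0 := le_trans (cabs_ge0 _) (uR 0).
Let cu : clbm u := prim_clbm uv.1.
Let cv : clbm v := prim_clbm uv.2.

Section OnePeriod.
Variables (P : nat) (g : R -> R).
Hypothesis lg : lbm g.
Let p : R := P%:R.
Hypothesis gp : forall x, 0 < x -> x <= p -> cabs (N (x + p) - N x) <= g x.
Hypothesis gm : forall x, 0 < x -> x <= p -> cabs (N (x - p) - N x) <= g x.

Let G := lI g 0 p.

Let g0 x : 0 < x -> x <= p -> 0 <= g x.
Proof. by move=> x0 xp; apply: le_trans (gp x0 xp); exact: cabs_ge0. Qed.

Let G0 : 0 <= G.
Proof. exact: lI_ge0. Qed.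

(** The Wronskian of two solutions of the same system is constant. Here the system of the
translate has coefficient [N(x + p)] instead of [N(x)], and the derivative of the Wronskian
contains the factor [N(x + p) - N(x)]. *)
Lemma wronskian_drift : cabs ((u (p + p) * v p - v (p + p) * u p) - (u p * v 0 - v p * u 0))
  <= 2 * (2 * (R0 * R0) * (1 + K)) * G.
Proof.
have p1 := prim_shift p uv.1; have p2 := prim_shift p uv.2.
have pW := primD (primM p1 uv.2) (primZ (-1) (primM p2 uv.1)).
have := pW.2 0 p; rewrite add0r.
have -> : u (p + p) * v p + -1 * (v (p + p) * u p) - (u p * v 0 + -1 * (v p * u 0)) =
  u (p + p) * v p - v (p + p) * u p - (u p * v 0 - v p * u 0) by ring.
move=> ->.
rewrite (cI_ext (g := fun x => (N (x + p) - N x) *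
   (u (x + p) * v x + v (x + p) * u x + (N (x + p) + N x) * (u (x + p) * u x)))); last first.
  by move=> x; ring.
rewrite -mulrA -(RI_Z (@leb_fin R))//.
apply: cI_le; [by rewrite /p|by clbm_tac|exact: lbmM (lbm_cst _) lg|].
move=> x x0 xp; rewrite cabsM mulrC; apply: ler_pM; rewrite ?cabs_ge0// ?gp//.
apply: le_trans (cabsD _ _) _.
apply: le_trans (lerD (cabsD _ _) (le_refl _)) _; rewrite !cabsM.
have h1 : cabs (u (x + p)) * cabs (v x) <= R0 * R0 by apply: ler_pM; rewrite ?cabs_ge0.
have h2 : cabs (v (x + p)) * cabs (u x) <= R0 * R0 by apply: ler_pM; rewrite ?cabs_ge0.
have h3 : cabs (N (x + p) + N x) * (cabs (u (x + p)) * cabs (u x)) <= (K + K) * (R0 * R0).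
  apply: ler_pM; rewrite ?cabs_ge0 ?mulr_ge0 ?cabs_ge0//.
    by apply: le_trans (cabsD _ _) _; exact: lerD.
  by apply: ler_pM; rewrite ?cabs_ge0.
by lra.
Qed.

(** A combination of [(u, v)] and its two translates solves the system up to errors that are
bounded by a multiple of [c] times [g]; Gronwall takes its values at [p] back to [0]. *)
Lemma combination_bound n (c1 c0 cm : R[i]) (c : R) :
  gronwall_lip K E * (n.+1%:R)^-1 <= 2^-1 -> cabs c1 <= c -> cabs cm <= c ->
  cabs (c1 * u p + c0 * u 0 + cm * u (- p)) + cabs (c1 * v p + c0 * v 0 + cm * v (- p)) <=
  2 ^+ (n.+1 * P) * (cabs (c1 * u (p + p) + c0 * u p + cm * u 0) +
                     cabs (c1 * v (p + p) + c0 * v p + cm * v 0) +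
                     32 * (c * (R0 * (1 + K))) * G).
Proof.
move=> hn c1c cmc; have c_ge0 : 0 <= c := le_trans (cabs_ge0 _) c1c.
pose y x := c1 * u (x + p) + c0 * u x + cm * u (x - p).
pose z x := c1 * v (x + p) + c0 * v x + cm * v (x - p).
pose e1 x := c1 * ((N (x + p) - N x) * u (x + p)) + cm * ((N (x - p) - N x) * u (x - p)).
pose e2 x := - (c1 * ((N (x + p) - N x) * (v (x + p) + (N (x + p) + N x) * u (x + p))) +
                cm * ((N (x - p) - N x) * (v (x - p) + (N (x - p) + N x) * u (x - p)))).
pose h x := (2 * c * (R0 * (1 + 2 * K))) * g x.
have ce1 : clbm e1 by rewrite /e1; clbm_tac.
have ce2 : clbm e2 by rewrite /e2; clbm_tac.
have lh : lbm h by exact: lbmM (lbm_cst _) lg.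
have py : prim (fun t => z t + N t * y t + e1 t) y.
  apply: prim_ext (primD (primD (primZ c1 (prim_shift p uv.1)) (primZ c0 uv.1))
    (primZ cm (prim_shift (- p) uv.1))) => // x.
  by rewrite /z /y /e1; ring.
have pz : prim (fun t => - (N t * z t + (N t * N t + E) * y t) + e2 t) z.
  apply: prim_ext (primD (primD (primZ c1 (prim_shift p uv.2)) (primZ c0 uv.2))
    (primZ cm (prim_shift (- p) uv.2))) => // x.
  by rewrite /z /y /e2; ring.
have q_le (d a q1 q2 w : R[i]) (G1 : R) : cabs d <= c -> cabs a <= G1 -> cabs w <= R0 ->
    cabs q1 <= R0 -> cabs q2 <= 2 * K -> cabs (d * (a * (w + q2 * q1))) <= c * (R0 * (1 + 2 * K)) * G1.
  move=> dc aG wR q1R q2K; rewrite !cabsM.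
  have -> : c * (R0 * (1 + 2 * K)) * G1 = c * (G1 * (R0 + 2 * K * R0)) by ring.
  apply: ler_pM; rewrite ?mulr_ge0 ?cabs_ge0//.
  apply: ler_pM; rewrite ?cabs_ge0//.
  apply: le_trans (cabsD _ _) _; apply: lerD => //; rewrite cabsM.
  by apply: ler_pM; rewrite ?cabs_ge0.
have NN x x' : cabs (N x + N x') <= 2 * K.
  by apply: le_trans (cabsD _ _) _; have := NK x; have := NK x'; lra.
have K20 : cabs (0 : R[i]) <= 2 * K by rewrite cabs0 mulr_ge0.
have e1h x : 0 < x -> x <= 0 + p -> cabs (e1 x) <= h x.
  rewrite add0r => x0 xp; apply: le_trans (cabsD _ _) _.
  have := q_le c1 _ (u (x + p)) 0 (u (x + p)) _ c1c (gp x0 xp) (uR _) (uR _) K20.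
  have := q_le cm _ (u (x - p)) 0 (u (x - p)) _ cmc (gm x0 xp) (uR _) (uR _) K20.
  by rewrite !mul0r !addr0 /h; lra.
have e2h x : 0 < x -> x <= 0 + p -> cabs (e2 x) <= h x.
  rewrite add0r => x0 xp; rewrite cabsN; apply: le_trans (cabsD _ _) _.
  have := q_le c1 _ (u (x + p)) _ (v (x + p)) _ c1c (gp x0 xp) (vR _) (uR _) (NN (x + p) x).
  have := q_le cm _ (u (x - p)) _ (v (x - p)) _ cmc (gm x0 xp) (vR _) (uR _) (NN (x - p) x).
  by rewrite /h; lra.
have pp : 0 <= p by rewrite /p.
have [] := sol_gronwall cN NK hn ce1 ce2 lh py pz e1h e2h (lexx 0) pp _; first by rewrite add0r.
rewrite /y /z !add0r !subrr => H _; apply: le_trans H _.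
rewrite ler_pM2l ?exprn_gt0// lerD2l.
have -> : lI h 0 p = 2 * c * (R0 * (1 + 2 * K)) * G by rewrite /lI (RI_Z (@leb_fin R)).
have -> : 8 * (2 * c * (R0 * (1 + 2 * K)) * G) = 16 * (c * (R0 * (1 + 2 * K))) * G by ring.
rewrite ler_wpM2r//.
have -> : 32 * (c * (R0 * (1 + K))) = 16 * (c * (R0 * (2 + 2 * K))) by ring.
by rewrite ler_pM2l// ler_wpM2l// ler_wpM2l// lerD2r; lra.
Qed.

End OnePeriod.
End BoundedSolution.
End Gordon.

(** * Gordon's argument *)

Section GordonTheorem.
Context {R : realType}.
Variables (N : R -> R[i]) (E : R[i]) (u v : R -> R[i]) (K R0 : R).
Hypothesis cN : clbm N.
Hypothesis NK : forall x, cabs (N x) <= K.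
Hypothesis uv : sol N E u v.
Hypothesis uR : forall x, cabs (u x) <= R0.
Hypothesis vR : forall x, cabs (v x) <= R0.
Let r x := cabs (u x) + cabs (v x).

Let K0 : 0 <= K := le_trans (cabs_ge0 _) (NK 0).
Let R00 : 0 <= R0 := le_trans (cabs_ge0 _) (uR 0).

Let A : R := 72 * (R0 * R0 * R0 * (1 + K)).
Let B : R := 64 * (R0 * R0 * (1 + K)).

(** The two inequalities of the Gordon argument: the first makes the Wronskian [om] small as
soon as [w_1], [w_2], [w_(-1)] are small compared with [w_0]; the second then bounds [w_0]. *)
Lemma one_period_estimate (P : nat) (g : R -> R) n :
  gronwall_lip K E * (n.+1%:R)^-1 <= 2^-1 -> lbm g ->
  (forall x, 0 < x -> x <= P%:R -> cabs (N (x + P%:R) - N x) <= g x) ->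
  (forall x, 0 < x -> x <= P%:R -> cabs (N (x - P%:R) - N x) <= g x) ->
  let Gam := 2 ^+ (n.+1 * P) in let G := lI g 0 P%:R in
  exists2 om : R, om * (r 0 - (r P%:R + r (P%:R + P%:R) + r (- P%:R))) <= A * (Gam * G) &
    r 0 * r 0 <= r P%:R * r (- P%:R) + 2 * (Gam * om) + B * (Gam * G).
Proof.
move=> hn lg gp gm Gam G.
pose p : R := P%:R.
have G0 : 0 <= G.
  by apply: lI_ge0 => // x x0 xp; apply: le_trans (gp x x0 xp); exact: cabs_ge0.
have Gam1 : 1 <= Gam by rewrite exprn_ege1// ler1n.
have Gam0 : 0 <= Gam by exact: le_trans Gam1.
have r0 x : 0 <= r x by rewrite /r addr_ge0 ?cabs_ge0.
have rR x : r x <= 2 * R0 by rewrite /r; have := uR x; have := vR x; lra.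
have rE x : r x = cabs (u x) + cabs (v x) by [].
clearbody r.
pose om := u p * v 0 - v p * u 0.
pose om' := u (p + p) * v p - v (p + p) * u p.
pose th := u (p + p) * v 0 - v (p + p) * u 0.
have drift : cabs (om' - om) <= 2 * (2 * (R0 * R0) * (1 + K)) * G.
  exact: (wronskian_drift cN NK uv uR vR lg gp).
have wR x y : cabs (u x * v y - v x * u y) <= 2 * (R0 * R0).
  apply: le_trans (cabsB _ _) _; rewrite !cabsM.
  have h1 : cabs (u x) * cabs (v y) <= R0 * R0 by apply: ler_pM; rewrite ?cabs_ge0.
  have h2 : cabs (v x) * cabs (u y) <= R0 * R0 by apply: ler_pM; rewrite ?cabs_ge0.
  by lra.
have comb (c1 c0 cm : R[i]) (c : R) (h1 : cabs c1 <= c) (h2 : cabs cm <= c) :=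
  combination_bound cN NK uv uR vR lg gp gm c0 hn h1 h2.
exists (cabs om).
  have := comb om (- th) om' (2 * (R0 * R0)) (wR p 0) (wR (p + p) p).
  rewrite -/p.
  have -> : om * u (p + p) + - th * u p + om' * u 0 = 0 by rewrite /om /om' /th; ring.
  have -> : om * v (p + p) + - th * v p + om' * v 0 = 0 by rewrite /om /om' /th; ring.
  rewrite cabs0 !add0r -/Gam -/G => X.
  have om0 := cabs_ge0 om.
  have om'om : cabs om' <= cabs om + 2 * (2 * (R0 * R0) * (1 + K)) * G.
    by have := cabs_ltr_dist om' om; lra.
  have omom' : cabs om <= cabs om' + 2 * (2 * (R0 * R0) * (1 + K)) * G.
    by have := cabs_ltr_dist om om'; rewrite (cabsBC om om'); lra.
  have K1 : 0 <= R0 * R0 * R0 * (1 + K) by rewrite !mulr_ge0// addr_ge0.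
  have K2 : 0 <= 2 * (2 * (R0 * R0) * (1 + K)) * G by rewrite !mulr_ge0// addr_ge0.
  have GG : G <= Gam * G by rewrite ler_peMl.
  have dr (x : R) : 2 * (2 * (R0 * R0) * (1 + K)) * G * r x <= 8 * (R0 * R0 * R0 * (1 + K) * (Gam * G)).
    rewrite [leRHS]mulrA; apply: le_trans (ler_wpM2l K2 (rR x)) _.
    have -> : 2 * (2 * (R0 * R0) * (1 + K)) * G * (2 * R0) = 8 * (R0 * R0 * R0 * (1 + K)) * G by ring.
    by rewrite ler_wpM2l// mulr_ge0.
  have GGG : 0 <= R0 * R0 * R0 * (1 + K) * (Gam * G) by rewrite mulr_ge0// mulr_ge0.
  rewrite -/p.
  have -> : A * (Gam * G) = 72 * (R0 * R0 * R0 * (1 + K) * (Gam * G)) by rewrite /A; ring.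
  have {}X : cabs (om * u p + - th * u 0 + om' * u (- p)) +
      cabs (om * v p + - th * v 0 + om' * v (- p)) <= 64 * (R0 * R0 * R0 * (1 + K) * (Gam * G)).
    by apply: le_trans X _; rewrite le_eqVlt; apply/orP; left; apply/eqP; ring.
  move: om'om omom' K2 dr GGG X; move: (2 * (2 * (R0 * R0) * (1 + K)) * G) => Q.
  move: (R0 * R0 * R0 * (1 + K) * (Gam * G)) => Z om'om omom' K2 dr GGG X.
  (* If [|th| <= |om|], use the relation between [w_0], [w_1], [w_2]; otherwise that between
  [w_(-1)], [w_0], [w_1]. *)
  have [thom|/ltW omth] := leP (cabs th) (cabs om).
    have eu : om' * u 0 = th * u p - om * u (p + p) by rewrite /om /om' /th; ring.
    have ev : om' * v 0 = th * v p - om * v (p + p) by rewrite /om /om' /th; ring.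
    have h1 : cabs om' * r 0 <= cabs om * (r p + r (p + p)).
      rewrite rE mulrDr -!cabsM eu ev.
      apply: le_trans (lerD (cabsB _ _) (cabsB _ _)) _; rewrite !cabsM.
      have := ler_wpM2r (cabs_ge0 (u p)) thom; have := ler_wpM2r (cabs_ge0 (v p)) thom.
      by rewrite !rE !mulrDr; lra.
    have h2 := ler_wpM2r (r0 0) omom'.
    have := dr 0; have := mulr_ge0 om0 (r0 (- p)); rewrite !mulrBr !mulrDr.
    move: h1 h2; rewrite mulrDr mulrDl; clear -GGG.
    by move: (cabs om * _) (cabs om * _) (cabs om * _) (cabs om * _) (cabs om' * _) => *; lra.
  have eu : th * u 0 = om * u p + om' * u (- p) - (om * u p + - th * u 0 + om' * u (- p)) by ring.
  have ev : th * v 0 = om * v p + om' * v (- p) - (om * v p + - th * v 0 + om' * v (- p)) by ring.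
  have h1 : cabs th * r 0 <= cabs om * r p + cabs om' * r (- p) + 64 * Z.
    rewrite [r 0]rE mulrDr -!cabsM eu ev.
    apply: le_trans (lerD (cabsB _ _) (cabsB _ _)) _.
    have := cabsD (om * u p) (om' * u (- p)); have := cabsD (om * v p) (om' * v (- p)).
    rewrite !cabsM !rE !mulrDr; lra.
  have h2 := ler_wpM2r (r0 0) omth.
  have h3 := ler_wpM2r (r0 (- p)) om'om.
  have := dr (- p); have := mulr_ge0 om0 (r0 (p + p)); rewrite !mulrBr !mulrDr.
  move: h1 h2 h3; rewrite (mulrDl (cabs om) Q); clear -GGG.
  by move: (cabs om * _) (cabs om * _) (cabs om * _) (cabs om * _) (cabs om' * _) => *; lra.
(* The combinations [u 0 * (u, v) - u p * (u, v)(. - p)] and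
[v 0 * (u, v) - v p * (u, v)(. - p)] take the values [(0, - om)] and [(om, 0)] at [p]. *)
have c2 := comb 0 (u 0) (- u p) R0; have c3 := comb 0 (v 0) (- v p) R0.
have z0 : cabs (0 : R[i]) <= R0 by rewrite cabs0.
have up : cabs (- u p) <= R0 by rewrite cabsN.
have vp : cabs (- v p) <= R0 by rewrite cabsN.
have {}c2 := c2 z0 up; have {}c3 := c3 z0 vp.
move: c2 c3; rewrite -/p !mul0r !add0r.
have -> : u 0 * u p + - u p * u 0 = 0 by ring.
have -> : v 0 * v p + - v p * v 0 = 0 by ring.
have -> : u 0 * v p + - u p * v 0 = - om by rewrite /om; ring.
have -> : v 0 * u p + - v p * u 0 = om by rewrite /om; ring.
rewrite cabs0 cabsN add0r addr0 -/G -/Gam => c2 c3.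
have d2 : cabs (u 0) * r 0 <= cabs (u p) * r (- p) + Gam * (cabs om + 32 * (R0 * (R0 * (1 + K))) * G).
  apply: le_trans (lerD (le_refl _) c2); rewrite !rE !mulrDr -!cabsM.
  have := cabs_ltr_dist (u 0 * u 0) (u p * u (- p)).
  have := cabs_ltr_dist (u 0 * v 0) (u p * v (- p)); rewrite !mulNr; lra.
have d3 : cabs (v 0) * r 0 <= cabs (v p) * r (- p) + Gam * (cabs om + 32 * (R0 * (R0 * (1 + K))) * G).
  apply: le_trans (lerD (le_refl _) c3); rewrite !rE !mulrDr -!cabsM.
  have := cabs_ltr_dist (v 0 * u 0) (v p * u (- p)).
  have := cabs_ltr_dist (v 0 * v 0) (v p * v (- p)); rewrite !mulNr; lra.
have -> : r 0 * r 0 = cabs (u 0) * r 0 + cabs (v 0) * r 0 by rewrite {1}rE mulrDl.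
have -> : r p * r (- p) = cabs (u p) * r (- p) + cabs (v p) * r (- p) by rewrite {1}rE mulrDl.
have -> : B * (Gam * G) = 2 * (Gam * (32 * (R0 * (R0 * (1 + K))) * G)) by rewrite /B; ring.
move: d2 d3; rewrite !mulrDr; lra.
Qed.

(** The Gronwall factor is paid twice, once for [om] and once for passing from [om] to [w_0];
its rate depends on [K] and [E], whence the assumption for every exponent [n]. *)
Theorem gordon_argument :
  (forall (n : nat) (e : R), 0 < e -> exists (P : nat) (g : R -> R),
    [/\ lbm g,
        forall x, 0 < x -> x <= P%:R -> cabs (N (x + P%:R) - N x) <= g x,
        forall x, 0 < x -> x <= P%:R -> cabs (N (x - P%:R) - N x) <= g x,
        2 ^+ (n * P) * lI g 0 P%:R <= e &
        [/\ r P%:R <= e, r (P%:R + P%:R) <= e & r (- P%:R) <= e]]) ->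
  forall x, u x = 0.
Proof.
move=> H.
have r0 x : 0 <= r x by rewrite /r addr_ge0 ?cabs_ge0.
suff w0 : r 0 <= 0.
  have u00 : u 0 = 0.
    by apply: cabs_eq0; apply: le_anti; rewrite cabs_ge0 andbT; apply: le_trans w0; rewrite lerDl cabs_ge0.
  have v00 : v 0 = 0.
    by apply: cabs_eq0; apply: le_anti; rewrite cabs_ge0 andbT; apply: le_trans w0; rewrite lerDr cabs_ge0.
  exact: sol_eq0 cN NK uv u00 v00.
rewrite leNgt; apply/negP => w0; set w := r 0 in w0.
have A0 : 0 <= A by rewrite /A !mulr_ge0// addr_ge0.
have B0 : 0 <= B by rewrite /B !mulr_ge0// addr_ge0.
pose D := w + 4 * A + B * w + 1.
have D0 : 0 < D by rewrite /D; have := mulr_ge0 B0 (ltW w0); lra.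
(* With this [e] the two estimates give [w^3 <= e * D <= w^3 / 2], which contradicts [0 < w]. *)
pose e := Num.min (Num.min 1 (w / 6)) (w * w * w / (2 * D)).
have e0 : 0 < e.
  by rewrite !lt_min ltr01 !divr_gt0 ?mulr_gt0.
have e1 : e <= 1 by rewrite !ge_min lexx.
have e6 : e <= w / 6 by rewrite !ge_min lexx orbT.
have eD : e * D <= w * w * w / 2.
  rewrite -ler_pdivlMr//; have -> : w * w * w / 2 / D = w * w * w / (2 * D) by rewrite -mulrA -invfM.
  by rewrite ge_min lexx orbT.
have [n hn] := gronwall_step_length K E.
have [P [g [lg gp gm small [r1 r2 rm]]]] := H (2 * n.+1)%N e e0.
have [om hom hw] := one_period_estimate hn lg gp gm.
set Gam := 2 ^+ (n.+1 * P) in hom hw; set G := lI g 0 P%:R in hom hw small.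
rewrite -mulnA mul2n -addnn exprD -/Gam -mulrA in small.
have G0 : 0 <= G.
  by apply: lI_ge0 => // x x0 xp; apply: le_trans (gp x x0 xp); exact: cabs_ge0.
have Gam1 : 1 <= Gam by rewrite exprn_ege1// ler1n.
have Gam0 : 0 <= Gam by exact: le_trans Gam1.
have GG : Gam * G <= Gam * (Gam * G) by rewrite ler_peMl// mulr_ge0.
have GGe : Gam * G <= e by exact: le_trans small.
have hom2 : Gam * om * w <= 2 * (A * e).
  have [om0|/ltW om0] := leP om 0.
    apply: (@le_trans _ _ 0); last by apply: mulr_ge0 => //; apply: mulr_ge0 => //; exact: ltW.
    have t1 : Gam * om <= 0 by apply: mulr_ge0_le0.
    by apply: mulr_le0_ge0 => //; exact: ltW.
  have h1 : om * (w / 2) <= A * (Gam * G).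
    apply: le_trans hom; rewrite ler_wpM2l// -/w.
    move: r1 r2 rm e6; clear; move: (r _) (r _) (r _) => *; lra.
  have h2 : Gam * (om * (w / 2)) <= Gam * (A * (Gam * G)) by rewrite ler_wpM2l.
  have h3 : A * (Gam * (Gam * G)) <= A * e by rewrite ler_wpM2l.
  have -> : Gam * om * w = 2 * (Gam * (om * (w / 2))) by field.
  by move: h2; rewrite mulrCA; lra.
have h4 : r P%:R * r (- P%:R) <= e * e by apply: ler_pM.
have h5 : e * e <= e by rewrite ler_piMl// ltW.
have h6 : w * w * w <= e * w + 4 * (A * e) + B * e * w.
  have := ler_wpM2r (ltW w0) hw; rewrite -/w.
  have -> : (r P%:R * r (- P%:R) + 2 * (Gam * om) + B * (Gam * G)) * w =
    r P%:R * r (- P%:R) * w + 2 * (Gam * om * w) + B * (Gam * G) * w by ring.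
  have a1 : r P%:R * r (- P%:R) * w <= e * w by rewrite ler_wpM2r ?(ltW w0)//; lra.
  have a2 : B * (Gam * G) * w <= B * e * w by rewrite ler_wpM2r ?(ltW w0)// ler_wpM2l.
  move: hom2 a1 a2; clear; move: (Gam * om * w) (r _ * r _ * w) (B * (Gam * G) * w) => *; lra.
have h7 : e * D = e * w + 4 * (A * e) + B * e * w + e by rewrite /D; ring.
have : 0 < w * w * w by rewrite !mulr_gt0.
by move: h6 h7 eD; lra.
Qed.

End GordonTheorem.

(** * Lipschitz functions with almost everywhere bounded derivative *)

Section Rademacher.
Context {R : realType}.
Notation leb := (@lebesgue_measure R).

Lemma lebesgue_stieltjes_oc (G : cumulative R R) (a b : R) : a <= b ->
  lebesgue_stieltjes_measure G `]a, b]%classic = (G b - G a)%:E.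
Proof.
move=> ab; rewrite /lebesgue_stieltjes_measure /measure_extension measurable_mu_extE/=; last exact: is_ocitv.
rewrite wlength_itv/= lte_fin; case: ltP => // ba.
by rewrite (le_anti (_ : a <= b <= a)) ?ab ?subrr.
Qed.

Section Density.
Variables (G1 G2 : cumulative R R) (k : R).
Hypothesis k0 : 0 < k.
Hypothesis G12 : forall x, G1 x + G2 x = k * x.

Let nu1 : {measure set (measurableTypeR R) -> \bar R} := lebesgue_stieltjes_measure G1.
Let nu2 : {measure set (measurableTypeR R) -> \bar R} := lebesgue_stieltjes_measure G2.

(** The two Stieltjes measures add up to [k] times Lebesgue measure, as both have the same
values on half-open intervals; so each of them is dominated by it. *)
Lemma stieltjes_le (A : set (measurableTypeR R)) : measurable A -> (nu1 A <= k%:E * leb A)%E.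
Proof.
move=> mA.
have k1 : 0 <= k^-1 by rewrite invr_ge0 ltW.
pose m : {measure set (measurableTypeR R) -> \bar R} := mscale (NngNum k1) (measure_add nu1 nu2).
have mE B : m B = (k^-1%:E * (nu1 B + nu2 B))%E by rewrite -measure_addE.
have e : leb A = m A.
  apply: lebesgue_measure_unique => // _ [[a b] _ <-].
  rewrite mE -[(a, b).1]/a -[(a, b).2]/b.
  have [ab|ba] := leP a b; last first.
    by rewrite set_itv_ge ?bnd_simp -?leNgt ?(ltW ba)// !measure0 adde0 mule0.
  have L1 : nu1 `]a, b]%classic = (G1 b - G1 a)%:E := lebesgue_stieltjes_oc G1 ab.
  have L2 : nu2 `]a, b]%classic = (G2 b - G2 a)%:E := lebesgue_stieltjes_oc G2 ab.
  rewrite leb_itv// L1 L2 -EFinD -EFinM; congr (_%:E).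
  have := G12 a; have := G12 b => hb ha.
  have -> : G1 b - G1 a + (G2 b - G2 a) = k * (b - a) by rewrite mulrBr -hb -ha; ring.
  by rewrite mulrA mulVf ?mul1r// gt_eqF.
rewrite e mE muleA -EFinM divff ?gt_eqF// mul1e.
by rewrite leeDl.
Qed.

Lemma stieltjes_density a b : a <= b -> exists h : R -> R,
  leb.-integrable setT (EFin \o h) /\
  forall x y, a <= x -> x <= y -> y <= b ->
    (\int[leb]_(t in `]x, y]) (h t)%:E = (G1 y - G1 x)%:E)%E.
Proof.
move=> ab.
have mI : measurable (`]a, b]%classic : set (measurableTypeR R)) by exact: measurable_itv.
have fI : (nu1 `]a, b]%classic < +oo)%E by rewrite [nu1 _](lebesgue_stieltjes_oc G1 ab) ltry.
pose nu : {finite_measure set (measurableTypeR R) -> \bar R} := mfrestr mI fI.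
have dom : nu `<< leb.
  apply/null_content_dominatesP => A mA A0.
  apply: le_anti; rewrite measure_ge0 andbT.
  rewrite /nu /= /mfrestr /mrestr.
  apply: le_trans (stieltjes_le (measurableI _ _ mA mI)) _.
  rewrite (_ : leb (A `&` `]a, b]%classic) = 0%E) ?mule0//.
  apply: le_anti; rewrite measure_ge0 andbT -A0.
  by apply: le_measure; rewrite ?inE//; first [exact: measurableI|exact: subIsetl].
have [f [f0 ffin intf fE]] := radon_nikodym_sigma_finite dom.
have fK : EFin \o (fine \o f) = f by apply/funext => x /=; rewrite fineK.
exists (fine \o f); split; first by rewrite fK.
move=> x y ax xy yb.
transitivity (\int[leb]_(t in `]x, y]) f t)%E.
  by apply: eq_integral => t _ /=; rewrite fineK.
rewrite -fE// /nu /= /mfrestr /mrestr setIidl; first exact: lebesgue_stieltjes_oc.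
move=> t /=; rewrite !in_itv/= => /andP[xt ty]; rewrite (le_lt_trans ax xt)/=.
exact: le_trans ty yb.
Qed.
End Density.

(** Adding [k x] to [f] or to [- f] gives two nondecreasing functions with sum [2 k x], so the
Stieltjes measure of the first has a density [h] with respect to Lebesgue measure. By the
differentiation theorem [h = k + f'] almost everywhere, and integrating [h - k] gives the
increment of [f]. *)
Lemma lipschitz_deriv_le1 (f : R -> R) (k : R) : 0 < k ->
  (forall x y, `|f x - f y| <= k * `|x - y|) ->
  {ae leb, forall x, `|derive1 f x| <= 1} ->
  forall a b, a <= b -> `|f b - f a| <= b - a.
Proof.
move=> k0 flip fae a b ab.
have cf : continuous f.
  apply: lip_continuous => L; exists k => x y _ xy _.
  by apply: le_trans (flip _ _) _; rewrite ger0_norm ?subr_ge0.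
have nd s : `|s| = 1 -> nondecreasing (fun x => k * x + s * f x).
  move=> s1 x y xy; have := flip y x; rewrite (ger0_norm (x := y - x)) ?subr_ge0// => h.
  have : `|s * (f x - f y)| <= k * (y - x) by rewrite normrM s1 mul1r distrC.
  by move/(le_trans (ler_norm _)); lra.
have rc s : right_continuous (fun x => k * x + s * f x).
  apply: right_continuousW => x; apply: cvgD; apply: cvgM => //; try exact: cvg_cst.
  exact: cf.
have n1 := nd 1 (normr1 _); have n2 := nd (-1) (normrN1 _).
pose G1 : cumulative R R := HB.pack_for (cumulative R R) (fun x => k * x + 1 * f x)
  (isCumulative.Build R _ R (fun x => k * x + 1 * f x) n1 (rc 1)).
pose G2 : cumulative R R := HB.pack_for (cumulative R R) (fun x => k * x + (-1) * f x)
  (isCumulative.Build R _ R (fun x => k * x + (-1) * f x) n2 (rc (-1))).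
have G12 x : G1 x + G2 x = (2 * k) * x by rewrite /G1 /G2 /=; ring.
have k20 : 0 < 2 * k by rewrite mulr_gt0.
have ab1 : a <= b + 1 by lra.
have [h [ih hE]] := stieltjes_density k20 G12 ab1.
pose F y := Rintegral leb `]a, y]%classic h.
have FE y : a <= y -> y <= b + 1 -> F y = k * y + f y - (k * a + f a).
  by move=> ay yb; rewrite /F /Rintegral hE//= !mul1r.
have hae : {ae leb, forall x, a < x -> x <= b -> `|h x - k| <= 1}.
  have ih' y : leb.-integrable `]a, y]%classic (EFin \o h).
    exact: integrableS ih.
  have lh : locally_integrable [set: R] h by apply: open_integrable_locally => //; exact: openT.
  have := FTC1 (a := BRight a) ih' lh.
  move: fae; apply: filterS2; first exact: (ae_filter_ringOfSetsType leb).
  move=> x f1 /= hx ax xb.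
  have ax' : a < x := ax.
  have [dF Fx] := hx ax'.
  have nf : \forall y \near x, F y - k * y + (k * a + f a) = f y.
    near=> y.
    have y1 : `|x - y| < x - a by near: y; apply: cvgr_dist_lt => //; rewrite subr_gt0.
    have y2 : `|x - y| < 1 by near: y; apply: cvgr_dist_lt.
    move: y1 y2; rewrite !ltr_norml => /andP[_ y1] /andP[y2 _].
    by rewrite FE; [ring|lra|lra].
  have dl : is_derive x 1 (fun y => F y - k * y + (k * a + f a)) (h x - k).
    have dF' : is_derive x 1 F (h x) := DeriveDef dF (etrans (esym (derive1E F x)) Fx).
    apply: is_derive_eq; rewrite /GRing.scale/=; ring.
  have := near_eq_is_derive nf dl => -[_ df].
  by move: f1; rewrite derive1E df.
have mh : measurable_fun setT h by apply/measurable_EFinP; exact: measurable_int ih.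
(* The truncation agrees with [h] almost everywhere on the interval and is bounded
everywhere. *)
pose h1 x := Num.max (k - 1) (Num.min (h x) (k + 1)).
have h1b x : `|h1 x - k| <= 1.
  rewrite /h1 ler_norml; apply/andP; split.
    by rewrite lerBrDl le_max; apply/orP; left; lra.
  by rewrite lerBlDl ge_max ge_min; apply/andP; split; [lra|apply/orP; right; lra].
have lh1 : lbm h1.
  split; first by apply: measurable_maxr => //; apply: measurable_minr.
  move=> L; exists (1 + `|k|) => x _; have := ler_normD (h1 x - k) k; rewrite subrK.
  by have := h1b x; lra.
have e1 : F b = Rintegral leb `]a, b]%classic h1.
  rewrite /F /Rintegral; congr fine; apply: ae_eq_integral => //.
  - by apply/measurable_EFinP; exact: measurable_funTS.
  - by apply/measurable_EFinP; exact: measurable_funTS lh1.1.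
  - move: hae; apply: filterS; first exact: (ae_filter_ringOfSetsType leb).
    move=> x hx; rewrite /= in_itv/= => /andP[/hx hx' /hx'].
    rewrite ler_norml => /andP[p q]; rewrite /h1 min_l ?max_r//; lra.
have := RI_close (@leb_fin R) (k := k) (e := 1) (a := a) (b := b) lh1 (fun x _ _ => h1b x).
rewrite -e1 fine_leb// mul1r FE//; last lra.
by rewrite (_ : k * b + f b - (k * a + f a) - k * (b - a) = f b - f a)//; ring.
Unshelve. all: by end_near. Qed.
End Rademacher.

(** * Flat smooth functions *)

Section Smooth.
Context {R : realType}.
Implicit Types (f g : R -> R) (x y c l : R) (p q : {poly R}).

(** Differentiability in the form used for functions defined by integrals or by cases. *)
Lemma is_derive_eps f x l :
  (forall e, 0 < e -> exists2 d, 0 < d & forall y, `|y - x| <= d ->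
     `|f y - f x - l * (y - x)| <= e * `|y - x|) -> is_derive x 1 f l.
Proof.
move=> H.
have lim : h^-1 *: (f (h *: 1 + x) - f x) @[h --> 0^'] --> l.
  apply/cvgrPdist_le => e e0; have [d d0 Hd] := H e e0.
  near=> h.
  have h0 : h != 0 by near: h; exact: nbhs_dnbhs_neq.
  have hd : `|h| <= d by near: h; apply: dnbhs0_le.
  rewrite /GRing.scale/= mulr1.
  have := Hd (h + x); rewrite addrK => /(_ hd) k.
  have -> : l - h^-1 * (f (h + x) - f x) = - (h^-1 * (f (h + x) - f x - l * h)) by field.
  by rewrite normrN normrM normfV ler_pdivrMl ?normr_gt0// [leRHS]mulrC.
by split; [apply/cvg_ex; exists l|exact: cvg_lim lim].
Unshelve. all: by end_near. Qed.

(** Differentiability [n] times everywhere, by recursion on the derivative: a form that is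
stable under sums, products and affine substitutions by induction on [n]. *)
Fixpoint nder (n : nat) f : Prop :=
  if n is m.+1 then (forall x, derivable f x 1) /\ nder m (derive1 f) else True.

Definition smooth f := forall n, nder n f.

Lemma nderS n f g : (forall x, is_derive x 1 f (g x)) -> nder n g -> nder n.+1 f.
Proof.
move=> fg ng; split; first by move=> x; have [] := fg x.
suff -> : derive1 f = g by [].
by apply/funext => x; rewrite derive1E; have [_ ->] := fg x.
Qed.

Lemma nder_is_derive n f : nder n.+1 f -> forall x, is_derive x 1 f (derive1 f x).
Proof. by move=> [df _] x; rewrite derive1E; split. Qed.

Lemma nderW n f : nder n.+1 f -> nder n f.
Proof.
elim: n f => [//|n IH] f [df nf]; split => //; exact: IH.
Qed.

Lemma smooth_derivable f : smooth f -> forall n x, derivable (derive1n n f) x 1.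
Proof.
move=> sf n; elim: n f sf => [|n IH] f sf x; first by have [] := sf 1.
by rewrite derive1Sn; apply: IH => m; have [] := sf m.+1.
Qed.

Lemma nder_cst n c : nder n (fun=> c).
Proof.
elim: n c => [//|n IH] c; apply: (nderS (g := fun=> 0)) => //.
Qed.

Lemma nderD n f g : nder n f -> nder n g -> nder n (fun x => f x + g x).
Proof.
elim: n f g => [//|n IH] f g nf ng.
apply: (nderS (g := fun x => derive1 f x + derive1 g x)).
  by move=> x; exact: (is_deriveD (nder_is_derive nf x) (nder_is_derive ng x)).
by apply: IH; [exact: nf.2|exact: ng.2].
Qed.

Lemma nderM n f g : nder n f -> nder n g -> nder n (fun x => f x * g x).
Proof.
elim: n f g => [//|n IH] f g nf ng.
apply: (nderS (g := fun x => f x * derive1 g x + g x * derive1 f x)).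
  by move=> x; exact: (is_deriveM (nder_is_derive nf x) (nder_is_derive ng x)).
apply: nderD; apply: IH; [exact: nderW|exact: ng.2|exact: nderW|exact: nf.2].
Qed.

Lemma nder_affine n f s c : nder n f -> nder n (fun x => f (s * x + c)).
Proof.
elim: n f => [//|n IH] f nf.
have d x : is_derive x 1 (fun x => f (s * x + c)) (derive1 f (s * x + c) * s).
  have dg : is_derive x 1 (fun x : R => s * x + c) s.
    apply: (is_derive_eq (is_deriveD (is_deriveZ s (is_derive_id x 1)) (is_derive_cst c x 1))).
    by rewrite /GRing.scale/= mulr1 addr0.
  exact: (@is_derive1_comp _ f (fun x => s * x + c) x _ s (nder_is_derive nf _) dg).
apply: (nderS d); apply: nderM; [apply: IH; exact: nf.2|exact: nder_cst].
Qed.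

(** The function [p(1/x) exp(- 1/x)] for [x > 0], extended by zero. This class is closed under
derivation, which proves smoothness for all of its members at once. *)
Definition flat p x : R := if 0 < x then p.[x^-1] * expR (- x^-1) else 0.

(** The extra power [t ^+ k] makes the induction on [p] work. *)
Lemma poly_exp_bound p k : exists2 C : R, 0 <= C & forall t, 0 <= t -> t ^+ k * `|p.[t]| * expR (- t) <= C.
Proof.
elim/poly_ind: p k => [|p c IH] k.
  by exists 0 => // t _; rewrite horner0 normr0 mulr0 mul0r.
have mono j : exists2 C : R, 0 <= C & forall t, 0 <= t -> t ^+ j * expR (- t) <= C.
  case: j => [|j].
    exists 1 => // t t0; rewrite expr0 mul1r -expR0 ler_expR lerNl oppr0//.
  exists (j.+1%:R ^+ j.+1); first exact: exprn_ge0.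
  move=> t t0; rewrite expRN ler_pdivrMr ?expR_gt0//.
  have j0 : 0 < j.+1%:R :> R by rewrite ltr0n.
  have h : t / j.+1%:R <= expR (t / j.+1%:R).
    by apply: le_trans (expR_ge1Dx _); rewrite lerDr.
  have -> : expR t = expR (t / j.+1%:R) ^+ j.+1.
    by rewrite -expRM_natl; congr expR; field; rewrite gt_eqF.
  have -> : t ^+ j.+1 = j.+1%:R ^+ j.+1 * (t / j.+1%:R) ^+ j.+1.
    by rewrite -exprMn; congr (_ ^+ _); field; rewrite gt_eqF.
  by rewrite ler_pM2l ?exprn_gt0//; apply: lerXn2r; rewrite ?nnegrE ?divr_ge0 ?expR_ge0.
have [C C0 hC] := IH k.+1; have [D D0 hD] := mono k.
exists (C + `|c| * D); first by rewrite addr_ge0// mulr_ge0.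
move=> t t0; rewrite hornerMXaddC.
have n1 : `|p.[t] * t + c| <= `|p.[t]| * t + `|c|.
  by apply: le_trans (ler_normD _ _) _; rewrite normrM (ger0_norm t0).
apply: (@le_trans _ _ (t ^+ k * (`|p.[t]| * t + `|c|) * expR (- t))).
  by rewrite ler_wpM2r ?expR_ge0// ler_wpM2l// exprn_ge0.
have -> : t ^+ k * (`|p.[t]| * t + `|c|) * expR (- t) =
  t ^+ k.+1 * `|p.[t]| * expR (- t) + `|c| * (t ^+ k * expR (- t)) by rewrite exprSr; ring.
by apply: lerD; [exact: hC|rewrite ler_wpM2l// hD].
Qed.

(** At [0] the difference quotient is [y^(-1) p(1/y) exp(- 1/y)], which is [O(y)] because
[t^2 p(t) exp(- t)] is bounded. *)
Lemma flat_derive p x : is_derive x 1 (flat p) (flat ('X^2 * (p - p^`())) x).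
Proof.
have [x0|x0|->] := ltgtP x 0.
- have -> : flat ('X^2 * (p - p^`())) x = 0 by rewrite /flat ltNge (ltW x0).
  have c0 : is_derive x 1 (fun=> 0 : R) (0 : R) := is_derive_cst (0 : R) x 1.
  apply: near_eq_is_derive c0.
  near=> y; rewrite /flat ltNge ltW//; near: y; exact: lt_nbhsl.
- have xn0 : x != 0 by rewrite gt_eqF.
  apply: (near_eq_is_derive (f := fun y => p.[y^-1] * expR (- y^-1))).
    near=> y; rewrite /flat ifT//.
    have : `|x - y| < x by near: y; apply: cvgr_dist_lt.
    by rewrite ltr_norml => /andP[_]; lra.
  have dV : is_derive x 1 (fun y : R => y^-1) (- x ^- 2).
    apply: (is_derive_eq (is_deriveV (f := id) xn0 (is_derive_id x 1))).
    by rewrite /GRing.scale/= mulr1.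
  have d1 : is_derive x 1 (fun y => p.[y^-1]) ((p^`()).[x^-1] * - x ^- 2).
    exact: (@is_derive1_comp _ (fun y => p.[y]) (fun y => y^-1) x _ _ (is_derive_poly p _) dV).
  have d2 : is_derive x 1 (fun y => expR (- y^-1)) (expR (- x^-1) * x ^- 2).
    have dN : is_derive x 1 (fun y : R => - y^-1) (x ^- 2).
      by apply: (is_derive_eq (is_deriveN dV)); rewrite opprK.
    exact: (@is_derive1_comp _ expR (fun y => - y^-1) x _ _ (is_derive_expR _) dN).
  apply: (is_derive_eq (is_deriveM d1 d2)).
  rewrite -[LHS]/(p.[x^-1] * (expR (- x^-1) * x ^- 2) + expR (- x^-1) * ((p^`()).[x^-1] * - x ^- 2)).
  by rewrite /flat x0 hornerM hornerXn hornerD hornerN -!exprVn; ring.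
have -> : flat ('X^2 * (p - p^`())) 0 = 0 by rewrite /flat ltxx.
have p0 : flat p 0 = 0 by rewrite /flat ltxx.
apply: is_derive_eps => e e0.
have [C C0 hC] := poly_exp_bound p 2.
exists (e / (C + 1)); first by rewrite divr_gt0// ltr_wpDl.
move=> y; rewrite p0 mul0r !subr0 => yd.
rewrite /flat; case: ifP => [y0|]; last by rewrite normr0 mulr_ge0// ltW.
have yi : 0 <= y^-1 by rewrite invr_ge0 ltW.
have := hC _ yi; rewrite exprVn -mulrA ler_pdivrMl ?exprn_gt0// => h.
rewrite normrM (ger0_norm (expR_ge0 _)); apply: le_trans h _.
move: yd; rewrite (gtr0_norm y0) ler_pdivlMr ?ltr_wpDl// => yd.
by rewrite expr2 -mulrA mulrCA mulrC ler_pM2r//; apply: le_trans yd; rewrite ler_pM2l//; lra.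
Unshelve. all: by end_near. Qed.

Lemma flat_smooth p : smooth (flat p).
Proof.
move=> n; elim: n p => [//|n IH] p.
by apply: nderS; [exact: flat_derive|exact: IH].
Qed.

End Smooth.

(** * Bump functions and test functions *)

Section Bump.
Context {R : realType}.
Implicit Types (f F : R -> R) (a b x y e s L : R).

Lemma lI_additive f : lbm f -> additive_itv (lI f).
Proof. by move=> lf a b c ab bc; apply: RI_chasles => //; exact: leb_fin. Qed.

Lemma orient_lI_derive f a x : continuous f -> is_derive x 1 (orient (lI f) a) (f x).
Proof.
move=> cf; have lf := lbm_continuous cf; have add := lI_additive lf.
apply: is_derive_eps => e e0.
have /cvgrPdist_le/(_ e e0) := cf x; rewrite -nbhs_nearE => /nbhs_ballP[d /= d0 hd].
exists (d / 2); first by rewrite divr_gt0.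
move=> y yx; rewrite orientB//.
have ft t : `|t - x| <= d / 2 -> `|f t - f x| <= e.
  by move=> tx; rewrite distrC; apply: hd; rewrite /ball/= distrC; lra.
have H (c d' : R) : c <= d' -> (forall t, c < t -> t <= d' -> `|t - x| <= d / 2) ->
    `|lI f c d' - f x * (d' - c)| <= e * (d' - c).
  move=> cd ct; have := RI_close (@leb_fin R) (k := f x) (e := e) (a := c) (b := d') lf.
  by rewrite fine_leb//; apply => t t1 t2; apply: ft; exact: ct.
move: yx; rewrite ler_norml => /andP[y1 y2].
have [xy|/ltW yx] := leP x y.
  rewrite orient_le// [X in e * X]ger0_norm ?subr_ge0//; apply: H => // t xt ty.
  by rewrite ler_norml; apply/andP; split; lra.
rewrite (orientN _ _ add) orient_le//.
have -> : - lI f y x - f x * (y - x) = - (lI f y x - f x * (x - y)) by ring.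
rewrite normrN [X in e * X]distrC [X in e * X]ger0_norm ?subr_ge0//; apply: H => // t xt ty.
by rewrite ler_norml; apply/andP; split; lra.
Qed.

Lemma derive_continuous F f : (forall x, is_derive x 1 F (f x)) -> continuous F.
Proof.
by move=> dF x; apply/differentiable_continuous/derivable1_diffP; have [] := dF x.
Qed.

Lemma FTC_orient F f : (forall x, is_derive x 1 F (f x)) -> continuous f ->
  forall x y, F y - F x = orient (lI f) x y.
Proof.
move=> dF cf x y.
have d0 (z : R) : is_derive z 1 (fun z : R => F z - orient (lI f) x z) 0.
  by have := is_deriveB (dF z) (orient_lI_derive x z cf); rewrite subrr.
have := is_derive_0_is_cst y x d0.
rewrite (orientxx _ (lI_additive (lbm_continuous cf))) subr0 => <-; ring.
Qed.

Lemma lI_eq f F a b : (forall x, a < x -> x <= b -> f x = F x) -> lI f a b = lI F a b.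
Proof.
move=> fF; congr fine; apply: eq_integral => x; rewrite inE/= in_itv/= => /andP[ax xb].
by rewrite fF.
Qed.

Lemma lI_eq_cst f k a b : a <= b -> (forall x, a < x -> x <= b -> f x = k) ->
  lI f a b = k * (b - a).
Proof. by move=> ab fk; rewrite (lI_eq fk) /lI RI_cst fine_leb. Qed.

Lemma lI_eq0 f a b : (forall x, a < x -> x <= b -> f x = 0) -> lI f a b = 0.
Proof. by move=> f0; rewrite (lI_eq f0) /lI RI_cst mul0r. Qed.

Lemma Re_cI (f : R -> R[i]) a b : complex.Re (cI f a b) = orient (lI (Ref f)) a b.
Proof. by rewrite /cI /orient; case: ifP. Qed.

Lemma Im_cI (f : R -> R[i]) a b : complex.Im (cI f a b) = orient (lI (Imf f)) a b.
Proof. by rewrite /cI /orient; case: ifP. Qed.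

Lemma clbm_real f : lbm f -> clbm (fun x => (f x)%:C).
Proof. by move=> lf; split => //; exact: lbm_cst. Qed.

Lemma orient_lI0 a b : orient (lI (fun=> 0 : R)) a b = 0.
Proof. by rewrite /orient /lI !RI_cst !mul0r oppr0; case: ifP. Qed.

Lemma cI_real f a b : cI (fun x => (f x)%:C) a b = (orient (lI f) a b)%:C.
Proof. by apply: complex_ext; rewrite ?Re_cI ?Im_cI//= orient_lI0. Qed.

Lemma prim_real F f : (forall x, is_derive x 1 F (f x)) -> continuous f ->
  prim (fun x => (f x)%:C) (fun x => (F x)%:C).
Proof.
move=> dF cf; split; first exact/clbm_real/lbm_continuous.
by move=> x y; rewrite cI_real -(FTC_orient dF cf) rmorphB.
Qed.

Section Beta.
Variable e : R.
Hypotheses (e0 : 0 < e) (e1 : e <= 1).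

(** A smooth nonnegative bump supported in [[0, e]], product of a flat function and its mirror
image. *)
Definition beta x : R := flat 1 x * flat 1 (-1 * x + e).

Lemma flat1E x : 0 < x -> flat 1 x = expR (- x^-1).
Proof. by move=> x0; rewrite /flat x0 hornerC mul1r. Qed.

Lemma flat1_ge0 x : 0 <= flat 1 x.
Proof. by rewrite /flat; case: ifP => // _; rewrite hornerC mul1r expR_ge0. Qed.

Lemma flat_le0 (p : {poly R}) x : x <= 0 -> flat p x = 0.
Proof. by move=> x0; rewrite /flat ltNge x0. Qed.

Lemma beta_ge0 x : 0 <= beta x.
Proof. by rewrite mulr_ge0 ?flat1_ge0. Qed.

Lemma beta_out x : x <= 0 \/ e <= x -> beta x = 0.
Proof.
case=> x0; rewrite /beta; first by rewrite flat_le0 ?mul0r.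
by rewrite (@flat_le0 _ (-1 * x + e)) ?mulr0//; lra.
Qed.

Lemma beta_smooth : smooth beta.
Proof. by move=> n; apply: nderM; [exact: flat_smooth|apply: nder_affine; exact: flat_smooth]. Qed.

Lemma beta_continuous : continuous beta.
Proof. exact: derive_continuous (nder_is_derive (beta_smooth 1)). Qed.

(** The interval [[0, 1]] contains the support since [e <= 1]. *)
Definition beta_mass : R := lI beta 0 1.

(** Any interval that contains [[0, 1]] sees the whole mass. *)
Lemma lI_beta a b : a <= 0 -> 1 <= b -> lI beta a b = beta_mass.
Proof.
move=> a0 b1; have lb := lbm_continuous beta_continuous.
rewrite (lI_additive lb a0 (le_trans ler01 b1)) (lI_additive lb ler01 b1).
have z (c d : R) : d <= 0 \/ 1 <= c -> lI beta c d = 0.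
  move=> cd; apply: lI_eq0 => x cx xd; apply: beta_out.
  case: cd => h; first by left; exact: le_trans xd h.
  by right; exact: le_trans e1 (le_trans h (ltW cx)).
by rewrite (z a 0) ?(z 1 b) ?addr0 ?add0r//; [right|left].
Qed.

Lemma beta_mass_gt0 : 0 < beta_mass.
Proof.
have E0 : 0 < e := e0; have E1 : e <= 1 := e1.
have lb := lbm_continuous beta_continuous.
pose m := expR (- (e / 4)^-1) * expR (- (e / 4)^-1).
have m0 : 0 < m by rewrite mulr_gt0// expR_gt0.
have e40 : 0 < e / 4 by rewrite divr_gt0.
have h1 : lI beta (e / 4) (e / 2) <= beta_mass.
  by apply: lI_mono => //; [move=> x _ _; exact: beta_ge0|lra|lra|lra].
apply: lt_le_trans h1.
have h2 : m * (e / 2 - e / 4) <= lI beta (e / 4) (e / 2).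
  have e42 : e / 4 <= e / 2 by lra.
  rewrite -(fine_leb e42) -RI_cst; apply: RI_le => //; [exact: leb_fin|exact: lbm_cst|].
  have fm x : e / 4 <= x -> expR (- (e / 4)^-1) <= flat 1 x.
    move=> xe; rewrite flat1E; last exact: lt_le_trans xe.
    by rewrite ler_expR lerN2 lef_pV2 ?posrE//; exact: lt_le_trans xe.
  move=> x x1 x2; rewrite /beta /m; apply: ler_pM; rewrite ?expR_ge0// fm//; lra.
apply: lt_le_trans h2; rewrite mulr_gt0//; lra.
Qed.

Let B := orient (lI beta) 0.
Let B2 := orient (lI B) 0.

Let dB x : is_derive x 1 B (beta x).
Proof. exact: (orient_lI_derive 0 x beta_continuous). Qed.

Let cB : continuous B. Proof. exact: derive_continuous dB. Qed.

Let dB2 x : is_derive x 1 B2 (B x).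
Proof. exact: (orient_lI_derive 0 x cB). Qed.

Let B_le0 x : x <= 0 -> B x = 0.
Proof.
move=> x0; rewrite /B (orientN _ _ (lI_additive (lbm_continuous beta_continuous))) orient_le//.
by rewrite lI_eq0 ?oppr0// => t _ t0; apply: beta_out; left.
Qed.

Let B_ge1 x : 1 <= x -> B x = beta_mass.
Proof. by move=> x1; rewrite /B orient_le ?(le_trans ler01)// lI_beta. Qed.

Let B2_le0 x : x <= 0 -> B2 x = 0.
Proof.
move=> x0; rewrite /B2 (orientN _ _ (lI_additive (lbm_continuous cB))) orient_le//.
by rewrite lI_eq0 ?oppr0// => t _ t0; apply: B_le0.
Qed.

Let B2_ge1 x : 1 <= x -> B2 x = B2 1 + beta_mass * (x - 1).
Proof.
move=> x1; rewrite /B2 (orient_chasles (lI_additive (lbm_continuous cB)) 0 1 x).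
congr (_ + _); rewrite orient_le//; apply: lI_eq_cst => // t t1 _.
by apply: B_ge1; exact: ltW.
Qed.

Let comb (f : R -> R) x y := (1 - x) * f (1 * y + 0) + (-1) * f (1 * y + (- x)) + x * f (1 * y + (-1)).

Let comb_derive (f g : R -> R) x : (forall y, is_derive y 1 f (g y)) ->
  forall y, is_derive y 1 (comb f x) (comb g x y).
Proof.
move=> fg y.
have ds c : is_derive y 1 (fun y => f (1 * y + c)) (g (1 * y + c)).
  have dg : is_derive y 1 (fun x : R => 1 * x + c) 1.
    apply: (is_derive_eq (is_deriveD (is_deriveZ 1 (is_derive_id y 1)) (is_derive_cst c y 1))).
    by rewrite scale1r addr0.
  rewrite -[g _]mulr1.
  exact: (@is_derive1_comp _ f (fun x => 1 * x + c) y _ 1 (fg _) dg).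
exact: (is_deriveD (is_deriveD (is_deriveZ (1 - x) (ds 0)) (is_deriveZ (-1) (ds (- x)))) (is_deriveZ x (ds (-1)))).
Qed.

Let comb_nder n (f : R -> R) x : nder n f -> nder n (comb f x).
Proof.
move=> nf; apply: nderD; first apply: nderD; apply: nderM;
  by [exact: nder_cst|apply: nder_affine].
Qed.

(** A smoothed second order difference [(1 - x) delta_0 - delta_x + x delta_1]. It annihilates
affine functions, so that it is the second derivative of a test function; conversely, functions
that it annihilates for all [x] and all [e] are affine. *)
Definition test_density x y := (1 - x) * beta y - beta (y - x) + x * beta (y - 1).

(** The second antiderivative [B2] of the bump vanishes to the left of the bump and is affine to
the right of it. The combination with weights [1 - x], [-1], [x] of its translates by [0], [x],
[1] cancels the affine parts, so it has compact support. *)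
Lemma second_difference_test x : exists (phi phi1 : R -> R) (L : R),
  [/\ test_function (fun y => (phi y)%:C),
      forall y, cderive1n 2 (fun y => (phi y)%:C) y = (test_density x y)%:C,
      prim (fun y => (phi1 y)%:C) (fun y => (phi y)%:C),
      prim (fun y => (test_density x y)%:C) (fun y => (phi1 y)%:C) &
      forall y, L <= `|y| -> [/\ phi y = 0, phi1 y = 0 & test_density x y = 0]].
Proof.
have E0 : 0 < e := e0; have E1 : e <= 1 := e1.
exists (comb B2 x), (comb B x), (`|x| + 2).
have cbE y : comb beta x y = test_density x y.
  by rewrite /comb /test_density !mul1r addr0 mulN1r.
have d1 := comb_derive x dB2; have d2 := comb_derive x dB.
have d2' y : is_derive y 1 (comb B x) (test_density x y) by rewrite -cbE.
have sm : smooth (comb B2 x).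
  move=> [//|[|n]].
    by split => // y; have [] := d1 y.
  by apply: (nderS d1); apply: (nderS d2); apply: comb_nder; exact: beta_smooth.
have cdens : continuous (test_density x).
  have -> : test_density x = comb beta x by apply/funext => y; rewrite cbE.
  exact: derive_continuous (nder_is_derive (comb_nder x (beta_smooth 1))).
have D1 : derive1 (comb B2 x) = comb B x.
  by apply/funext => y; rewrite derive1E; have [_ ->] := d1 y.
have D2 : derive1 (comb B x) = test_density x.
  by apply/funext => y; rewrite derive1E; have [_ ->] := d2' y.
have out y : `|x| + 2 <= `|y| -> [/\ comb B2 x y = 0, comb B x y = 0 & test_density x y = 0].
  have := ler_norm x; have := ler_norm (- x); rewrite normrN => x1 x2 yL.
  have [y0|/ltW y0] := leP 0 y.
    rewrite (ger0_norm y0) in yL.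
    split.
    - by rewrite /comb !mul1r addr0 (@B2_ge1 y) ?(@B2_ge1 (y - x)) ?(@B2_ge1 (y - 1)); [ring|lra|lra|lra].
    - rewrite /comb !mul1r addr0 !B_ge1; [ring|lra|lra|lra].
    - by rewrite /test_density !beta_out; [ring|right; lra|right; lra|right; lra].
  rewrite (ler0_norm y0) in yL.
  split.
  - rewrite /comb !mul1r addr0 !B2_le0; [ring|lra|lra|lra].
  - rewrite /comb !mul1r addr0 !B_le0; [ring|lra|lra|lra].
  - by rewrite /test_density !beta_out; [ring|left; lra|left; lra|left; lra].
have I0 n : derive1n n (fun _ : R => 0 : R) = fun=> 0.
  elim: n => [//|n IH]; rewrite derive1Sn -[RHS]IH; congr derive1n.
  by apply/funext => y; rewrite derive1_cst.
pose phi y : R[i] := (comb B2 x y)%:C.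
have T1 : csmooth phi.
  move=> n y.
  have h1 : derivable (derive1n n (comb B2 x)) y 1 by exact: smooth_derivable.
  have h2 : derivable (derive1n n (fun _ : R => 0 : R)) y 1.
    by rewrite I0; exact: derivable_cst.
  exact: conj h1 h2.
have T2 : compact (spt phi).
  apply: (subclosed_compact (@closed_closure _ _) (@segment_compact R (- (`|x| + 2)) (`|x| + 2))).
  have cl : closed (`[- (`|x| + 2), `|x| + 2]%classic : set R) by exact: itv_closed.
  have clE := (closure_id _).1 cl.
  have sub : [set y | phi y != 0] `<=` `[- (`|x| + 2), `|x| + 2]%classic.
    move=> y /= py; rewrite in_itv/= -ler_norml leNgt; apply/negP => /ltW /out[py0 _ _].
    by rewrite /phi py0 eqxx in py.
  by move/closure_subset: sub; rewrite -clE.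
have T3 y : cderive1n 2 phi y = (test_density x y)%:C.
  have a1 : derive1n 2 (Ref phi) y = test_density x y.
    by rewrite derive1nS derive1n1 -[Ref phi]/(comb B2 x) D1 D2.
  have a2 : derive1n 2 (Imf phi) y = 0 by rewrite -[Imf phi]/(fun=> 0) I0.
  by rewrite /cderive1n a1 a2.
split.
- exact: conj T1 T2.
- exact: T3.
- by apply: prim_real d1 _; exact: derive_continuous d2.
- exact: prim_real d2' cdens.
- exact: out.
Qed.

End Beta.
End Bump.

(** * Weak second derivatives and local bounded variation *)

Section Affine.
Context {R : realType}.
Implicit Types (f h : R -> R[i]) (x y s e L : R).

Lemma ccontinuous_eps h x e : ccontinuous h -> 0 < e ->
  exists2 d, 0 < d & forall y, `|y - x| <= d -> cabs (h y - h x) <= e.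
Proof.
move=> [rh ih] e0; have e20 : 0 < e / 2 by rewrite divr_gt0.
have /cvgrPdist_le/(_ _ e20) := rh x; rewrite -nbhs_nearE => /nbhs_ballP[d1 /= d10 h1].
have /cvgrPdist_le/(_ _ e20) := ih x; rewrite -nbhs_nearE => /nbhs_ballP[d2 /= d20 h2].
exists (Num.min d1 d2 / 2); first by rewrite divr_gt0// lt_min d10.
move=> y yx; have m0 : 0 < Num.min d1 d2 by rewrite lt_min d10.
have yd : `|x - y| < Num.min d1 d2 by rewrite distrC; lra.
move: yd; rewrite lt_min => /andP[y1 y2].
apply: le_trans (cabs_le _) _; rewrite Re_add Im_add Re_opp Im_opp.
have := h1 y y1; have := h2 y y2; rewrite /= distrC (distrC (Ref h x)) /Ref /Imf; lra.
Qed.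

(** Averaging against a bump at [s] nearly reproduces the value at [s]. *)
Lemma beta_average h s e eps L : ccontinuous h -> 0 < e -> e <= 1 ->
  `|s| + 1 <= L -> (forall y, `|y - s| <= e -> cabs (h y - h s) <= eps) ->
  cabs (cI (fun y => h y * (beta e (y - s))%:C) (- L) L - h s * (beta_mass e)%:C)
    <= 2 * eps * beta_mass e.
Proof.
move=> ch e0 e1 sL hs; have ch' := clbm_continuous ch.
have lb := lbm_continuous (@beta_continuous R e).
have lbs : lbm (fun y => beta e (y - s)) by exact: (lbm_shift (- s) lb).
have cbs := clbm_real lbs.
have := ler_norm s; have := ler_norm (- s); rewrite normrN => s1 s2.
have LL : - L <= L by lra.
have mass : lI (fun y => beta e (y - s)) (- L) L = beta_mass e.
  by rewrite -(lI_shift (- L) L (- s) lb) lI_beta//; lra.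
rewrite -mass -[(lI _ _ _)%:C](congr1 (real_complex _) (orient_le _ LL)) -cI_real.
rewrite -cI_Z// -cI_B; [|by clbm_tac|by clbm_tac].
apply: le_trans (_ : 2 * lI (fun y => eps * beta e (y - s)) (- L) L <= _); last first.
  by rewrite /lI (RI_Z (@leb_fin R))// mulrA.
apply: cI_le; [exact: LL|by clbm_tac|exact: lbmM (lbm_cst _) lbs|].
move=> y _ _; rewrite -mulrBl cabsM cabs_real ger0_norm ?beta_ge0//.
have [ys|ys] := leP `|y - s| e; first by rewrite ler_wpM2r ?beta_ge0 ?hs.
rewrite (_ : beta e (y - s) = 0) ?mulr0//; apply: beta_out.
have [p|p] := leP (y - s) 0; first by left.
by right; move: ys; rewrite gtr0_norm// => /ltW.
Qed.

(** A continuous function whose second distributional derivative is zero is affine: as [e] tends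
to zero, the hypothesis becomes the vanishing of the second order difference
[(1 - x) h(0) - h(x) + x h(1)]. *)
Lemma affine_of_weak h : ccontinuous h ->
  (forall x e, 0 < e -> e <= 1 -> exists L0, forall L, L0 <= L ->
     cI (fun y => h y * (test_density e x y)%:C) (- L) L = 0) ->
  forall x, h x = h 0 + x%:C * (h 1 - h 0).
Proof.
move=> ch H x; apply/eqP; rewrite -subr_eq0; apply/eqP; apply: cabs_eq0.
apply: le_anti; rewrite cabs_ge0 andbT; apply/ler_addgt0Pl => eps eps0; rewrite addr0.
have x0 : 0 <= `|x| by [].
(* [2 + 2 |x|] bounds the sum of the absolute weights [|1 - x| + 1 + |x|] of the three
averages. *)
pose c : R := 2 * (2 + 2 * `|x|).
have c0 : 0 < c by rewrite mulr_gt0//; lra.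
pose e' := eps / c; have e'0 : 0 < e' by rewrite divr_gt0.
have [d1 d10 h1] := ccontinuous_eps 0 ch e'0.
have [d2 d20 h2] := ccontinuous_eps x ch e'0.
have [d3 d30 h3] := ccontinuous_eps 1 ch e'0.
pose e := Num.min 1 (Num.min d1 (Num.min d2 d3)).
have e0 : 0 < e by rewrite !lt_min ltr01 d10 d20.
have e1 : e <= 1 by rewrite ge_min lexx.
have ed1 : e <= d1 by rewrite !ge_min lexx orbT.
have ed2 : e <= d2 by rewrite !ge_min lexx !orbT.
have ed3 : e <= d3 by rewrite !ge_min lexx !orbT.
have [L0 HL] := H x e e0 e1.
pose L := Num.max L0 (`|x| + 2).
have L1 : L0 <= L by rewrite le_max lexx.
have L2 : `|x| + 2 <= L by rewrite le_max lexx orbT.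
have n0 : `|0 : R| + 1 <= L by rewrite normr0; lra.
have n1 : `|1 : R| + 1 <= L by rewrite normr1; lra.
have nx : `|x| + 1 <= L by lra.
have a1 := beta_average ch e0 e1 n0 (fun y yd => h1 y (le_trans yd ed1)).
have a2 := beta_average ch e0 e1 nx (fun y yd => h2 y (le_trans yd ed2)).
have a3 := beta_average ch e0 e1 n1 (fun y yd => h3 y (le_trans yd ed3)).
have := HL L L1; have ch' := clbm_continuous ch.
have lb := lbm_continuous (@beta_continuous R e).
have cb s : clbm (fun y => (beta e (y - s))%:C) by exact/clbm_real/(lbm_shift (- s) lb).
have M0 := beta_mass_gt0 e0 e1.
set J0 := cI _ _ _ in a1; set Jx := cI _ _ _ in a2; set J1 := cI _ _ _ in a3.
have -> : cI (fun y => h y * (test_density e x y)%:C) (- L) L =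
   (1 - x)%:C * J0 + (-1) * Jx + x%:C * J1.
  have c_0 := clbmM ch' (cb 0); have c_x := clbmM ch' (cb x); have c_1 := clbmM ch' (cb 1).
  rewrite -!cI_Z// -!cI_D; [|by clbm_tac; apply: cb..].
  apply: cI_ext => y; rewrite /test_density subr0.
  by rewrite !(rmorphD, rmorphM, rmorphN, rmorph1)/=; ring.
clearbody J0 Jx J1; move=> HJ; set M := beta_mass e in a1 a2 a3 M0.
have D : (h x - (h 0 + x%:C * (h 1 - h 0))) * M%:C =
   (1 - x)%:C * (J0 - h 0 * M%:C) + (-1) * (Jx - h x * M%:C) + x%:C * (J1 - h 1 * M%:C).
  transitivity ((1 - x)%:C * J0 + -1 * Jx + x%:C * J1 + (h x - (h 0 + x%:C * (h 1 - h 0))) * M%:C).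
    by rewrite HJ add0r.
  by rewrite rmorphB rmorph1; ring.
have DM : cabs (h x - (h 0 + x%:C * (h 1 - h 0))) * M <= eps * M.
  have -> : M = cabs M%:C by rewrite cabs_real gtr0_norm.
  rewrite -cabsM D cabs_real gtr0_norm//.
  apply: le_trans (cabsD _ _) _; apply: le_trans (lerD (cabsD _ _) (le_refl _)) _.
  rewrite !cabsM cabsN cabs1 mul1r !cabs_real.
  have b1 := ler_wpM2l (normr_ge0 (1 - x)) a1; have b3 := ler_wpM2l x0 a3.
  have q : `|1 - x| <= 1 + `|x| by apply: le_trans (ler_normB _ _) _; rewrite normr1.
  have W0 : 0 <= 2 * e' * M.
    by apply: mulr_ge0; [apply: mulr_ge0 => //|]; exact: ltW.
  have b4 := ler_wpM2r W0 q.
  apply: le_trans (lerD (lerD b1 a2) b3) _.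
  have -> : eps * M = (2 + 2 * `|x|) * (2 * e' * M).
    by rewrite /e' /c; field; rewrite gt_eqF//; lra.
  by lra.
by move: DM; rewrite ler_pM2r.
Qed.

End Affine.

Section BV.
Context {R : realType}.
Implicit Types (f V : R -> R) (F : R -> R[i]) (L C : R).

(** The projection onto [[- L, L]], used to reduce a local bound on the variation to a global
one. *)
Definition clamp L x : R := Num.max (- L) (Num.min x L).

Lemma clamp_nd L x y : x <= y -> clamp L x <= clamp L y.
Proof.
move=> xy; rewrite /clamp ge_max le_max lexx /= le_max; apply/orP; right.
by rewrite le_min !ge_min xy lexx orbT.
Qed.

Lemma clamp_id L x : `|x| <= L -> clamp L x = x.
Proof. by rewrite ler_norml /clamp => /andP[h1 h2]; rewrite min_l// max_r. Qed.

Lemma clamp_in L x : 0 <= L -> - L <= clamp L x /\ clamp L x <= L.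
Proof.
move=> L0; rewrite /clamp le_max lexx; split => //.
by rewrite ge_max ge_min lexx orbT andbT; lra.
Qed.

(** On [[- n, n]], [f] is the difference of the monotone functions [f + C V] and [C V], hence
measurable; the clamped functions converge pointwise to [f]. *)
Lemma bv_lbm f V : {homo V : x y / x <= y} ->
  (forall L, 0 <= L -> exists2 C, 0 <= C & forall x y, - L <= x -> x <= y -> y <= L ->
    `|f y - f x| <= C * (V y - V x)) -> lbm f.
Proof.
move=> nV H; split; last first.
  move=> L; have [L0|L0] := leP 0 L; last first.
    by exists 0 => x xL; have := normr_ge0 x; lra.
  have [C C0 hC] := H L L0; exists (`|f (- L)| + C * (V L - V (- L))) => x.
  rewrite ler_norml => /andP[x1 x2].
  have h1 := hC (- L) x (lexx _) x1 x2.
  have h2 : C * (V x - V (- L)) <= C * (V L - V (- L)) by rewrite ler_wpM2l// lerD2r nV.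
  have := ler_normD (f (- L)) (f x - f (- L)).
  have -> : f (- L) + (f x - f (- L)) = f x by ring.
  by lra.
apply: (@measurable_fun_cvg _ _ _ setT (fun n x => f (clamp n%:R x))).
  move=> n; have n0 : 0 <= n%:R :> R by [].
  have [C C0 hC] := H n%:R n0.
  have nd1 : {homo (fun x => f (clamp n%:R x) + C * V (clamp n%:R x)) : x y / x <= y}.
    move=> x y xy; have [c1 _] := clamp_in x n0; have [_ c2] := clamp_in y n0.
    have := hC _ _ c1 (clamp_nd n%:R xy) c2.
    rewrite distrC => /(le_trans (ler_norm _)); lra.
  have nd2 : {homo (fun x => C * V (clamp n%:R x)) : x y / x <= y}.
    by move=> x y xy; rewrite ler_wpM2l// nV// clamp_nd.
  have [m _] := lbmB (lbm_nondecreasing nd1) (lbm_nondecreasing nd2).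
  by move: m; congr measurable_fun; apply/funext => x; ring.
move=> x _; apply: cvg_near_cst; near=> n.
rewrite clamp_id//; near: n; exact: nbhs_infty_ger.
Unshelve. all: by end_near. Qed.

Lemma bv_clbm F V : {homo V : x y / x <= y} ->
  (forall L, 0 <= L -> exists2 C, 0 <= C & forall x y, - L <= x -> x <= y -> y <= L ->
    cabs (F y - F x) <= C * (V y - V x)) -> clbm F.
Proof.
move=> nV H; split; apply: (bv_lbm nV) => L L0; have [C C0 hC] := H L L0; exists C => // x y h1 h2 h3.
  by apply: le_trans (hC x y h1 h2 h3); rewrite /Ref -Re_opp -Re_add; exact: cabs_Re.
by apply: le_trans (hC x y h1 h2 h3); rewrite /Imf -Im_opp -Im_add; exact: cabs_Im.
Qed.

End BV.

(** * From the distributional equation to the quasi-derivative system *)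

Section StieltjesLinear.
Context {R : realType}.
Implicit Types (f g u : R -> R[i]) (a b x y : R) (mu : set_function R) (k : R[i]).

Lemma Sr_lin (nu : set (measurableTypeR R) -> R) (f g : R -> R) (k l : R) a b :
  rlocal nu -> lbm f -> lbm g ->
  Sr nu (fun x => k * f x + l * g x) a b = k * Sr nu f a b + l * Sr nu g a b.
Proof.
move=> nuP lf lg; have nuN := rlocalN nuP.
have SE (h : R -> R) : Sr nu h a b =
    Rintegral (pos_part_measure nuP) `]a, b]%classic h - Rintegral (pos_part_measure nuN) `]a, b]%classic h by [].
have lin (m : {measure set (measurableTypeR R) -> \bar R}) :
    (forall c d, (m `]c, d]%classic < +oo)%E) ->
    Rintegral m `]a, b]%classic (fun x => k * f x + l * g x) =
    k * Rintegral m `]a, b]%classic f + l * Rintegral m `]a, b]%classic g.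
  move=> mfin; rewrite (RI_D mfin); [|exact: lbmM (lbm_cst k) lf|exact: lbmM (lbm_cst l) lg].
  by rewrite (RI_Z mfin)// (RI_Z mfin).
rewrite !SE !lin; [ring|..] => c d; exact: pos_part_itv_fin.
Qed.

Lemma cS_Z mu f k a b : clocal mu -> clbm f -> cS mu (fun x => k * f x) a b = k * cS mu f a b.
Proof.
move=> [h1 h2] [rf jf].
have e1 : Ref (fun x => k * f x) = fun x => complex.Re k * Ref f x + - complex.Im k * Imf f x.
  by apply/funext => x; rewrite /Ref Re_mul mulNr.
have e2 : Imf (fun x => k * f x) = fun x => complex.Re k * Imf f x + complex.Im k * Ref f x.
  by apply/funext => x; rewrite /Imf Im_mul.
apply: complex_ext; rewrite ?Re_mul ?Im_mul /cS /= e1 e2 !Sr_lin//; ring.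
Qed.

Lemma cS_D mu f g a b : clocal mu -> clbm f -> clbm g ->
  cS mu (fun x => f x + g x) a b = cS mu f a b + cS mu g a b.
Proof.
move=> [h1 h2] [rf jf] [rg ig].
have e1 : Ref (fun x => f x + g x) = fun x => 1 * Ref f x + 1 * Ref g x.
  by apply/funext => x; rewrite /Ref Re_add !mul1r.
have e2 : Imf (fun x => f x + g x) = fun x => 1 * Imf f x + 1 * Imf g x.
  by apply/funext => x; rewrite /Imf Im_add !mul1r.
apply: complex_ext; rewrite ?Re_add ?Im_add /cS /= e1 e2 !Sr_lin//; ring.
Qed.

Lemma cS_bound mu f C a b : clocal mu -> clbm f ->
  (forall x, a < x -> x <= b -> cabs (f x) <= C) -> cabs (cS mu f a b) <= 2 * C * Vc mu a b.
Proof.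
move=> mP cf fC; have := cS_close mP cf (k := 0) (e := C) (a := a) (b := b).
rewrite mul0r subr0; apply=> x ax xb; rewrite subr0; exact: fC.
Qed.

Lemma cS_cst mu k a b : clocal mu -> cS mu (fun=> k) a b = k * mu `]a, b]%classic.
Proof.
move=> mP; apply/eqP; rewrite -subr_eq0; apply/eqP; apply: cabs_eq0; apply: le_anti.
rewrite cabs_ge0 andbT.
have := cS_close mP (clbm_cst k) (k := k) (e := 0) (a := a) (b := b).
by rewrite mulr0 mul0r; apply=> x _ _; rewrite subrr cabs0.
Qed.

(** A nondecreasing function whose increments dominate [mu] on half-open intervals. *)
Definition variation_fun mu := orient (Vc mu) 0.

Lemma variation_fun_diff mu x y : clocal mu -> x <= y -> variation_fun mu y - variation_fun mu x = Vc mu x y.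
Proof. by move=> mP xy; rewrite /variation_fun orientB ?orient_le//; exact: Vc_chasles. Qed.

Lemma variation_fun_nd mu : clocal mu -> {homo variation_fun mu : x y / x <= y}.
Proof. by move=> mP x y xy; rewrite -subr_ge0 variation_fun_diff// Vc_ge0. Qed.

(** The distribution function of the measure [u mu], normalized to vanish at [0]. *)
Definition stieltjes_prim mu u := orient (cS mu u) 0.

Lemma stieltjes_prim_diff mu u x y : clocal mu -> clbm u -> x <= y ->
  stieltjes_prim mu u y - stieltjes_prim mu u x = cS mu u x y.
Proof. by move=> mP cu xy; rewrite /stieltjes_prim orientB ?orient_le//; exact: cS_chasles. Qed.

Lemma stieltjes_prim_clbm mu u : clocal mu -> clbm u -> clbm (stieltjes_prim mu u).
Proof.
move=> mP cu; apply: (bv_clbm (variation_fun_nd mP)) => L L0.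
have [C C0 uC] := clbm_bound (- L) L cu; exists (2 * C); first by rewrite mulr_ge0.
move=> x y Lx xy yL; rewrite stieltjes_prim_diff// variation_fun_diff//; apply: cS_bound => // t xt ty.
by apply: uC; [exact: le_trans Lx (ltW xt)|exact: le_trans ty yL].
Qed.

(** One factor is absolutely continuous, so no correction for common jumps appears. On a short
interval the two sides differ by integrals of [u (phi - phi(x))] and [(F - F(y)) phi1], both of
which are small compared with the variation of [mu]. *)
Lemma by_parts mu u (phi phi1 : R -> R[i]) a b : clocal mu -> clbm u -> prim phi1 phi -> a <= b ->
  cS mu (fun x => u x * phi x) a b =
  stieltjes_prim mu u b * phi b - stieltjes_prim mu u a * phi a - cI (fun x => stieltjes_prim mu u x * phi1 x) a b.
Proof.
move=> mP cu pphi ab; set F := stieltjes_prim mu u.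
have cF : clbm F by exact: stieltjes_prim_clbm.
have cphi := prim_clbm pphi; have cphi1 := pphi.1.
have cuphi : clbm (fun x => u x * phi x) by clbm_tac.
have cFphi : clbm (fun x => F x * phi1 x) by clbm_tac.
pose D x := orient (cS mu (fun x => u x * phi x)) a x - F x * phi x + cI (fun x => F x * phi1 x) a x.
suff : D b = D a.
  rewrite /D orient_le// (orientxx _ (cS_chasles mP cuphi)) cIxx// => h.
  apply/eqP; rewrite -subr_eq0; apply/eqP; move/eqP: h; rewrite -subr_eq0 => /eqP <-; ring.
apply: (increments_constant ab (variation_fun_nd mP)) => e e0.
have [Cu Cu0 uC] := clbm_bound a b cu; have [C1 C10 hC1] := clbm_bound a b cphi1.
have [L L0 hL] := prim_lip ab pphi.
pose K := 2 * Cu * L + 4 * Cu * C1 + 1.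
have K0 : 0 < K.
  by rewrite ltr_wpDl// addr_ge0//; apply: mulr_ge0 => //; apply: mulr_ge0.
exists (e / K); first by rewrite divr_gt0.
move=> x y ax xy yb yx.
have dV := variation_fun_diff mP xy; have dF := stieltjes_prim_diff mP cu xy; rewrite -/F in dF.
have V0 : 0 <= Vc mu x y by exact: Vc_ge0.
have yx0 : 0 <= y - x by rewrite subr_ge0.
have c1 : clbm (fun t => u t * (phi t - phi x)) by clbm_tac.
have c2 : clbm (fun t => (F t - F y) * phi1 t) by clbm_tac.
have -> : D y - D x = cS mu (fun t => u t * (phi t - phi x)) x y + cI (fun t => (F t - F y) * phi1 t) x y.
  have -> : cS mu (fun t => u t * (phi t - phi x)) x y =
      cS mu (fun x => u x * phi x) x y - phi x * cS mu u x y.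
    rewrite -mulNr -cS_Z// -cS_D//; last by clbm_tac.
    by congr cS; apply/funext => t; ring.
  have -> : cI (fun t => (F t - F y) * phi1 t) x y =
      cI (fun x => F x * phi1 x) x y - F y * (phi y - phi x).
    rewrite pphi.2 -cI_Z// -cI_B; [|by clbm_tac|by clbm_tac].
    by apply: cI_ext => t; ring.
  have -> : cS mu (fun x => u x * phi x) x y = orient (cS mu (fun x => u x * phi x)) a y -
      orient (cS mu (fun x => u x * phi x)) a x.
    by rewrite (orientB _ _ _ (cS_chasles mP cuphi)) orient_le.
  by rewrite -dF -(cIB a x y cFphi) /D; ring.
have b1 : cabs (cS mu (fun t => u t * (phi t - phi x)) x y) <= 2 * (Cu * (L * (y - x))) * Vc mu x y.
  apply: cS_bound => // t xt ty; rewrite cabsM.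
  have at_ : a <= t by exact: le_trans ax (ltW xt).
  have tb : t <= b by exact: le_trans ty yb.
  apply: ler_pM; rewrite ?cabs_ge0 ?uC//; apply: le_trans (hL x t ax (ltW xt) tb) _.
  by rewrite ler_wpM2l// lerD2r.
have b2 : cabs (cI (fun t => (F t - F y) * phi1 t) x y) <= 2 * (2 * Cu * Vc mu x y * C1) * (y - x).
  apply: cI_bound => // t xt ty; rewrite cabsM.
  have at_ : a <= t by exact: le_trans ax (ltW xt).
  have tb : t <= b by exact: le_trans ty yb.
  apply: ler_pM; rewrite ?cabs_ge0 ?hC1// cabsBC (stieltjes_prim_diff mP cu ty).
  apply: (@le_trans _ _ (2 * Cu * Vc mu t y)).
    by apply: cS_bound => // s ts sy; apply: uC; [exact: le_trans at_ (ltW ts)|exact: le_trans sy yb].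
  rewrite ler_wpM2l ?mulr_ge0// -!variation_fun_diff//.
  by rewrite lerD2l lerN2 variation_fun_nd// ltW.
apply: le_trans (cabsD _ _) _; apply: le_trans (lerD b1 b2) _; rewrite dV.
have -> : 2 * (Cu * (L * (y - x))) * Vc mu x y + 2 * (2 * Cu * Vc mu x y * C1) * (y - x) =
  (2 * Cu * L + 4 * Cu * C1) * (y - x) * Vc mu x y by ring.
rewrite ler_wpM2r//; apply: (@le_trans _ _ (K * (y - x))).
  by rewrite ler_wpM2r// lerDl.
by rewrite mulrC -ler_pdivlMr//; lra.
Qed.

End StieltjesLinear.

Section WeakSystem.
Context {R : realType}.
Implicit Types (f g u : R -> R[i]) (a b x y : R) (mu : set_function R).

Lemma ccontinuousB f g : ccontinuous f -> ccontinuous g -> ccontinuous (fun x => f x - g x).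
Proof.
move=> [rf jf] [rg ig]; split => x.
  have := cvgB (rf x) (rg x); rewrite (_ : Ref (fun x => f x - g x) = Ref f \- Ref g).
    exact.
  by apply/funext => y; rewrite /Ref Re_add Re_opp.
have := cvgB (jf x) (ig x); rewrite (_ : Imf (fun x => f x - g x) = Imf f \- Imf g).
  exact.
by apply/funext => y; rewrite /Imf Im_add Im_opp.
Qed.

Lemma cI_prim f : clbm f -> prim f (fun x => cI f 0 x).
Proof. by move=> cf; split => // x y; rewrite cIB. Qed.

(** Moving both derivatives to the test function, the function [u - H], where
[H'' = u mu - lambda u], has second distributional derivative zero and is thus affine. So [u] is
absolutely continuous with a derivative [w] of locally bounded variation. *)
Lemma weak_derivative mu (lambda : R[i]) u : clocal mu -> ccontinuous u ->
  (forall phi, test_function phi ->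
     cint (@lebesgue_measure R) (fun x => lambda * u x * phi x) =
     - cint (@lebesgue_measure R) (fun x => u x * cderive1n 2 phi x) + lint mu (fun x => u x * phi x)) ->
  exists w, prim w u /\
    forall x y, x <= y -> w y - w x = cS mu u x y - lambda * cI u x y.
Proof.
move=> mP ccu weak; have cu := clbm_continuous ccu.
pose F := stieltjes_prim mu u; have cF : clbm F by exact: stieltjes_prim_clbm.
pose G x := cI u 0 x; have pG : prim u G by exact: cI_prim.
have cG := prim_clbm pG.
pose w0 x := F x - lambda * G x.
have cw0 : clbm w0 by rewrite /w0; clbm_tac.
(* [H] is a second antiderivative of [u mu - lambda u]. *)
pose H x := cI w0 0 x; have pH : prim w0 H by exact: cI_prim.
have cH := prim_clbm pH.
pose h x := u x - H x.
have cch : ccontinuous h by apply: ccontinuousB => //; exact: prim_continuous pH.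
have aff : forall x, h x = h 0 + x%:C * (h 1 - h 0).
  apply: affine_of_weak => // x e e0 e1.
  have [phi [phi1 [L0 [tphi phi2E p1 p2 out]]]] := second_difference_test e0 e1 x.
  exists (Num.max L0 0) => L; rewrite ge_max => /andP[L0L L_ge0].
  have LL : - L <= L by lra.
  have outL y : ~ (- L < y <= L) -> L0 <= `|y|.
    move=> yL; apply: le_trans L0L _; rewrite leNgt; apply/negP; rewrite ltr_norml => /andP[y1 y2].
    by apply: yL; rewrite y1 ltW.
  have nL : L0 <= `|L| by apply: le_trans L0L (ler_norm _).
  have nNL : L0 <= `|- L| by rewrite normrN.
  have cp := prim_clbm p1; have cp1 := p1.1; have cp2 := p2.1.
  have := weak _ tphi.
  have -> : (fun x0 => u x0 * cderive1n 2 (fun y => (phi y)%:C) x0) = fun y => u y * (test_density e x y)%:C.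
    by apply/funext => y; rewrite phi2E.
  rewrite (cint_cI LL); [|by clbm_tac|by move=> y /outL /out[-> _ _]; rewrite mulr0].
  rewrite (cint_cI LL); [|by clbm_tac|by move=> y /outL /out[_ _ ->]; rewrite mulr0].
  rewrite (lint_cS mP (a := - L) (b := L)); [|by clbm_tac|by move=> y /outL /out[-> _ _]; rewrite mulr0].
  rewrite (by_parts mP cu p1 LL).
  have [z1 z2 _] := out _ nL; have [z3 z4 _] := out _ nNL.
  rewrite z1 z3 !mulr0 subr0 sub0r -/F => E.
  have E1 := (primM pG p1).2 (- L) L; have E2 := (primM pH p2).2 (- L) L.
  rewrite z1 z3 !mulr0 subr0 cI_D in E1; [|by clbm_tac|by clbm_tac].
  rewrite z2 z4 !mulr0 subr0 cI_D in E2; [|by clbm_tac|by clbm_tac].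
  have E3 : cI (fun y => w0 y * (phi1 y)%:C) (- L) L =
     cI (fun y => F y * (phi1 y)%:C) (- L) L - lambda * cI (fun y => G y * (phi1 y)%:C) (- L) L.
    rewrite -cI_Z; last by clbm_tac.
    rewrite -cI_B; [|by clbm_tac|by clbm_tac].
    by apply: cI_ext => y; rewrite /w0; ring.
  have E4 : cI (fun y => lambda * u y * (phi y)%:C) (- L) L = lambda * cI (fun y => u y * (phi y)%:C) (- L) L.
    rewrite -cI_Z; last by clbm_tac.
    by apply: cI_ext => y; ring.
  have -> : cI (fun y => h y * (test_density e x y)%:C) (- L) L =
     cI (fun y => u y * (test_density e x y)%:C) (- L) L - cI (fun y => H y * (test_density e x y)%:C) (- L) L.
    rewrite -cI_B; [|by clbm_tac|by clbm_tac].
    by apply: cI_ext => y; rewrite /h; ring.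
  move: E E1 E2; rewrite E3 E4; clear.
  move: (cI _ _ _) => A1; move: (cI _ _ _) => A2; move: (cI _ _ _) => A3; move: (cI _ _ _) => A4.
  move: (cI _ _ _) => A5 E /esym/eqP E1 /esym/eqP E2.
  rewrite addr_eq0 in E1; rewrite addrC addr_eq0 in E2.
  rewrite (eqP E2) (eqP E1) in E *; rewrite mulrN in E.
  have -> : A2 = lambda * A4 - A3 by rewrite -[A2]opprK -[- A2](addrK (- A3)) -E; ring.
  ring.
pose b := h 1 - h 0.
exists (fun x => w0 x + b); split.
  split; first by clbm_tac.
  move=> x y; rewrite cI_D//; last exact: clbm_cst.
  rewrite -pH.2 cI_cst.
  have uE z : u z = h z + H z by rewrite /h subrK.
  by rewrite !uE (aff y) (aff x) -/b rmorphB; ring.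
move=> x y xy.
have e1 := stieltjes_prim_diff mP cu xy; rewrite -/F in e1.
have e2 := pG.2 x y.
by rewrite /w0 -e1 -e2; ring.
Qed.

(** Subtracting [N u] from [u'] cancels the jumps: [(N u)' = u mu - kappa u + N u'], and the
singular term [u mu] is that of [w']. *)
Lemma quasi_derivative mu (lambda kappa : R[i]) u w : clocal mu -> prim w u ->
  (forall x y, x <= y -> w y - w x = cS mu u x y - lambda * cI u x y) ->
  let N x := stieltjes_prim mu (fun=> 1) x - x%:C * kappa in
  sol N (lambda - kappa) u (fun x => w x - N x * u x).
Proof.
move=> mP pu dw N; have cu := prim_clbm pu; have cw := pu.1.
have pid : prim (fun=> 1 : R[i]) (fun x : R => x%:C).
  by split; [exact: clbm_cst|move=> x y; rewrite cI_cst mul1r rmorphB].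
have cid := prim_clbm pid.
have cM : clbm (stieltjes_prim mu (fun=> 1)) by apply: stieltjes_prim_clbm => //; exact: clbm_cst.
have cN : clbm N by rewrite /N; clbm_tac.
split; first by apply: prim_ext pu => // x; rewrite subrK.
split; first by clbm_tac.
suff main x y : x <= y -> w y - N y * u y - (w x - N x * u x) =
    cI (fun t => - (N t * (w t - N t * u t) + (N t * N t + (lambda - kappa)) * u t)) x y.
  move=> x y; have [xy|/ltW yx] := leP x y; first exact: main.
  rewrite cI_opp; last by clbm_tac.
  by rewrite -main// [RHS]opprB.
move=> xy; have e1 := dw _ _ xy.
have e2 := by_parts mP (clbm_cst 1) pu xy.
have e3 : cS mu (fun x => 1 * u x) x y = cS mu u x y.
  by congr cS; apply/funext => t; rewrite mul1r.
rewrite e3 in e2.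
have e4 := (primM pid pu).2 x y; rewrite cI_D in e4; [|by clbm_tac|by clbm_tac].
have e5 : cI (fun x => 1 * u x) x y = cI u x y by apply: cI_ext => t; rewrite mul1r.
rewrite e5 in e4.
have -> : cI (fun t => - (N t * (w t - N t * u t) + (N t * N t + (lambda - kappa)) * u t)) x y =
   - cI (fun t => stieltjes_prim mu (fun=> 1) t * w t) x y + kappa * cI (fun t => t%:C * w t) x y +
   (kappa - lambda) * cI u x y.
  rewrite -cI_N; last by clbm_tac.
  rewrite -!cI_Z//; last by clbm_tac.
  rewrite -!cI_D; [|by clbm_tac|by clbm_tac|by clbm_tac|by clbm_tac].
  by apply: cI_ext => t; rewrite /N; ring.
have -> : w y - N y * u y - (w x - N x * u x) = (w y - w x) -
   (stieltjes_prim mu (fun=> 1) y * u y - stieltjes_prim mu (fun=> 1) x * u x) + kappa * (y%:C * u y - x%:C * u x).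
  by rewrite /N; ring.
by rewrite e1 e2 e4; ring.
Qed.

End WeakSystem.

(** * Decay of square integrable solutions *)

Section Decay.
Context {R : realType}.
Implicit Types (u v N : R -> R[i]) (E : R[i]).
Notation leb := (@lebesgue_measure R).

(** The set where [|u|] exceeds [eta] has finite measure by Chebyshev, so far away it contains
no interval of length [h]. *)
Lemma small_points u (eta h : R) : ccontinuous u -> square_integrable u -> 0 < eta -> 0 < h ->
  exists X : R, forall x : R, X <= `|x| -> exists s : R, [/\ x <= s, s <= x + h & cabs (u s) <= eta].
Proof.
move=> cu [_ fu] eta0 h0.
have ccabs : continuous (fun x => cabs (u x)).
  move=> x; apply/cvgrPdist_le => e e0; have [d d0 hd] := ccontinuous_eps x cu e0.
  near=> y; rewrite distrC; apply: le_trans (cabs_dist_norm _ _) _; apply: hd.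
  rewrite distrC; near: y; exact: cvgr_dist_le.
pose f x : \bar R := ((cabs (u x)) ^+ 2)%:E.
have f0 x : (0 <= f x)%E by rewrite /f lee_fin sqr_ge0.
have mf : measurable_fun [set: R] f.
  by apply/measurable_EFinP; apply: measurable_funX; exact: continuous_measurable_fun.
pose A : set R := [set x | ((eta ^+ 2)%:E <= f x)%E].
have mA : measurable A.
  rewrite (_ : A = [set: R] `&` f @^-1` `[(eta ^+ 2)%:E, +oo[%classic).
    by apply: mf => //; exact: emeasurable_itv.
  by apply/seteqP; split => x /=; rewrite in_itv/= andbT; [move=> ?; split|case].
have fA : (leb A < +oo)%E.
  have : ((eta ^+ 2)%:E * leb A <= \int[leb]_x f x)%E.
    rewrite -integral_cst// integral_mkcond; apply: ge0_le_integral => //.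
    - move=> x _; rewrite patchE; case: ifP => // _; rewrite lee_fin sqr_ge0//.
    - by apply/(measurable_restrictT _ _).1 => //; exact: measurable_cst.
    - by move=> x _; rewrite patchE; case: ifPn; [rewrite inE|move=> _; exact: f0].
  move=> /le_lt_trans/(_ fu) H; rewrite ltNge; apply/negP; rewrite leye_eq => /eqP Aoo.
  by move: H; rewrite Aoo gt0_muley ?ltxx// lte_fin exprn_gt0.
(* The parts of [A] outside [[- n, n]] decrease to the empty set. *)
pose B (n : nat) : set R := A `&` ~` `[- n%:R, n%:R]%classic.
have mB n : measurable (B n) by apply: measurableI => //; apply: measurableC; exact: measurable_itv.
have cvB : leb (B n) @[n --> \oo] --> leb (\bigcap_n B n).
  apply: nonincreasing_cvg_mu => //.
  - by apply: le_lt_trans fA; apply: le_measure; rewrite ?inE; [exact: mB|exact: mA|exact: subIsetl].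
  - by apply: bigcapT_measurable => n; exact: mB.
  - move=> n m nm; apply/subsetPset; apply: setIS => x /= H H'; apply: H.
    move: H'; rewrite !in_itv/= => /andP[p q].
    have nm' : n%:R <= m%:R :> R by rewrite ler_nat.
    by apply/andP; split; lra.
have B0 : \bigcap_n B n = set0.
  apply/seteqP; split => // x H; have [_ /=] := H (Num.truncn `|x|).+1 I; apply.
  rewrite in_itv/= -ler_norml ltW//; exact: truncnS_gt.
rewrite B0 measure0 in cvB.
have [n hn] : exists n, (leb (B n) < h%:E)%E.
  have h' : nbhs (0 : \bar R)%E [set z | (z < h%:E)%E] by apply: open_ereal_lt'; rewrite lte_fin.
  have [n _ Hn] := cvB _ h'; exists n; exact: (Hn n (leqnn n)).
exists (n%:R + h + 1) => x Xx.
have [[s [xs sx us]]|nos] := pselect (exists s, [/\ x <= s, s <= x + h & cabs (u s) <= eta]).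
  by exists s.
exfalso; have sub : `]x, x + h]%classic `<=` B n.
  move=> s /=; rewrite in_itv/= => /andP[xs sx]; split.
    rewrite /A /f /= lee_fin ler_sqr ?nnegrE ?cabs_ge0//; last exact: ltW.
    by rewrite leNgt; apply/negP => us; apply: nos; exists s; split => //; exact: ltW.
  rewrite /= in_itv/= => /andP[s1 s2].
  have n0 : 0 <= n%:R :> R by [].
  move: Xx xs sx s1 s2 h0; move: (n%:R : R) n0; clear => q q0 Xx xs sx s1 s2 h0.
  by have [x0|x0] := leP 0 x; [rewrite (ger0_norm x0) in Xx|rewrite (ltr0_norm x0) in Xx]; lra.
have : (h%:E <= leb (B n))%E.
  have -> : h%:E = leb `]x, x + h]%classic by rewrite leb_itv; [congr (_%:E); ring|rewrite lerDl ltW].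
  by apply: le_measure; rewrite ?inE; [exact: measurable_itv|exact: mB|exact: sub].
by rewrite leNgt hn.
Unshelve. all: by end_near. Qed.

(** Let [r(x) = |u(x)| + |v(x)|]. On [[x, x + 3 h]] the solution changes by at most a small
multiple of [r(x)]. There are points in the first and the last third where [|u|] is tiny; so [u]
is small against [r(x)] on the whole interval, and its increment between these points, which is
nearly their distance times [v(x)], makes [v(x)] small as well. *)
Lemma sol_decay N E u v (K : R) : clbm N -> (forall x, cabs (N x) <= K) ->
  sol N E u v -> ccontinuous u -> square_integrable u ->
  forall eta, 0 < eta -> exists X : R, forall x : R, X <= `|x| -> cabs (u x) + cabs (v x) <= eta.
Proof.
move=> cN NK [pu pv] ccu L2 eta eta0.
have cu := prim_clbm pu; have cv := prim_clbm pv.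
have K0 : 0 <= K := le_trans (cabs_ge0 _) (NK 0).
pose L := gronwall_lip K E.
have L2K : 2 * (1 + K) <= L.
  rewrite /L /gronwall_lip lerDl; apply: mulr_ge0 => //.
  by apply: addr_ge0; [apply: addr_ge0 => //; exact: mulr_ge0|exact: cabs_ge0].
have L0 : 0 < L by lra.
(* Chosen such that the final estimate reads [r x <= eta / 2 + r x / 2]. *)
pose h := (4 * (L * (9 + 6 * K)))^-1.
have h0 : 0 < h by rewrite invr_gt0 mulr_gt0// mulr_gt0//; lra.
have hL : 2 * (h * L * (9 + 6 * K)) = 2^-1.
  by rewrite /h; field; rewrite ?gt_eqF//; lra.
have hLs : L * (3 * h) <= 2^-1.
  have hl : 0 < h * L by exact: mulr_gt0.
  have : 0 <= h * L * K by apply: mulr_ge0 => //; exact: ltW.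
  have := hL; have -> : h * L * (9 + 6 * K) = 9 * (h * L) + 6 * (h * L * K) by ring.
  have -> : L * (3 * h) = 3 * (h * L) by ring.
  move: hl; move: (h * L * K) (h * L); clear => a b; lra.
pose Ch := 1 + 2 / h + 2 * K.
have h20 : 0 < 2 / h by rewrite divr_gt0.
have Ch0 : 0 < Ch by rewrite /Ch; lra.
pose eta' := eta / (2 * Ch).
have eta'0 : 0 < eta' by rewrite divr_gt0// mulr_gt0.
have [X HX] := small_points ccu L2 eta'0 h0.
exists (X + 2 * h) => x xX.
have [s1 [xs1 s1h us1]] : exists s, [/\ x <= s, s <= x + h & cabs (u s) <= eta'] by apply: HX; lra.
have [s2 [xs2 s2h us2]] : exists s, [/\ x + 2 * h <= s, s <= x + 2 * h + h & cabs (u s) <= eta'].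
  apply: HX; have := ler_normD (x + 2 * h) (- (2 * h)); rewrite addrK normrN (gtr0_norm (x := 2 * h)) ?mulr_gt0//; lra.
pose r t := cabs (u t) + cabs (v t).
have r0 t : 0 <= r t by rewrite addr_ge0 ?cabs_ge0.
have rx : forall t, x <= t -> t <= x + 3 * h -> r t <= 2 * r x.
  have pu' : prim (fun t => v t + N t * u t + 0) u.
    by apply: prim_ext pu => // t; rewrite addr0.
  have pv' : prim (fun t => - (N t * v t + (N t * N t + E) * u t) + 0) v.
    by apply: prim_ext pv => // t; rewrite addr0.
  have z0 (y : R) : x < y -> y <= x + 3 * h -> cabs (0 : R[i]) <= 0 by rewrite cabs0.
  have GH := sol_gronwall_hyp cN NK (clbm_cst 0) (clbm_cst 0) (lbm_cst 0) pu' pv' z0 z0.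
  rewrite /lI RI_cst mul0r mulr0 in GH.
  have [B _ hB] := clbm_bound x (x + 3 * h) cu; have [B' _ hB'] := clbm_bound x (x + 3 * h) cv.
  have rB t : x <= t -> t <= x + 3 * h -> r t <= B + B'.
    by move=> t1 t2; apply: lerD; [exact: hB|exact: hB'].
  have xx : x <= x + 3 * h by lra.
  have Ls : L * (x + 3 * h - x) <= 2^-1 by rewrite addrAC subrr add0r.
  move=> t t1 t2.
  have [] := gronwall_step GH (ltW L0) r0 rB (lexx x) xx (lexx _) Ls t1 t2.
  by rewrite addr0.
pose B := 2 * r x.
have B0 : 0 <= B by rewrite mulr_ge0.
have uB t : x <= t -> t <= x + 3 * h -> cabs (u t) <= B.
  by move=> t1 t2; apply: le_trans (rx t t1 t2); rewrite lerDl cabs_ge0.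
have vB t : x <= t -> t <= x + 3 * h -> cabs (v t) <= B.
  by move=> t1 t2; apply: le_trans (rx t t1 t2); rewrite lerDr cabs_ge0.
have lipu s t : x <= s -> s <= t -> t <= x + 3 * h -> cabs (u t - u s) <= L * B * (3 * h).
  move=> xs st th; rewrite pu.2.
  apply: (@le_trans _ _ (2 * ((1 + K) * B) * (t - s))).
    apply: cI_bound; [exact: st|exact: pu.1|] => y sy yt.
    have y1 : x <= y by lra. have y2 : y <= x + 3 * h by lra.
    apply: le_trans (cabsD _ _) _; rewrite cabsM mulrDl mul1r; apply: lerD; first exact: vB.
    by apply: ler_pM; rewrite ?cabs_ge0// uB.
  have -> : 2 * ((1 + K) * B) * (t - s) = 2 * (1 + K) * (B * (t - s)) by ring.
  rewrite -[leRHS]mulrA; apply: ler_pM; [lra| |exact: L2K|by rewrite ler_wpM2l//; lra].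
  by apply: mulr_ge0 => //; rewrite subr_ge0.
have lipv s t : x <= s -> s <= t -> t <= x + 3 * h -> cabs (v t - v s) <= L * B * (3 * h).
  move=> xs st th; rewrite pv.2.
  apply: (@le_trans _ _ (2 * ((K + (K * K + cabs E)) * B) * (t - s))).
    apply: cI_bound; [exact: st|exact: pv.1|] => y sy yt.
    have y1 : x <= y by lra. have y2 : y <= x + 3 * h by lra.
    rewrite cabsN; apply: le_trans (cabsD _ _) _; rewrite !cabsM mulrDl; apply: lerD.
      by apply: ler_pM; rewrite ?cabs_ge0// vB.
    apply: ler_pM; rewrite ?cabs_ge0// ?uB//; apply: le_trans (cabsD _ _) _.
    by rewrite lerD2r cabsM; apply: ler_pM; rewrite ?cabs_ge0.
  have -> : 2 * ((K + (K * K + cabs E)) * B) * (t - s) = 2 * (K + (K * K + cabs E)) * (B * (t - s)) by ring.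
  have KKE : 0 <= K + (K * K + cabs E).
    by apply: addr_ge0 => //; apply: addr_ge0; [exact: mulr_ge0|exact: cabs_ge0].
  rewrite -[leRHS]mulrA; apply: ler_pM; [by apply: mulr_ge0| | |by rewrite ler_wpM2l//; lra].
    by apply: mulr_ge0 => //; rewrite subr_ge0.
  by rewrite /L /gronwall_lip addrA lerDr; apply: mulr_ge0 => //; rewrite addr_ge0.
pose e := L * B * (3 * h).
have e0 : 0 <= e.
  by apply: mulr_ge0; [apply: mulr_ge0 => //; exact: ltW|apply: mulr_ge0 => //; exact: ltW].
have usm t : x <= t -> t <= x + 3 * h -> cabs (u t) <= eta' + e.
  move=> t1 t2; have s1' : s1 <= x + 3 * h by lra.
  have d : cabs (u t - u s1) <= e.
    have [ts|/ltW ts] := leP s1 t; first exact: lipu.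
    by rewrite cabsBC; exact: lipu.
  by have := cabs_ltr_dist (u t) (u s1); lra.
have s12 : s1 <= s2 by lra.
have xx : x <= x + 3 * h by lra.
have s2' : s2 <= x + 3 * h by lra.
have hs : h <= s2 - s1 by lra.
have key : cabs (cI (fun t => v t + N t * u t) s1 s2 - v x * (s2 - s1)%:C) <=
    2 * (e + K * (eta' + e)) * (s2 - s1).
  apply: cI_close; [exact: s12|exact: pu.1|] => t t1 t2.
  have t1' : x <= t by lra. have t2' : t <= x + 3 * h by lra.
  have -> : v t + N t * u t - v x = (v t - v x) + N t * u t by ring.
  apply: le_trans (cabsD _ _) _; apply: lerD; first exact: lipv.
  by rewrite cabsM; apply: ler_pM; rewrite ?cabs_ge0// usm.
rewrite -pu.2 in key.
have vx : cabs (v x) * (s2 - s1) <= 2 * eta' + 2 * (e + K * (eta' + e)) * (s2 - s1).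
  have -> : cabs (v x) * (s2 - s1) = cabs (v x * (s2 - s1)%:C).
    by rewrite cabsM cabs_real ger0_norm// subr_ge0.
  apply: le_trans (cabs_ltr_dist _ (u s2 - u s1)) _; rewrite (cabsBC (v x * _)).
  by have := cabsB (u s2) (u s1); lra.
have vx' : cabs (v x) <= 2 * eta' / h + 2 * (e + K * (eta' + e)).
  have s0 : 0 < s2 - s1 by lra.
  rewrite -(ler_pM2r s0) mulrDl; apply: le_trans vx _; rewrite lerD2r.
  have q : 0 <= 2 * eta' / h by apply: divr_ge0; apply: ltW => //; exact: mulr_gt0.
  by have := ler_wpM2l q hs; rewrite divfK ?gt_eqF.
have ux := usm x (lexx _) xx.
have eE : e * (3 + 2 * K) = h * L * (9 + 6 * K) * B by rewrite /e; ring.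
have : r x <= eta' * Ch + e * (3 + 2 * K).
  rewrite /r /Ch; have -> : eta' * (1 + 2 / h + 2 * K) + e * (3 + 2 * K) =
     (eta' + e) + (2 * eta' / h + 2 * (e + K * (eta' + e))) by ring.
  exact: lerD.
rewrite eE; have -> : h * L * (9 + 6 * K) * B = 2 * (h * L * (9 + 6 * K)) * r x by rewrite /B; ring.
rewrite hL; have -> : eta' * Ch = eta / 2 by rewrite /eta'; field; rewrite gt_eqF.
by rewrite -/(r x); move: (r x) => q; lra.
Qed.

Lemma sol_bounded N E u v (K : R) : clbm N -> (forall x, cabs (N x) <= K) ->
  sol N E u v -> ccontinuous u -> square_integrable u ->
  exists R0 : R, forall x, cabs (u x) <= R0 /\ cabs (v x) <= R0.
Proof.
move=> cN NK s cu L2; have [X HX] := sol_decay cN NK s cu L2 (@ltr01 R).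
have [B B0 hB] := clbm_bound (- X) X (prim_clbm s.1).
have [B' B0' hB'] := clbm_bound (- X) X (prim_clbm s.2).
exists (1 + B + B') => x; have u0 := cabs_ge0 (u x); have v0 := cabs_ge0 (v x).
have [h|/ltW] := leP X `|x|; first by have := HX x h; split; lra.
by rewrite ler_norml => /andP[x1 x2]; have := hB x x1 x2; have := hB' x x1 x2; split; lra.
Qed.

End Decay.

(** * Rational approximation *)

Section Approximation.
Context {R : realType}.
Implicit Types (alpha B e X : R).

(** The multiple [Q * alpha] is not an integer, and the distance is attained at one of the two
neighbouring integers. *)
Lemma dist_int_gt0 alpha (Q : nat) : irrational alpha -> (0 < Q)%N ->
  exists2 d : R, 0 < d & forall p : int, d <= `|Q%:R * alpha - p%:~R|.
Proof.
move=> irr Q0; pose x := Q%:R * alpha.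
have nint (p : int) : x != p%:~R.
  apply/eqP => xp; apply: irr; exists (p%:~R / Q%:R : rat) => //.
  rewrite fmorph_div /= ratr_int ratr_nat -xp /x mulrAC divff ?mul1r//.
  by rewrite pnatr_eq0 -lt0n.
pose f := Num.floor x.
have f1 : f%:~R < x by rewrite lt_neqAle eq_sym nint floor_le.
have f2 : x < (f + 1)%:~R by exact: floorD1_gt.
exists (Num.min (x - f%:~R) ((f + 1)%:~R - x)); first by rewrite lt_min !subr_gt0 f1.
move=> p; have [pf|fp] := leP p f.
  apply: le_trans (ler_norm _); rewrite ge_min; apply/orP; left.
  by rewrite lerD2l lerN2 ler_int.
rewrite distrC; apply: le_trans (ler_norm _); rewrite ge_min; apply/orP; right.
by rewrite lerD2r ler_int lezD1.
Qed.

Section Sequence.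
Variables (alpha B : R) (p : nat -> int) (q : nat -> nat).
Hypotheses (alpha0 : 0 < alpha) (irr : irrational alpha) (B0 : 0 < B).
Hypothesis approx : forall m : nat, (0 < m)%N ->
  (0 < q m)%N /\ `|alpha - (p m)%:~R / (q m)%:R| <= B * m%:R ^- q m.

Lemma numerator_close m : (0 < m)%N ->
  `|(q m)%:R * alpha - (p m)%:~R| <= (q m)%:R * B * m%:R ^- q m.
Proof.
move=> m0; have [q0 h] := approx m0.
have qR : 0 < (q m)%:R :> R by rewrite ltr0n.
have -> : (q m)%:R * alpha - (p m)%:~R = (q m)%:R * (alpha - (p m)%:~R / (q m)%:R).
  by field; rewrite gt_eqF.
by rewrite normrM gtr0_norm// -mulrA ler_pM2l.
Qed.

Lemma inv_pow_le m k : (0 < m)%N -> (0 < k)%N -> m%:R ^- k <= m%:R^-1 :> R.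
Proof.
move=> m0 k0; have mR : 0 < m%:R :> R by rewrite ltr0n.
rewrite lef_pV2 ?posrE ?exprn_gt0//; case: k k0 => // k _.
by rewrite exprS; apply: ler_peMr; [exact: ltW|rewrite exprn_ege1// ler1n].
Qed.

(** Each single denominator can occur only finitely often, for otherwise [Q * alpha] would be
arbitrarily close to integers. *)
Lemma denominator_large (Q : nat) : exists m0 : nat, forall m, (m0 < m)%N -> (Q < q m)%N.
Proof.
elim: Q => [|Q [m0 IH]].
  by exists 0%N => m m0; have [] := approx m0.
have [d d0 hd] := dist_int_gt0 irr (ltn0Sn Q).
exists (maxn m0 (Num.truncn (Q.+1%:R * B / d))) => m.
rewrite gtn_max => /andP[m0m dm].
rewrite ltn_neqAle (IH m m0m) andbT; apply/negP => /eqP Qq.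
have mgt : (0 < m)%N by exact: leq_ltn_trans m0m.
have mR : 0 < m%:R :> R by rewrite ltr0n.
have := numerator_close mgt; rewrite -Qq => h.
have := le_trans (hd (p m)) h; apply/negP; rewrite -ltNge.
apply: (@le_lt_trans _ _ (Q.+1%:R * B * m%:R^-1)).
  by apply: ler_wpM2l; [apply: mulr_ge0 => //; exact: ltW|exact: inv_pow_le].
rewrite ltr_pdivrMr// [ltRHS]mulrC -ltr_pdivrMr//.
by apply: lt_le_trans (truncnS_gt _) _; rewrite ler_nat.
Qed.

Lemma two_pow_ge (n : nat) : n%:R <= 2 ^+ n :> R.
Proof. by rewrite -natrX ler_nat ltnW// ltn_expl. Qed.

(** The numerator [P] is at most [Q * A] for a fixed [A], so the left hand side is bounded by a
constant times [Q * (D / m) ^+ Q] with a fixed [D]; this tends to zero as [m] tends to infinity,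
because [D / m] does. *)
Lemma superexponential_approx (n : nat) e X : 0 < e -> exists P Q : nat,
  X <= P%:R /\ 2 ^+ (n * P) * (P%:R + 2) * `|P%:R - Q%:R * alpha| <= e.
Proof.
move=> e0.
pose A := (Num.truncn (alpha + B)).+1.
have hA : alpha + B < A%:R by exact: truncnS_gt.
pose D : R := 2 ^+ (n.+1 * A).
have D1 : 1 <= D by rewrite exprn_ege1// ler1n.
(* [A] bounds [P / Q], [D] bounds the exponential per unit of [Q], and [M] fixes how small
[D / m] must be. *)
pose M : R := 1 + 2 * B / e.
have M1 : 1 <= M.
  by rewrite lerDl; apply: divr_ge0; [apply: mulr_ge0 => //|]; exact: ltW.
have [m0 hm0] := denominator_large (Num.truncn (2 * `|X| / alpha)).+1.
pose t1 := Num.truncn (2 * B / alpha); pose t2 := Num.truncn (2 * D * M).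
pose m := (m0 + t1 + t2 + 1)%N.
have t1m : (t1 < m)%N by rewrite /m; clear; lia.
have t2m : (t2 < m)%N by rewrite /m; clear; lia.
have m0m : (m0 < m)%N by rewrite /m; clear; lia.
have mgt : (0 < m)%N by rewrite /m addn1.
have mR : 0 < m%:R :> R by rewrite ltr0n.
have hq : ((Num.truncn (2 * `|X| / alpha)).+1 < q m)%N by apply: hm0.
have hmB : 2 * B / alpha <= m%:R.
  by apply: le_trans (ltW (truncnS_gt _)) _; rewrite ler_nat.
have hmD : 2 * D * M <= m%:R.
  by apply: le_trans (ltW (truncnS_gt _)) _; rewrite ler_nat.
have [q0 _] := approx mgt; have close := numerator_close mgt.
have qR : 0 < (q m)%:R :> R by rewrite ltr0n.
set Q := q m in hq q0 close qR.
have Bm : B / m%:R <= alpha / 2.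
  rewrite ler_pdivrMr// mulrAC ler_pdivlMr//; move: hmB; rewrite ler_pdivrMr//; lra.
have Bm' : B / m%:R <= B.
  by rewrite ler_pdivrMr//; apply: ler_peMr; [exact: ltW|rewrite ler1n].
have close1 : `|Q%:R * alpha - (p m)%:~R| <= Q%:R * (B / m%:R).
  apply: le_trans close _; rewrite -mulrA ler_pM2l// ler_pM2l//; exact: inv_pow_le.
have plo : Q%:R * (alpha / 2) <= (p m)%:~R.
  have := ler_norm (Q%:R * alpha - (p m)%:~R); have := ler_wpM2l (ltW qR) Bm; lra.
have phi : (p m)%:~R <= Q%:R * (alpha + B).
  have := ler_norm (- (Q%:R * alpha - (p m)%:~R)); rewrite normrN.
  by have := ler_wpM2l (ltW qR) Bm'; rewrite mulrDr; lra.
have p0 : 0 < (p m)%:~R :> R by apply: lt_le_trans plo; rewrite mulr_gt0// divr_gt0.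
have pE : (p m)%:~R = (`|p m|%N)%:R :> R.
  by rewrite natr_absz gtr0_norm// -(ltr0z R).
rewrite pE in plo phi close; set P := `|p m|%N in plo phi close.
exists P, Q; split.
  apply: le_trans plo; apply: le_trans (ler_norm X) _.
  have h : 2 * `|X| / alpha <= Q%:R.
    by apply: le_trans (ltW (truncnS_gt _)) _; rewrite ler_nat ltnW.
  by move: h; rewrite ler_pdivrMr// mulrA ler_pdivlMr//; lra.
rewrite distrC.
have PA : (P <= Q * A)%N.
  rewrite -(ler_nat R) natrM; apply: le_trans phi _; rewrite ler_pM2l//; exact: ltW.
have pow1 : 2 ^+ (n * P) * (P%:R + 2) <= 2 * D ^+ Q :> R.
  have P2 : P%:R + 2 <= 2 * 2 ^+ P :> R.
    have := two_pow_ge P.+1; rewrite exprS => h.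
    have p1 : 1 <= 2 ^+ P :> R by rewrite exprn_ege1// ler1n.
    have : P%:R + 1 <= 2 ^+ P :> R by rewrite -natrX natr1 ler_nat ltn_expl.
    lra.
  apply: (@le_trans _ _ (2 ^+ (n * P) * (2 * 2 ^+ P))); first by rewrite ler_pM2l ?exprn_gt0.
  rewrite mulrCA -exprD ler_pM2l// -exprM ler_eXn2l ?ltr1n// -mulSnr -mulnA leq_mul2l.
  by rewrite mulnC PA orbT.
apply: (@le_trans _ _ (2 * D ^+ Q * (Q%:R * B * m%:R ^- Q))).
  by apply: ler_pM.
have -> : 2 * D ^+ Q * (Q%:R * B * m%:R ^- Q) = 2 * B * (Q%:R * (D / m%:R) ^+ Q).
  by rewrite expr_div_n; ring.
have M0 : 0 < M by lra.
have D0 : 0 < D by lra.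
have Dm : D / m%:R <= 2^-1 * M^-1.
  rewrite ler_pdivrMr// -invfM mulrC ler_pdivlMr ?mulr_gt0//; lra.
have s1 : (D / m%:R) ^+ Q <= (2 ^+ Q)^-1 * M^-1.
  apply: (@le_trans _ _ ((2^-1 * M^-1) ^+ Q)).
    apply: lerXn2r => //; rewrite nnegrE.
      by apply: divr_ge0; [exact: ltW|].
    by apply: mulr_ge0; rewrite invr_ge0//; exact: ltW.
  rewrite exprMn exprVn ler_pM2l ?invr_gt0 ?exprn_gt0//.
  have iM : 0 <= M^-1 by rewrite invr_ge0 ltW.
  case: (Q) q0 => // k _; rewrite exprS; apply: ler_piMr => //.
  by apply: exprn_ile1 => //; rewrite invf_le1.
have s2 : Q%:R * (D / m%:R) ^+ Q <= M^-1.
  apply: le_trans (ler_wpM2l (ltW qR) s1) _; rewrite mulrA; apply: ler_piMl; first by rewrite invr_ge0 ltW.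
  by rewrite ler_pdivrMr ?exprn_gt0// mul1r two_pow_ge.
apply: (@le_trans _ _ (2 * B * M^-1)); first by apply: ler_wpM2l => //; apply: mulr_ge0 => //; exact: ltW.
rewrite ler_pdivrMr//; have -> : e * M = 2 * B + e by rewrite /M; field; rewrite gt_eqF.
by rewrite lerDl ltW.
Qed.

End Sequence.
End Approximation.

(** * Uniformly local measures and translations *)

Section Measures.
Context {R : realType}.
Implicit Types (mu : set_function R) (nu : set (measurableTypeR R) -> R) (A B : set (measurableTypeR R)) (a b d p : R).

Lemma cvg_eqf (f g : nat -> R) (l : R) : f =1 g -> f @ \oo --> l -> g @ \oo --> l.
Proof. by move=> /funext ->. Qed.

(** Countable additivity in terms of real limits, which can be added componentwise. *)
Definition semi_additive_real nu := forall F : (set (measurableTypeR R))^nat,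
  (forall i, measurable (F i)) -> trivIset setT F -> measurable (\bigcup_n F n) ->
  (fun n => \sum_(0 <= i < n) nu (F i)) @ \oo --> nu (\bigcup_n F n).

Lemma semi_sigma_additiveE nu :
  semi_sigma_additive (fun B => (nu B)%:E) <-> semi_additive_real nu.
Proof.
split=> H F mF tF mU.
  apply: (cvg_eqf _ (fine_cvg (H F mF tF mU))).
  by move=> n /=; rewrite sumEFin.
apply: cvg_EFin; first by near=> n; rewrite sumEFin.
apply: (cvg_eqf _ (H F mF tF mU)).
by move=> n /=; rewrite sumEFin.
Unshelve. all: by end_near. Qed.

(** Uses the partition of [B] into [A], its complement in [B], and empty sets. *)
Lemma variation_ge mu A B : measurable A -> measurable B -> A `<=` B ->
  ((cabs (mu A))%:E <= measure_variation mu B)%E.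
Proof.
move=> mA mB AB; pose F := bigcup2 A (B `\` A).
have mF k : measurable (F k).
  by case: k => [|[|k]]; [exact: mA|exact: (measurableD mB mA)|exact: measurable0].
apply: (@le_trans _ _ (\sum_(0 <= k <oo) (cabs (mu (F k)))%:E)%E); last first.
  apply: ereal_sup_ubound; exists F => //; split => //.
    by rewrite -trivIset_bigcup2 setDIK.
  by rewrite bigcup2E setDUK.
have := @nneseries_lim_ge R (fun k => (cabs (mu (F k)))%:E) xpredT 0 1.
by rewrite big_nat1; apply => n _ _; rewrite lee_fin; exact: cabs_ge0.
Qed.

(** A disjoint sequence with bounded union lives in a compact interval [K], where intersecting
with [K] changes nothing; the uniform bound comes from that on the variation. *)
Lemma Mlocunif_clocal mu : Mlocunif mu -> clocal mu.
Proof.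
move=> [loc unif].
have bound (a : R) (B : set (measurableTypeR R)) : measurable B -> B `<=` `]a, a + 1] ->
    cabs (mu B) <= fine (unif_norm mu).
  move=> mB Ba; rewrite -lee_fin.
  have h : ((cabs (mu B))%:E <= unif_norm mu)%E.
    apply: le_trans (variation_ge mu mB (measurable_itv `]a, a + 1]) Ba) _.
    by apply: ereal_sup_ubound; exists a.
  by rewrite fineK// fin_numE; apply/andP; split;
    [rewrite -ltNye; exact: lt_le_trans (ltNyr _) h|rewrite -ltey].
have sig (F : (set (measurableTypeR R))^nat) : has_bound (\bigcup_n F n) -> exists K : set R,
    compact K /\ forall B, B `<=` \bigcup_n F n -> B `&` K = B.
  move=> [L hL]; exists `[- L, L]%classic; split; first exact: segment_compact.
  by move=> B BF; apply/setIidl => x /BF /hL; rewrite /= in_itv/= ler_norml.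
split; split.
- move=> F mF tF bF; have [K [cK KE]] := sig F bF.
  have [/semi_sigma_additiveE H _] := loc K cK.
  have := H F mF tF (bigcup_measurable (fun k _ => mF k)); rewrite KE// => HU.
  apply: (cvg_eqf _ HU) => n; apply: eq_bigr => i _.
  by rewrite KE//; exact: bigcup_sup.
- exists (fine (unif_norm mu)) => a B mB Ba.
  by apply: le_trans (cabs_Re _) _; exact: (bound a).
- move=> F mF tF bF; have [K [cK KE]] := sig F bF.
  have [_ /semi_sigma_additiveE H] := loc K cK.
  have := H F mF tF (bigcup_measurable (fun k _ => mF k)); rewrite KE// => HU.
  apply: (cvg_eqf _ HU) => n; apply: eq_bigr => i _.
  by rewrite KE//; exact: bigcup_sup.
- exists (fine (unif_norm mu)) => a B mB Ba.
  by apply: le_trans (cabs_Im _) _; exact: (bound a).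
Qed.

Lemma MlocunifD mu1 mu2 : Mlocunif mu1 -> Mlocunif mu2 -> Mlocunif (mu1 \+ mu2).
Proof.
move=> [l1 u1] [l2 u2]; split.
  move=> K cK; have [/semi_sigma_additiveE a1 /semi_sigma_additiveE b1] := l1 K cK.
  have [/semi_sigma_additiveE a2 /semi_sigma_additiveE b2] := l2 K cK.
  split; apply/semi_sigma_additiveE => F mF tF mU.
    rewrite Re_add; apply: (cvg_eqf _ (cvgD (a1 F mF tF mU) (a2 F mF tF mU))).
    by move=> n; rewrite (eq_bigr _ (fun i _ => Re_add _ _)) big_split.
  rewrite Im_add; apply: (cvg_eqf _ (cvgD (b1 F mF tF mU) (b2 F mF tF mU))).
  by move=> n; rewrite (eq_bigr _ (fun i _ => Im_add _ _)) big_split.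
apply: le_lt_trans (lte_add_pinfty u1 u2); apply: ub_ereal_sup => _ [a _ <-].
apply: ub_ereal_sup => _ [F [mF tF UF] <-].
apply: (@le_trans _ _ (\sum_(0 <= k <oo) (cabs (mu1 (F k)))%:E + \sum_(0 <= k <oo) (cabs (mu2 (F k)))%:E)%E).
  rewrite -nneseriesD; last 2 first.
  - by move=> k _ _; rewrite lee_fin cabs_ge0.
  - by move=> k _ _; rewrite lee_fin cabs_ge0.
  apply: lee_nneseries => k _; first by rewrite lee_fin cabs_ge0.
  by rewrite -EFinD lee_fin; exact: cabsD.
apply: leeD; (apply: le_trans (ereal_sup_ubound _); last by exists a); apply: ereal_sup_ubound;
  by exists F.
Qed.

Lemma rlocalD nu1 nu2 : rlocal nu1 -> rlocal nu2 -> rlocal (fun B => nu1 B + nu2 B).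
Proof.
move=> [s1 [U1 b1]] [s2 [U2 b2]]; split.
  move=> F mF tF bF; apply: (cvg_eqf _ (cvgD (s1 F mF tF bF) (s2 F mF tF bF))).
  by move=> n; rewrite [RHS]big_split.
exists (U1 + U2) => a B mB Ba; apply: le_trans (ler_normD _ _) _.
by apply: lerD; [exact: (b1 a)|exact: (b2 a)].
Qed.

Lemma rlocal_ext nu1 nu2 : nu1 =1 nu2 -> rlocal nu1 -> rlocal nu2.
Proof. by move=> /funext ->. Qed.

Lemma clocalD mu1 mu2 : clocal mu1 -> clocal mu2 -> clocal (mu1 \+ mu2).
Proof.
move=> [r1 i1] [r2 i2]; split.
  by apply: rlocal_ext (rlocalD r1 r2) => B; rewrite /= Re_add.
by apply: rlocal_ext (rlocalD i1 i2) => B; rewrite /= Im_add.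
Qed.

Lemma clocalB mu1 mu2 : clocal mu1 -> clocal mu2 -> clocal (mu1 \- mu2).
Proof.
move=> [r1 i1] [r2 i2]; split.
  by apply: rlocal_ext (rlocalD r1 (rlocalN r2)) => B; rewrite /= Re_add Re_opp.
by apply: rlocal_ext (rlocalD i1 (rlocalN i2)) => B; rewrite /= Im_add Im_opp.
Qed.

Lemma shift_setE d (B : set R) : [set x + d | x in B] = (fun x => x - d) @^-1` B.
Proof.
apply/seteqP; split => x /=; first by move=> [y By <-]; rewrite addrK.
by move=> Bx; exists (x - d) => //; rewrite subrK.
Qed.

Lemma shift_measurable d B : measurable B -> measurable ([set x + d | x in B] : set (measurableTypeR R)).
Proof.
move=> mB; rewrite shift_setE -[X in measurable X]setTI.
have : measurable_fun [set: R] (fun x : R => x - d).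
  by apply: measurable_funB => //; exact: measurable_cst.
by apply.
Qed.

Lemma shift_has_bound d (B : set R) : has_bound B -> has_bound [set x + d | x in B].
Proof.
move=> [L hL]; exists (L + `|d|) => _ [x Bx <-]; apply: le_trans (ler_normD _ _) _.
by rewrite lerD2r hL.
Qed.

Lemma shift_oc d a b : [set x + d | x in `]a, b]%classic] = `]a + d, b + d]%classic :> set R.
Proof. by rewrite shift_setE; apply/seteqP; split => x /=; rewrite !in_itv/= ltrBrDr lerBlDr. Qed.

Lemma shift_shift d1 d2 (B : set R) :
  [set x + d2 | x in [set x + d1 | x in B]] = [set x + (d1 + d2) | x in B].
Proof. by rewrite !shift_setE; apply/seteqP; split => x /=; rewrite opprD addrA addrAC. Qed.

Lemma shift_bounded_borel d B : bounded_borel B -> bounded_borel ([set x + d | x in B] : set (measurableTypeR R)).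
Proof.
move=> [mB /bounded_setP bB]; split; first exact: shift_measurable.
by apply/bounded_setP; exact: shift_has_bound.
Qed.

Lemma rlocal_translate nu d : rlocal nu -> rlocal (fun B => nu [set x + d | x in B]).
Proof.
move=> [s [U hU]]; split.
  move=> F mF tF bF; rewrite image_bigcup.
  apply: s; [by move=> i; exact: shift_measurable| |].
    move=> i j _ _ [x []]; rewrite !shift_setE /= => Fi Fj.
    by apply: tF => //; exists (x - d).
  by rewrite -image_bigcup; exact: shift_has_bound.
exists U => a B mB Ba; apply: (hU (a + d)); first exact: shift_measurable.
rewrite addrAC -shift_oc; exact: image_subset.
Qed.

Lemma clocal_translate mu d : clocal mu -> clocal (measure_translate d mu).
Proof. by move=> [r i]; split; [exact: (rlocal_translate d r)|exact: (rlocal_translate d i)]. Qed.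

Lemma pos_part_ext nu1 nu2 : (forall B, bounded_borel B -> nu1 B = nu2 B) ->
  pos_part nu1 = pos_part nu2.
Proof.
move=> e; apply/funext => A; congr ereal_sup; apply/seteqP; split => _ [B [bB BA] <-].
  by exists B => //; rewrite e.
by exists B => //; rewrite e.
Qed.

Lemma lint_ext mu1 mu2 u : (forall B, bounded_borel B -> mu1 B = mu2 B) -> lint mu1 u = lint mu2 u.
Proof.
move=> e; rewrite /lint /neg_part.
rewrite (@pos_part_ext (fun B => complex.Re (mu1 B)) (fun B => complex.Re (mu2 B))); last first.
  by move=> B /e ->.
rewrite (@pos_part_ext (fun B => complex.Im (mu1 B)) (fun B => complex.Im (mu2 B))); last first.
  by move=> B /e ->.
rewrite (@pos_part_ext (fun B => - complex.Re (mu1 B)) (fun B => - complex.Re (mu2 B))); last first.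
  by move=> B /e ->.
rewrite (@pos_part_ext (fun B => - complex.Im (mu1 B)) (fun B => - complex.Im (mu2 B)))//.
by move=> B /e ->.
Qed.

Lemma periodic_natmul mu p n : periodic_measure p mu -> periodic_measure (n%:R * p) mu.
Proof.
move=> per; elim: n => [|n IH] B bB.
  rewrite /measure_translate mul0r; congr mu; rewrite shift_setE.
  by apply/seteqP; split => x /=; rewrite subr0.
have e : n.+1%:R * p = p + n%:R * p by rewrite -natr1; ring.
rewrite /measure_translate e -shift_shift -[RHS]per// -[RHS]IH//.
exact: shift_bounded_borel.
Qed.

Lemma Vc_length mu (U : R) a (n : nat) : clocal mu -> (forall a, Vc mu a (a + 1) <= U) ->
  Vc mu a (a + n%:R) <= n%:R * U.
Proof.
move=> mP hU; have add := Vc_chasles mP; elim: n => [|n IH].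
  have := add a a a (lexx a) (lexx a) => /eqP; rewrite addrC -subr_eq subrr => /eqP e.
  by rewrite addr0 -e mul0r.
have h1 : a <= a + n%:R by rewrite lerDl.
have h2 : a + n%:R <= a + n.+1%:R by rewrite lerD2l ler_nat.
rewrite (add _ _ _ h1 h2) -[X in _ <= X * _]natr1 mulrDl mul1r; apply: lerD => //.
by have := hU (a + n%:R); rewrite -addrA natr1.
Qed.

End Measures.

(** * The weak Gordon property *)

Section WeakGordon.
Context {R : realType}.
Implicit Types (mu : set_function R) (u : R -> R[i]) (a b d x y : R).
Notation leb := (@lebesgue_measure R).

(** The constant is 2 because real and imaginary parts are treated separately. *)
Lemma lip_test_lipschitz (I : set R) u : lip_test I u ->
  forall x y, x <= y -> cabs (u y - u x) <= 2 * (y - x).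
Proof.
move=> [[k lip] _ _ sup1] x y xy.
pose k' := `|k| + 1; have k'0 : 0 < k' by rewrite ltr_wpDl.
have lip' z w : cabs (u z - u w) <= k' * `|z - w|.
  apply: le_trans (lip z w) _; rewrite ler_wpM2r//; have := ler_norm k; rewrite /k'; lra.
move/ess_supP in sup1.
have rae : {ae leb, forall x, `|derive1 (Ref u) x| <= 1}.
  move: sup1; apply: filterS.
  move=> z; rewrite lee_fin; apply: le_trans.
  by have := cabs_Re (cderive1n 1 u z); rewrite /cderive1n !derive1n1.
have iae : {ae leb, forall x, `|derive1 (Imf u) x| <= 1}.
  move: sup1; apply: filterS.
  move=> z; rewrite lee_fin; apply: le_trans.
  by have := cabs_Im (cderive1n 1 u z); rewrite /cderive1n !derive1n1.
have rl z w : `|Ref u z - Ref u w| <= k' * `|z - w|.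
  by apply: le_trans (lip' z w); have := cabs_Re (u z - u w); rewrite Re_add Re_opp.
have il z w : `|Imf u z - Imf u w| <= k' * `|z - w|.
  by apply: le_trans (lip' z w); have := cabs_Im (u z - u w); rewrite Im_add Im_opp.
have h1 := lipschitz_deriv_le1 k'0 rl rae xy; have h2 := lipschitz_deriv_le1 k'0 il iae xy.
apply: le_trans (cabs_le _) _; rewrite Re_add Im_add Re_opp Im_opp.
by move: h1 h2; rewrite /Ref /Imf; lra.
Qed.

Lemma lipschitz2_continuous u : (forall x y, x <= y -> cabs (u y - u x) <= 2 * (y - x)) ->
  ccontinuous u.
Proof.
move=> lip; split; apply: lip_continuous => L; exists 2 => x y _ xy _; apply: le_trans (lip x y xy).
  by have := cabs_Re (u y - u x); rewrite Re_add Re_opp.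
by have := cabs_Im (u y - u x); rewrite Im_add Im_opp.
Qed.

(** Change of variables for the translate of a measure. The Jordan parts of the difference are
not the differences of the Jordan parts, so additivity in the measure is obtained by comparing
the increments of both sides with those of the variations. *)
Lemma cS_sub_translate mu d u a b : clocal mu -> a <= b ->
  (forall x y, x <= y -> cabs (u y - u x) <= 2 * (y - x)) ->
  cS (mu \- measure_translate d mu) u a b =
  cS mu u a b - cS mu (fun x => u (x - d)) (a + d) (b + d).
Proof.
move=> mP ab lip; set nu := mu \- measure_translate d mu.
have nuP : clocal nu by apply: clocalB => //; exact: clocal_translate.
pose ud x := u (x - d).
have lipd x y : x <= y -> cabs (ud y - ud x) <= 2 * (y - x).
  move=> xy; have -> : y - x = (y - d) - (x - d) by ring.
  by apply: lip; rewrite lerD2r.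
have cu := clbm_continuous (lipschitz2_continuous lip).
have cud := clbm_continuous (lipschitz2_continuous lipd).
pose D x := orient (cS nu u) a x - orient (cS mu u) a x + orient (cS mu ud) (a + d) (x + d).
have aN := cS_chasles nuP cu; have aM := cS_chasles mP cu; have aD := cS_chasles mP cud.
have adbd : a + d <= b + d by rewrite lerD2r.
suff : D b = D a.
  rewrite /D !orientxx// !orient_le// subrr addr0 => /eqP.
  by move=> h; apply/eqP; rewrite -subr_eq0 opprB addrCA addrC.
pose V x := variation_fun nu x + variation_fun mu x + variation_fun mu (x + d).
apply: (increments_constant (V := V) ab).
  by move=> x y xy; apply: lerD; [apply: lerD; exact: variation_fun_nd|apply: variation_fun_nd => //; rewrite lerD2r].
move=> e e0; exists (e / 4); first by rewrite divr_gt0.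
move=> x y _ xy _ yx.
have xyd : x + d <= y + d by rewrite lerD2r.
have nuE : nu `]x, y]%classic = mu `]x, y]%classic - mu `]x + d, y + d]%classic.
  by rewrite /nu /= /measure_translate shift_oc.
(* Each of the three integrals is compared with the value of [u] at the right end point times
the measure of the interval. *)
have close (m : set_function R) w c c' k : clocal m -> clbm w -> c <= c' -> c' - c = y - x ->
    (forall z z', z <= z' -> cabs (w z' - w z) <= 2 * (z' - z)) -> k = w c' ->
    cabs (cS m w c c' - k * m `]c, c']%classic) <= e * (variation_fun m c' - variation_fun m c).
  move=> mP' cw cc ce lw ->; rewrite variation_fun_diff//.
  apply: le_trans (cS_close mP' cw (e := e / 2) _) _.
    move=> z cz zc; rewrite cabsBC; apply: le_trans (lw z c' zc) _; lra.
  by rewrite mulrCA divff// mulr1.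
have b1 := close nu u x y (u y) nuP cu xy erefl lip erefl.
have b2 := close mu u x y (u y) mP cu xy erefl lip erefl.
have b3 : cabs (cS mu ud (x + d) (y + d) - u y * mu `]x + d, y + d]%classic) <=
    e * (variation_fun mu (y + d) - variation_fun mu (x + d)).
  by apply: close => //; [ring|rewrite /ud addrK].
have -> : D y - D x = (cS nu u x y - u y * nu `]x, y]%classic) - (cS mu u x y - u y * mu `]x, y]%classic) +
    (cS mu ud (x + d) (y + d) - u y * mu `]x + d, y + d]%classic).
  rewrite nuE -(orient_le (cS nu u) xy) -(orient_le (cS mu u) xy) -(orient_le (cS mu ud) xyd).
  rewrite -(orientB a x y aN) -(orientB a x y aM) -(orientB (a + d) (x + d) (y + d) aD) /D; ring.
apply: le_trans (cabsD _ _) _; apply: le_trans (lerD (cabsB _ _) (le_refl _)) _.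
by rewrite /V; move: b1 b2 b3; rewrite !mulrBr !mulrDr; lra.
Qed.

(** After the change of variables only [u - u(. - d)] is integrated; it is at most [2 |d|] and
lives on an interval of length 8. *)
Lemma lint_sub_translate mu d u x0 (U : R) : clocal mu -> (forall a, Vc mu a (a + 1) <= U) ->
  `|d| <= 1 -> (forall x y, x <= y -> cabs (u y - u x) <= 2 * (y - x)) ->
  (forall x, u x != 0 -> `|x - x0| <= 2) ->
  cabs (lint (mu \- measure_translate d mu) u) <= 32 * U * `|d|.
Proof.
move=> mP hU d1 lip supp.
have nuP : clocal (mu \- measure_translate d mu) by apply: clocalB => //; exact: clocal_translate.
pose ud x := u (x - d).
have cu := clbm_continuous (lipschitz2_continuous lip).
have cud : clbm ud by exact: (clbm_shift (- d) cu).
move: d1; rewrite ler_norml => /andP[d1 d2].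
have supp' x : u x != 0 -> x0 - 2 <= x <= x0 + 2.
  by move=> /supp; rewrite ler_norml => /andP[p q]; apply/andP; split; lra.
(* Large enough to contain the supports of [u] and of its translate by [|d| <= 1]. *)
pose a := x0 - 4; pose b := x0 + 4.
have ab : a <= b by rewrite /a /b; lra.
have u0 x : ~ (a < x <= b) -> u x = 0.
  move=> h; apply/eqP; apply: contra_notT h => /supp' /andP[p q].
  by rewrite /a /b; apply/andP; split; lra.
have ud0 x : ~ (a < x <= b) -> ud x = 0.
  move=> h; apply/eqP; apply: contra_notT h => /supp' /andP[p q].
  by rewrite /a /b; apply/andP; split; lra.
have ud0' x : ~ (a + d < x <= b + d) -> ud x = 0.
  move=> h; apply/eqP; apply: contra_notT h => /supp' /andP[p q].
  by rewrite /a /b; apply/andP; split; lra.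
rewrite (lint_cS nuP cu u0) cS_sub_translate//.
rewrite -[cS mu (fun x => u (x - d)) _ _](lint_cS mP cud ud0') (lint_cS mP cud ud0).
have -> : cS mu u a b - cS mu ud a b = cS mu (fun x => u x + -1 * ud x) a b.
  by rewrite cS_D ?cS_Z//; [rewrite mulN1r|clbm_tac].
have VU : Vc mu a b <= 8 * U.
  have := Vc_length a 8 mP hU; have -> : a + 8%:R = b by rewrite /a /b; ring.
  by [].
apply: le_trans (cS_bound (C := 2 * `|d|) mP _ _) _; first by clbm_tac.
  move=> x _ _; rewrite mulN1r /ud.
  have [d0|/ltW d0] := leP 0 d.
    by rewrite (ger0_norm d0); apply: le_trans (lip (x - d) x _) _; lra.
  by rewrite cabsBC (ler0_norm d0); apply: le_trans (lip x (x - d) _) _; lra.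
have n0 : 0 <= 2 * (2 * `|d|) by rewrite !mulr_ge0.
apply: le_trans (ler_wpM2l n0 VU) _; lra.
Qed.

Lemma norm_on_sub_translate mu d (I : set R) (U : R) : clocal mu -> 0 <= U ->
  (forall a, Vc mu a (a + 1) <= U) -> `|d| <= 1 ->
  (norm_on I (mu \- measure_translate d mu)%R <= (32 * U * `|d|)%:E)%E.
Proof.
move=> mP U0 hU d1; apply: ub_ereal_sup => _ [u lt <-]; rewrite lee_fin.
have lip := lip_test_lipschitz lt; have [_ _ dm _] := lt.
have [[x0 ux0]|u0] := pselect (exists x, u x != 0).
  apply: (lint_sub_translate mP hU d1 lip (x0 := x0)) => x ux.
  rewrite -lee_fin; apply: le_trans dm; apply: ereal_sup_ubound; exists x, x0.
  by split => //; apply: subset_closure.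
apply: (lint_sub_translate mP hU d1 lip (x0 := 0)) => x ux.
by exfalso; apply: u0; exists x.
Qed.

Lemma norm_on_ge0 mu (I : set R) : clocal mu -> (0 <= norm_on I mu)%E.
Proof.
move=> mP; have c0 := clbm_cst (0 : R[i]).
have l0 : lint mu (fun=> 0) = 0.
  by rewrite (lint_cS (a := 0) (b := 0) mP c0)// cS_cst// mul0r.
have s0 : spt (fun=> 0 : R[i]) = set0 :> set R.
  rewrite /spt (_ : [set x | _] = set0) ?closure0//.
  by apply/seteqP; split => // x /=; rewrite eqxx.
apply: ereal_sup_ubound; exists (fun=> 0); last by rewrite l0 cabs0.
split.
- by exists 0 => x y; rewrite subrr cabs0 mul0r.
- by rewrite s0.
- by rewrite s0; apply: ub_ereal_sup => _ [x [y [[]]]].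
- apply/ess_supP; apply: nearW => x; rewrite lee_fin /cderive1n !derive1n1.
  have -> : Ref (fun=> 0 : R[i]) = cst 0 by [].
  by rewrite derive1_cst (_ : _ +i* _ = 0)// cabs0.
Qed.

(** Translation by [P] leaves [mu1] unchanged; on [mu2] it acts as translation by
[P - Q * alpha]. *)
Lemma translate_sum_per mu1 mu2 (alpha : R) (P Q : nat) (d : R) : d = P%:R - Q%:R * alpha ->
  periodic_measure 1 mu1 -> periodic_measure alpha mu2 ->
  forall B, bounded_borel B ->
  ((mu1 \+ mu2) \- measure_translate P%:R (mu1 \+ mu2)) B =
  (mu2 \- measure_translate d mu2) B.
Proof.
move=> dE per1 per2 B bB; rewrite /= /measure_translate /=.
have e1 := periodic_natmul P per1 bB; rewrite mulr1 in e1.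
have e2 := periodic_natmul Q per2 (shift_bounded_borel d bB).
rewrite /measure_translate shift_shift in e2.
have dQ : d + Q%:R * alpha = P%:R by rewrite dE subrK.
rewrite dQ in e2; rewrite -[mu1 [set _ | _ in _]]/(measure_translate P%:R mu1 B) e1 e2.
ring.
Qed.

(** The exponent [n] is chosen such that [e ^ C <= 2 ^ n], so the approximation property absorbs
the weight; the periods are the numerators [P]. *)
Theorem weak_gordon_sum mu1 mu2 alpha C : Mlocunif mu1 -> Mlocunif mu2 ->
  periodic_measure 1 mu1 -> periodic_measure alpha mu2 -> 0 < C ->
  (forall (n : nat) (e X : R), 0 < e -> exists P Q : nat,
    X <= P%:R /\ 2 ^+ (n * P) * (P%:R + 2) * `|P%:R - Q%:R * alpha| <= e) ->
  weak_gordon C (mu1 \+ mu2).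
Proof.
move=> M1 M2 per1 per2 C0 approx; split; first exact: MlocunifD.
have m1 := Mlocunif_clocal M1; have m2 := Mlocunif_clocal M2.
have m12 := clocalD m1 m2.
have [U U0 hU] := Vc_unif m2.
pose n := (Num.truncn (expR C)).+1.
have hn : expR C <= 2 ^+ n.
  apply: le_trans (two_pow_ge n); exact: ltW (truncnS_gt _).
have ex (m : nat) : exists PQ : nat * nat, [/\ m%:R + 1 <= PQ.1%:R :> R,
    `|PQ.1%:R - PQ.2%:R * alpha| <= 1 &
    expR (C * PQ.1%:R) * (32 * U * `|PQ.1%:R - PQ.2%:R * alpha|) <= m.+1%:R^-1].
  have e0 : 0 < (32 * U + 1)^-1 * m.+1%:R^-1 by rewrite mulr_gt0 ?invr_gt0 ?ltr0n//; lra.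
  have [P [Q [XP hP]]] := approx n _ (m%:R + 1) e0.
  exists (P, Q); split => //=.
    have i1 : (32 * U + 1)^-1 <= 1 by rewrite invf_le1; lra.
    have i2 : m.+1%:R^-1 <= 1 :> R by rewrite invf_le1 ?ltr0n// ler1n.
    have i3 : (32 * U + 1)^-1 * m.+1%:R^-1 <= 1.
      have j1 : 0 <= (32 * U + 1)^-1 by rewrite invr_ge0; lra.
      have j2 : 0 <= m.+1%:R^-1 :> R by rewrite invr_ge0.
      by apply: le_trans (ler_pM j1 j2 i1 i2) _; rewrite mulr1.
    apply: le_trans i3; apply: le_trans hP; apply: ler_peMl => //.
    have a1 : 1 <= 2 ^+ (n * P) :> R by rewrite exprn_ege1// ler1n.
    by apply: mulr_ege1 => //; have : 0 <= P%:R :> R by []; lra.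
  have eP : expR (C * P%:R) <= 2 ^+ (n * P).
    rewrite mulrC expRM_natl exprM; apply: lerXn2r => //; rewrite nnegrE ?expR_ge0//.
  set dd := `|_| in hP *.
  have dd0 : 0 <= dd by rewrite /dd.
  have h1 : 2 ^+ (n * P) * dd <= (32 * U + 1)^-1 * m.+1%:R^-1.
    apply: le_trans hP; rewrite ler_wpM2r//; apply: ler_peMr; first exact: exprn_ge0.
    by have : 0 <= P%:R :> R by []; lra.
  have h2 : expR (C * P%:R) * dd <= (32 * U + 1)^-1 * m.+1%:R^-1.
    by apply: le_trans h1; rewrite ler_wpM2r.
  have U1 : 0 < 32 * U + 1 by lra.
  have -> : m.+1%:R^-1 = (32 * U + 1) * ((32 * U + 1)^-1 * m.+1%:R^-1).
    by rewrite mulrA divff ?mul1r// gt_eqF.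
  rewrite mulrCA; apply: ler_pM => //; [lra|by rewrite mulr_ge0 ?expR_ge0|lra].
have /choice [PQ hPQ] := ex.
exists (fun m => (PQ m).1%:R); split.
- by move=> m; have [h _ _] := hPQ m; have : 0 <= m%:R :> R by []; lra.
- apply/cvgryPge => A; near=> m.
  have [h _ _] := hPQ m; have : A <= m%:R by near: m; exact: nbhs_infty_ger.
  lra.
have key (m : nat) : (0 <= (expR (C * (PQ m).1%:R))%:E *
     norm_on `[(- (PQ m).1%:R)%R, (PQ m).1%:R] ((mu1 \+ mu2) \- measure_translate (PQ m).1%:R (mu1 \+ mu2))%R <=
     (m.+1%:R^-1)%:E)%E.
  have [_ d1 h] := hPQ m; set P := (PQ m).1 in d1 h *; set Q := (PQ m).2 in d1 h *.
  apply/andP; split.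
    rewrite mule_ge0// ?lee_fin ?expR_ge0//; apply: norm_on_ge0.
    by apply: clocalB => //; exact: clocal_translate.
  apply: (@le_trans _ _ ((expR (C * P%:R))%:E * (32 * U * `|P%:R - Q%:R * alpha|)%:E)%E); last first.
    by rewrite -EFinM lee_fin.
  apply: lee_pmul => //.
    by apply: norm_on_ge0; apply: clocalB => //; exact: clocal_translate.
  apply: le_trans (norm_on_sub_translate `[- P%:R, P%:R]%classic m2 U0 hU d1).
  apply: ub_ereal_sup => _ [u lu <-]; apply: ereal_sup_ubound; exists u => //.
  congr (_%:E); congr cabs; apply: lint_ext => B bB.
  by rewrite (translate_sum_per (erefl (P%:R - Q%:R * alpha)) per1 per2 bB).
apply: (@squeeze_cvge _ _ _ _ (fun=> 0%E) _ (fun m => (m.+1%:R^-1)%:E)).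
- by apply: nearW.
- exact: cvg_cst.
- apply: cvg_EFin; first by apply: nearW.
  exact: cvg_harmonic.
Unshelve. all: by end_near. Qed.

End WeakGordon.

(** * Absence of eigenvalues *)

Section PeriodicDistribution.
Context {R : realType}.
Implicit Types (mu : set_function R) (f u : R -> R[i]) (p x y : R).

Definition distr mu := stieltjes_prim mu (fun=> 1).

Lemma distr_diff mu x y : clocal mu -> x <= y -> distr mu y - distr mu x = mu `]x, y]%classic.
Proof. by move=> mP xy; rewrite /distr stieltjes_prim_diff// ?cS_cst ?mul1r//; exact: clbm_cst. Qed.

Lemma distr_clbm mu : clocal mu -> clbm (distr mu).
Proof. by move=> mP; apply: stieltjes_prim_clbm => //; exact: clbm_cst. Qed.

Lemma distrD mu1 mu2 x : clocal mu1 -> clocal mu2 ->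
  distr (mu1 \+ mu2) x = distr mu1 x + distr mu2 x.
Proof.
move=> m1 m2; have m12 := clocalD m1 m2.
rewrite /distr /stieltjes_prim /orient; case: ifP => _; rewrite !cS_cst// !mul1r//.
by rewrite opprD.
Qed.

Lemma oc_bounded_borel (a b : R) : bounded_borel (`]a, b]%classic : set (measurableTypeR R)).
Proof. by split; [exact: measurable_itv|apply/bounded_setP; exact: has_bound_oc]. Qed.

(** The increment over a period does not depend on where the period starts. *)
Lemma distr_periodic mu p x : clocal mu -> 0 < p -> periodic_measure p mu ->
  distr mu (x + p) = distr mu x + mu `]0, p]%classic.
Proof.
move=> mP p0 per.
have step y z : y <= z -> distr mu (z + p) - distr mu z = distr mu (y + p) - distr mu y.
  move=> yz; have yzp : y + p <= z + p by rewrite lerD2r.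
  have := distr_diff mP yzp; rewrite -shift_oc -[mu _]/(measure_translate p mu _).
  rewrite per; last exact: oc_bounded_borel.
  rewrite -(distr_diff mP yz) => /eqP; rewrite subr_eq => /eqP ->; ring.
have e0 : distr mu (0 + p) - distr mu 0 = mu `]0, p]%classic.
  by rewrite add0r distr_diff// ltW.
have : distr mu (x + p) - distr mu x = mu `]0, p]%classic.
  by rewrite -e0; have [x0|/ltW x0] := leP 0 x; [exact: step|rewrite (step x 0)].
by move=> <-; ring.
Qed.

Definition mean_density mu p : R[i] := mu `]0, p]%classic / p%:C.

(** Removing the mean growth from the distribution function of a [p]-periodic measure leaves a
[p]-periodic function, which is bounded. *)
Definition periodic_part mu p x : R[i] := distr mu x - x%:C * mean_density mu p.

Lemma periodic_part_periodic mu p x : clocal mu -> 0 < p -> periodic_measure p mu ->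
  periodic_part mu p (x + p) = periodic_part mu p x.
Proof.
move=> mP p0 per; rewrite /periodic_part (distr_periodic _ mP p0 per) rmorphD mulrDl.
have -> : p%:C * mean_density mu p = mu `]0, p]%classic.
  rewrite /mean_density mulrCA divff ?mulr1//.
  by apply/eqP => /(congr1 (@complex.Re R)) /= p00; rewrite p00 ltxx in p0.
ring.
Qed.

Lemma periodic_part_clbm mu p : clocal mu -> clbm (periodic_part mu p).
Proof.
move=> mP; have cd := distr_clbm mP.
have cid : clbm (fun x : R => x%:C) by apply: clbm_real; apply: lbm_continuous => x; exact: cvg_id.
by rewrite /periodic_part; clbm_tac.
Qed.

Lemma periodicDn f p n x : (forall x, f (x + p) = f x) -> f (x + n%:R * p) = f x.
Proof.
move=> per; elim: n => [|n IH]; first by rewrite mul0r addr0.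
by rewrite -natr1 mulrDl mul1r addrA per.
Qed.

Lemma periodicBn f p n x : (forall x, f (x + p) = f x) -> f (x - n%:R * p) = f x.
Proof. by move=> per; rewrite -(periodicDn n (x - n%:R * p) per) subrK. Qed.

Lemma periodic_bounded f p : 0 < p -> clbm f -> (forall x, f (x + p) = f x) ->
  exists K : R, forall x, cabs (f x) <= K.
Proof.
move=> p0 cf per; have [K K0 hK] := clbm_bound (- p) p cf; exists K => x.
have claim (n : nat) : forall x : R, `|x| <= n.+1%:R * p -> cabs (f x) <= K.
  elim: n => [|n IH] z; first by rewrite mul1r ler_norml => /andP[z1 z2]; exact: hK.
  have np : 0 <= n%:R * p by rewrite mulr_ge0// ltW.
  rewrite -natr1 mulrDl mul1r => zn; have [z0|/ltW z0] := leP 0 z.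
    rewrite -(subrK p z) per; apply: IH; rewrite (ger0_norm z0) in zn.
    by rewrite ler_norml -natr1 mulrDl mul1r in zn *; apply/andP; split; lra.
  rewrite -per; apply: IH; rewrite (ler0_norm z0) in zn.
  by rewrite ler_norml -natr1 mulrDl mul1r in zn *; apply/andP; split; lra.
apply: (claim (Num.truncn (`|x| / p))).
by rewrite -ler_pdivrMr// ltW// truncnS_gt.
Qed.

(** A monotone function that dominates the increments of [periodic_part]. *)
Definition part_variation mu p x : R := variation_fun mu x + cabs (mean_density mu p) * x.

Lemma part_variation_nd mu p : clocal mu -> {homo part_variation mu p : x y / x <= y}.
Proof.
move=> mP x y xy; apply: lerD; first exact: variation_fun_nd.
by rewrite ler_wpM2l// cabs_ge0.
Qed.

Lemma periodic_part_diff mu p x y : clocal mu -> x <= y ->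
  cabs (periodic_part mu p y - periodic_part mu p x) <= part_variation mu p y - part_variation mu p x.
Proof.
move=> mP xy; rewrite /periodic_part.
have -> : distr mu y - y%:C * mean_density mu p - (distr mu x - x%:C * mean_density mu p) =
   mu `]x, y]%classic - (y - x)%:C * mean_density mu p.
  by rewrite -distr_diff// rmorphB; ring.
apply: le_trans (cabsB _ _) _; rewrite cabsM cabs_real ger0_norm ?subr_ge0//.
have := cmu_le_Vc x y mP; rewrite -(variation_fun_diff mP xy) /part_variation; lra.
Qed.

Lemma periodic_part_shift mu p x d : clocal mu ->
  cabs (periodic_part mu p (x + d) - periodic_part mu p x) <=
  part_variation mu p (x + `|d|) - part_variation mu p (x - `|d|).
Proof.
move=> mP; have nd := part_variation_nd p mP.
have [d0|/ltW d0] := leP 0 d.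
  have xd : x <= x + d by rewrite lerDl.
  apply: le_trans (periodic_part_diff p mP xd) _; rewrite (ger0_norm d0) lerD2l lerN2.
  by apply: nd; lra.
have xd : x + d <= x by rewrite gerDl.
rewrite cabsBC; apply: le_trans (periodic_part_diff p mP xd) _; rewrite (ler0_norm d0) opprK lerD2r.
by apply: nd; lra.
Qed.

End PeriodicDistribution.

Section NoEigenvalue.
Context {R : realType}.

(** Translating by [P] changes only the [alpha]-periodic part of [N], and this like a
translation by [d = P - Q * alpha]. Its difference is dominated by [V(x + |d|) - V(x - |d|)]
with [V] monotone, so that its integral over [[0, P]] is of order [|d| (P + 2)], which the
approximation property makes small against [2 ^ (- n P)]. *)
Theorem no_eigenvalue_sum (mu1 mu2 : set_function R) (alpha : R) (lambda : R[i]) :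
  0 < alpha -> clocal mu1 -> clocal mu2 ->
  periodic_measure 1 mu1 -> periodic_measure alpha mu2 ->
  (forall (n : nat) (e X : R), 0 < e -> exists P Q : nat,
    X <= P%:R /\ 2 ^+ (n * P) * (P%:R + 2) * `|P%:R - Q%:R * alpha| <= e) ->
  ~ schroedinger_eigenvalue (mu1 \+ mu2) lambda.
Proof.
move=> alpha0 m1 m2 per1 per2 approx [u [[L2 _ ccu weak] nz]].
apply: nz; apply: aeW => x; move: x.
have m12 := clocalD m1 m2; set mu := mu1 \+ mu2 in weak m12.
have [w [pu dw]] := weak_derivative m12 ccu weak.
pose N1 := periodic_part mu1 1; pose N2 := periodic_part mu2 alpha.
pose kappa := mean_density mu1 1 + mean_density mu2 alpha.
have qd := quasi_derivative kappa m12 pu dw.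
set N := fun x => stieltjes_prim mu (fun=> 1) x - x%:C * kappa in qd.
set v := fun x => w x - N x * u x in qd.
have NE x : N x = N1 x + N2 x.
  rewrite /N -/(distr mu) /mu distrD// /N1 /N2 /periodic_part /kappa; ring.
have p1 x : N1 (x + 1) = N1 x by exact: periodic_part_periodic.
have p2 x : N2 (x + alpha) = N2 x by exact: periodic_part_periodic.
have c1 : clbm N1 by exact: periodic_part_clbm.
have c2 : clbm N2 by exact: periodic_part_clbm.
have cN : clbm N by apply: (clbm_ext (f := fun x => N1 x + N2 x)) => //; exact: clbmD.
have [K1 hK1] := periodic_bounded ltr01 c1 p1.
have [K2 hK2] := periodic_bounded alpha0 c2 p2.
have NK x : cabs (N x) <= K1 + K2.
  by rewrite NE; apply: le_trans (cabsD _ _) _; exact: lerD.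
have [R0 hR0] := sol_bounded cN NK qd ccu L2.
apply: (gordon_argument cN NK qd (fun x => (hR0 x).1) (fun x => (hR0 x).2)) => n e e0.
have [X hX] := sol_decay cN NK qd ccu L2 e0.
have [U U0 hU] := Vc_unif m2.
pose W := U + cabs (mean_density mu2 alpha).
have W0 : 0 <= W by rewrite addr_ge0// cabs_ge0.
pose e' := Num.min 1 (e / (2 * W + 1)).
have W1 : 0 < 2 * W + 1 by lra.
have e'0 : 0 < e' by rewrite lt_min ltr01 divr_gt0.
have [P [Q [XP hP]]] := approx n e' X e'0.
pose d : R := P%:R - Q%:R * alpha.
have P0 : 0 <= P%:R :> R by [].
have pow1 : 1 <= 2 ^+ (n * P) :> R by rewrite exprn_ege1// ler1n.
have d1 : `|d| <= 1.
  have : `|d| <= e'.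
    apply: le_trans hP; apply: ler_peMl => //; apply: mulr_ege1 => //; lra.
  by move/le_trans; apply; rewrite ge_min lexx.
pose V := part_variation mu2 alpha.
have nV : {homo V : x y / x <= y} by exact: part_variation_nd.
have lV := lbm_nondecreasing nV.
exists P, (fun x => V (x + `|d|) - V (x - `|d|)); split.
- by apply: lbmB; [exact: lbm_shift|exact: (lbm_shift (- `|d|) lV)].
- move=> x _ _; rewrite !NE.
  have -> : N1 (x + P%:R) = N1 x by have := periodicDn P x p1; rewrite mulr1.
  have -> : N2 (x + P%:R) = N2 (x + d).
    by rewrite -(periodicDn Q (x + d) p2); congr N2; rewrite /d; ring.
  have -> : N1 x + N2 (x + d) - (N1 x + N2 x) = N2 (x + d) - N2 x by ring.
  exact: periodic_part_shift.
- move=> x _ _; rewrite !NE.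
  have -> : N1 (x - P%:R) = N1 x by have := periodicBn P x p1; rewrite mulr1.
  have -> : N2 (x - P%:R) = N2 (x - d).
    by rewrite -(periodicBn Q (x - d) p2); congr N2; rewrite /d; ring.
  have -> : N1 x + N2 (x - d) - (N1 x + N2 x) = N2 (x - d) - N2 x by ring.
  by rewrite -normrN; exact: periodic_part_shift.
- have I1 := lI_nondecreasing nV P0 (normr_ge0 d).
  have VP : V (P%:R + `|d|) - V (0 - `|d|) <= (P%:R + 2) * W.
    apply: (@le_trans _ _ (V (P%:R + 1) - V (- 1))).
      apply: lerB; apply: nV; first by rewrite lerD2l.
      by rewrite sub0r lerN2.
    have le1 : -1 <= P%:R + 1 :> R by lra.
    have := Vc_length (-1) P.+2 m2 hU.
    have -> : -1 + P.+2%:R = P%:R + 1 :> R by rewrite -addn2 natrD; ring.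
    rewrite -(variation_fun_diff m2 le1) -addn2 natrD /V /part_variation /W.
    by rewrite !mulrDr !mulrDl; lra.
  have d0 : 0 <= `|d| by [].
  have pw0 : 0 <= 2 ^+ (n * P) :> R by exact: exprn_ge0.
  have I2 : lI (fun x => V (x + `|d|) - V (x - `|d|)) 0 P%:R <= 2 * `|d| * ((P%:R + 2) * W).
    by apply: le_trans I1 _; rewrite ler_wpM2l// mulr_ge0.
  apply: le_trans (ler_wpM2l pw0 I2) _.
  have -> : 2 ^+ (n * P) * (2 * `|d| * ((P%:R + 2) * W)) =
     2 * W * (2 ^+ (n * P) * (P%:R + 2) * `|d|) by ring.
  have hP' : 2 ^+ (n * P) * (P%:R + 2) * `|d| <= e / (2 * W + 1).
    by apply: le_trans hP _; rewrite ge_min lexx orbT.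
  have W20 : 0 <= 2 * W by lra.
  apply: le_trans (ler_wpM2l W20 hP') _; rewrite mulrA ler_pdivrMr// mulrC ler_pM2l//; lra.
- split; apply: hX.
  + by apply: le_trans XP (ler_norm _).
  + by rewrite ger0_norm; lra.
  + by rewrite normrN; apply: le_trans XP (ler_norm _).
Qed.

End NoEigenvalue.

(** * The theorem *)

Theorem mainTheorem5 (R : realType) (alpha : R) (mu1 mu2 : set_function R)
    (alpha_gt0 : 0 < alpha) (alpha_irr : irrational alpha)
    (mu1_locunif : Mlocunif mu1) (mu2_locunif : Mlocunif mu2)
    (mu1_per : periodic_measure 1 mu1) (mu2_per : periodic_measure alpha mu2)
    (approx : exists (B : R) (p : nat -> int) (q : nat -> nat),
      0 < B /\
      forall m : nat, (0 < m)%N ->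
        (0 < q m)%N /\
        `|alpha - (p m)%:~R / (q m)%:R| <= B * m%:R ^- q m) :
  (forall C : R, 0 < C -> weak_gordon C (mu1 \+ mu2)) /\
  (forall lambda : R[i], ~ schroedinger_eigenvalue (mu1 \+ mu2) lambda).
Proof.
have [B [p [q [B0 hpq]]]] := approx.
have close := superexponential_approx alpha_gt0 alpha_irr B0 hpq.
split=> [C C0|lambda].
  exact: weak_gordon_sum mu1_locunif mu2_locunif mu1_per mu2_per C0 close.
exact: no_eigenvalue_sum alpha_gt0 (Mlocunif_clocal mu1_locunif)
  (Mlocunif_clocal mu2_locunif) mu1_per mu2_per close.
Qed.
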